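(* Let $\alpha,s\in(0,1)$, $H_1,H_2\in(0,\tfrac12]$, $T>0$, and let $f$ be a deterministic mapping with $\|f(v)\|_{L^2(D)}\le C_f(1+\|v\|_{L^2(D)})$ and $\|f(v)-f(w)\|_{L^2(D)}\le C_f\|v-w\|_{L^2(D)}$ for all $v,w\in L^2(D)$ and some constant $C_f>0$. Let $u$ be the (mild) solution of the stochastic time-space fractional diffusion equation $\partial_t u+{}_0\partial_t^{1-\alpha}A^s u=f(u)+\xi^{H_1,H_2}$ in $D\times(0,T]$ with zero initial value and zero Dirichlet boundary condition. Assume $\frac{2sH_2}{\alpha}+H_1-1>0$ and $H_1+2s-1>0$. Then for every $\sigma$ with $2\sigma\in\left[0,\min\{\frac{2sH_2}{\alpha}+H_1-1,\;H_1+2s-1\}\right)$ there is a constant $C$ such that for all $t\in[0,T]$ $$\mathbb{E}\|A^{\sigma}u(t)\|_{L^2(D)}^2\le C.$$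
   Context: $D=(0,1)$. $A=-\Delta$ on $D$ with zero Dirichlet boundary condition, with non-decreasing eigenvalues $\lambda_k$ and $L^2$-normalized eigenfunctions $\phi_k$, $k\ge1$; $A^{q}v=\sum_{k}\lambda_k^{q}(v,\phi_k)\phi_k$, where $(\cdot,\cdot)$ is the $L^2(D)$ inner product. ${}_0\partial_t^{1-\alpha}u=\frac{1}{\Gamma(\alpha)}\frac{\partial}{\partial t}\int_0^t(t-r)^{\alpha-1}u(r)dr$ is the Riemann--Liouville derivative. $E_{\alpha,\beta}(z)=\sum_{k\ge0}z^k/\Gamma(k\alpha+\beta)$ is the Mittag--Leffler function. Noise: $\xi^{H_1,H_2}=\frac{\partial^2W^{H_1,H_2}}{\partial x\partial t}$, where $W^{H_1,H_2}$ is a fractional Brownian sheet on $D\times[0,T]$, i.e. a centered Gaussian field on a stochastic basis $(\Omega,\mathcal F,(\mathcal F_t)_{t\in[0,T]},\mathbb P)$ with $\mathbb{E}[W^{H_1,H_2}(x,t)W^{H_1,H_2}(y,r)]=\frac{x^{2H_1}+y^{2H_1}-|x-y|^{2H_1}}{2}\cdot\frac{t^{2H_2}+r^{2H_2}-|t-r|^{2H_2}}{2}$. Integrals $\int\!\int g(y,r)\xi^{H_1,H_2}(y,r)\,dy\,dr$ of deterministic $g$ are Wiener integrals with respect to $W^{H_1,H_2}$ (rectangular increments for indicator functions, extended linearly and by $L^2(\Omega)$-closure). Mild solution: $u$ satisfies $u(x,t)=\int_0^t\mathcal S(t-r)f(u(r))dr+\int_0^t\int_D G(t-r,x,y)\xi^{H_1,H_2}(y,r)dydr$,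 where $\mathcal S(t)v=\sum_{k\ge1}E_{\alpha,1}(-\lambda_k^st^\alpha)(v,\phi_k)\phi_k$ and $G(t,x,y)=\sum_{k\ge1}E_{\alpha,1}(-\lambda_k^st^\alpha)\phi_k(x)\phi_k(y)$. *)

(* Defs.v *)
From HB Require Import structures.
From mathcomp Require Import all_boot all_order all_algebra.
From mathcomp Require Import all_classical all_reals all_analysis.

Set Implicit Arguments.
Unset Strict Implicit.
Unset Printing Implicit Defensive.

Import Order.TTheory GRing.Theory Num.Theory.
Import numFieldNormedType.Exports.

Local Open Scope classical_set_scope.
Local Open Scope ring_scope.

(** * Special functions *)

Definition gamma_fun {R : realType} (x : R) : R :=
  \int[lebesgue_measure]_(t in `]0, +oo[) (t `^ (x - 1) * expR (- t)).

Definition mittag_leffler {R : realType} (a b z : R) : R :=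
  limn (series (fun k : nat => z ^+ k / gamma_fun (k%:R * a + b))).

(** * The space L^2(D), D = (0, 1) *)

Definition D {R : realType} : set (measurableTypeR R) := `]0, 1[.

Lemma measurable_D {R : realType} : measurable (@D R).
Proof. exact: measurable_itv. Qed.

Definition lebD (R : realType) : {measure set (measurableTypeR R) -> \bar R} :=
  mrestr lebesgue_measure (@measurable_D R).

(** Elements are functions on the whole line that are square integrable over D,
    not classes: equality in L^2(D) is [L2norm (v - w) = 0], and the values
    outside D carry no information. *)
Definition L2D (R : realType) := LfunType (lebD R) (lee1n 2).

Definition L2norm {R : realType} (v : L2D R) : R :=
  fine ('N[lebD R]_2%:R%:E [EFin \o v])%E.

Definition inner {R : realType} (v w : L2D R) : R :=
  \int[lebD R]_x (v x * w x).

Definition L2cvg {R : realType} (v : nat -> L2D R) (w : L2D R) : Prop :=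
  (fun n => L2norm (v n - w)) @ \oo --> (0 : R).

(** Equal to 0 when the sequence does not converge. *)
Definition L2lim {R : realType} (v : nat -> L2D R) : L2D R :=
  xget 0 [set w | L2cvg v w].

(** * The operator A: minus the Dirichlet Laplacian on D *)

Record dirichlet_eigenpair {R : realType} (l : R) (p : L2D R) : Prop := {
  eigen_continuous : {within `[0, 1], continuous (p : R -> R)};
  eigen_left : p 0 = 0;
  eigen_right : p 1 = 0;
  eigen_derivable : forall x : R, 0 < x < 1 ->
    derivable (p : R -> R) x 1 /\ derivable (derive1 (p : R -> R)) x 1;
  eigen_eq : forall x : R, 0 < x < 1 -> - derive1n 2 (p : R -> R) x = l * p x
}.

(** Completeness makes [lam] an enumeration, with multiplicity, of the whole
    spectrum. The index k stands for k + 1 in the usual numbering. *)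
Record dirichlet_eigensystem {R : realType} (lam : nat -> R)
    (phi : nat -> L2D R) : Prop := {
  eigensystem_pair : forall k, dirichlet_eigenpair (lam k) (phi k);
  eigensystem_nondecreasing : forall j k, (j <= k)%N -> lam j <= lam k;
  eigensystem_orthonormal : forall j k, inner (phi j) (phi k) = (j == k)%:R;
  eigensystem_complete : forall v : L2D R,
    (forall k, inner v (phi k) = 0) -> L2norm v = 0
}.

(** Partial sums of [\sum_k c k * (v, phi k) * phi k]. *)
Definition spectral_psum {R : realType} (phi : nat -> L2D R) (c : nat -> R)
    (v : L2D R) (n : nat) : L2D R :=
  \sum_(0 <= k < n) (c k * inner v (phi k)) *: phi k.

Definition dom_Apow {R : realType} (lam : nat -> R) (phi : nat -> L2D R)
    (q : R) : set (L2D R) :=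
  [set v | exists w, L2cvg (spectral_psum phi (fun k => lam k `^ q) v) w].

Definition Apow {R : realType} (lam : nat -> R) (phi : nat -> L2D R) (q : R)
    (v : L2D R) : L2D R :=
  L2lim (spectral_psum phi (fun k => lam k `^ q) v).

Definition sol_op {R : realType} (lam : nat -> R) (phi : nat -> L2D R)
    (alpha s t : R) (v : L2D R) : L2D R :=
  L2lim (spectral_psum phi
    (fun k => mittag_leffler alpha 1 (- (lam k `^ s * t `^ alpha))) v).

(** * The Bochner integral of an L^2(D)-valued function *)

Record L2simple (R : realType) := {
  sim_size : nat;
  sim_set : 'I_sim_size -> set (measurableTypeR R);
  sim_vec : 'I_sim_size -> L2D R;
  sim_meas : forall i, measurable (sim_set i)
}.
Arguments sim_set {R} l i.
Arguments sim_vec {R} l i.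

Definition sim_val {R : realType} (g : L2simple R) (r : R) : L2D R :=
  \sum_i (\1_(sim_set g i) r : R) *: sim_vec g i.

Definition sim_int {R : realType} (E : set R) (g : L2simple R) : L2D R :=
  \sum_i fine (lebesgue_measure (sim_set g i `&` E)) *: sim_vec g i.

(** [w] is the integral of [F] over the bounded interval [E]. *)
Definition is_bochner {R : realType} (E : set R) (F : R -> L2D R)
    (w : L2D R) : Prop :=
  exists g : nat -> L2simple R,
    [/\ {ae lebesgue_measure, forall r, E r -> L2cvg (sim_val^~ r \o g) (F r)},
        (fun n => \int[lebesgue_measure]_(r in E)
                    (L2norm (sim_val (g n) r - F r))%:E)%E @ \oo --> 0%E
      & L2cvg (sim_int E \o g) w].

(** * Fractional Brownian sheet and Wiener integrals *)

(** The library's [normal_prob m 0] is not a Dirac mass, so the degenerate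
    Gaussian law is treated apart. *)
Definition centered_gaussian {R : realType} d (Omega : measurableType d)
    (P : probability Omega R) (X : Omega -> R) : Prop :=
  {ae P, forall w, X w = 0} \/
  exists2 sigma : R, 0 < sigma &
    forall B : set (measurableTypeR R), measurable B ->
      P (X @^-1` B) = normal_prob 0 sigma B.

Definition fbm_cov {R : realType} (H x y : R) : R :=
  (x `^ (2 * H) + y `^ (2 * H) - `|x - y| `^ (2 * H)) / 2.

(** [W x t] matters only for x in D and t in [0, T]. *)
Record fractional_brownian_sheet {R : realType} d (Omega : measurableType d)
    (P : probability Omega R) (H1 H2 T : R)
    (W : R -> R -> {RV P >-> R}) : Prop := {
  fbs_gaussian : forall (n : nat) (c x t : 'I_n -> R),
    (forall i, 0 < x i < 1 /\ 0 <= t i <= T) ->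
    centered_gaussian P (fun w => \sum_i c i * W (x i) (t i) w);
  fbs_cov : forall x y t r : R, 0 < x < 1 -> 0 < y < 1 ->
    0 <= t <= T -> 0 <= r <= T ->
    ('E_P[fun w => (W x t w * W y r w)%R])%E =
      (fbm_cov H1 x y * fbm_cov H2 t r)%:E
}.

Arguments fractional_brownian_sheet {R d Omega} P H1 H2 T W.

(** A weighted rectangle [coef * 1_(]xlo, xhi] x ]tlo, thi])]. *)
Record wrect (R : realType) := {
  coef : R; xlo : R; xhi : R; tlo : R; thi : R
}.

Definition wrect_in {R : realType} (t : R) (q : wrect R) : Prop :=
  [/\ 0 < xlo q, xlo q <= xhi q & xhi q < 1] /\
  [/\ 0 <= tlo q, tlo q <= thi q & thi q <= t].

Record step_fun (R : realType) (t : R) := {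
  step_size : nat;
  step_rect : 'I_step_size -> wrect R;
  step_in : forall i, wrect_in t (step_rect i)
}.
Arguments step_rect {R t} s i.

Definition step_val {R : realType} (t : R) (g : step_fun t) (z : R * R) : R :=
  \sum_i coef (step_rect g i) *
    \1_(`]xlo (step_rect g i), xhi (step_rect g i)] `*`
        `]tlo (step_rect g i), thi (step_rect g i)]) z.

Definition step_int {R : realType} d (Omega : measurableType d)
    (P : probability Omega R) (W : R -> R -> {RV P >-> R}) (t : R)
    (g : step_fun t) (w : Omega) : R :=
  \sum_i let q := step_rect g i in
    coef q * (W (xhi q) (thi q) w - W (xlo q) (thi q) w
              - W (xhi q) (tlo q) w + W (xlo q) (tlo q) w).

(** Convergence in L^2(D x (0, t)), the space variable coming first. *)
Definition L2cvg_Dt {R : realType} (t : R) (g : nat -> R * R -> R)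
    (h : R * R -> R) : Prop :=
  (fun n => \int[lebesgue_measure \x lebesgue_measure]_(z in D `*` `]0%R, t[)
              ((g n z - h z) ^+ 2)%:E)%E @ \oo --> 0%E.

(** [X] is (a version of) the integral of [h] over D x (0, t) against the noise:
    the extension by closure of [step_int]. For H1, H2 <= 1/2, which is the only
    case in which it is used, [step_int] is closable from L^2(D x (0, t)) to
    L^2(Omega) and the domain of its closure is the usual Hilbert space of the
    sheet, so [X] is determined by [h] almost surely. *)
Definition is_wiener_integral {R : realType} d (Omega : measurableType d)
    (P : probability Omega R) (W : R -> R -> {RV P >-> R}) (t : R)
    (h : R * R -> R) (X : Omega -> R) : Prop :=
  measurable_fun setT X /\
  exists g : nat -> step_fun t,
    L2cvg_Dt t (fun n => step_val (g n)) h /\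
    (fun n => \int[P]_w ((step_int W (g n) w - X w) ^+ 2)%:E)%E @ \oo --> 0%E.

(** * Mild solutions *)

(** Partial sums of [G (t - r) x y] as functions of [z = (y, r)]. *)
Definition green_psum {R : realType} (lam : nat -> R) (phi : nat -> L2D R)
    (alpha s t x : R) (n : nat) (z : R * R) : R :=
  \sum_(0 <= k < n)
    mittag_leffler alpha 1 (- (lam k `^ s * (t - z.2) `^ alpha))
      * phi k x * phi k z.1.

(** [h] is the function [(y, r) |-> G (t - r) x y] on D x (0, t); as in
    [sol_op], the eigenfunction expansion is summed in the L^2 sense. *)
Definition is_green {R : realType} (lam : nat -> R) (phi : nat -> L2D R)
    (alpha s t x : R) (h : R * R -> R) : Prop :=
  measurable_fun (D `*` `]0, t[ : set (measurableTypeR R * measurableTypeR R)%type) h /\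
  L2cvg_Dt t (green_psum lam phi alpha s t x) h.

(** [O w] is [x |-> \int_0^t \int_D G (t - r) x y xi (y, r) dy dr]. *)
Definition is_stoch_conv {R : realType} d (Omega : measurableType d)
    (P : probability Omega R) (W : R -> R -> {RV P >-> R})
    (lam : nat -> R) (phi : nat -> L2D R) (alpha s t : R)
    (O : Omega -> L2D R) : Prop :=
  measurable_fun (setT `*` D : set (Omega * measurableTypeR R)%type)
    (fun z : Omega * measurableTypeR R => O z.1 z.2) /\
  {ae lebD R, forall x, exists h, is_green lam phi alpha s t x h /\
                          is_wiener_integral W t h (fun w => O w x)}.

(** Mild solution with zero initial value, as an L^2(D)-valued process: a jointly
    measurable field with square integrable paths for which the mild formulation
    holds almost surely at every time. *)
Record mild_solution {R : realType} d (Omega : measurableType d)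
    (P : probability Omega R) (W : R -> R -> {RV P >-> R})
    (lam : nat -> R) (phi : nat -> L2D R) (alpha s T : R)
    (f : L2D R -> L2D R) (u : R -> Omega -> L2D R) : Prop := {
  mild_measurable : measurable_fun
    (`[0, T] `*` setT `*` D :
      set (measurableTypeR R * Omega * measurableTypeR R)%type)
    (fun z : measurableTypeR R * Omega * measurableTypeR R => u z.1.1 z.1.2 z.2);
  mild_integrable : {ae P, forall w,
    (\int[lebesgue_measure]_(r in `[0%R, T]) (L2norm (u r w) ^+ 2)%:E < +oo)%E};
  mild_eq : forall t : R, 0 <= t <= T ->
    exists2 O : Omega -> L2D R, is_stoch_conv W lam phi alpha s t O &
    {ae P, forall w, exists2 b : L2D R,
       is_bochner `]0, t[ (fun r => sol_op lam phi alpha s (t - r) (f (u r w))) b &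
       {ae lebD R, forall x, u t w x = b x + O w x}}
}.
Arguments mild_solution {R d Omega} P W lam phi alpha s T f u.

(* Main.v *)
(** The Mittag-Leffler relaxation E(-lam^s t^alpha) is nonincreasing with values in
    [0, 1], and bounded by C lam^(-s g) t^(-alpha g) for every g in [0, 1]. This is
    obtained from discrete approximations: coefficients of powers of 1 - z, for which
    sign and monotonicity are immediate.

    For H <= 1/2 the covariance of fractional Brownian motion is the inner product of
    the Hartley transforms of indicators, weighted by |xi|^(1/2 - H). Hence the variance
    of a Wiener integral is a weighted L^2 norm of the transform of its integrand, and
    the k-th mode of the stochastic convolution has variance at most
    C lam_k^(1/2 - H1 - 2 s g) as soon as alpha g < H2: the space factor is an explicit
    sine, and the time factor is transformed by using its monotonicity. As lam_k >= k^2,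
    the sum of lam_k^(2 sigma) times these variances is finite when
    2 sigma < H1 - 1 + 2 s g, and the assumption on sigma is what allows such a g.

    The drift is estimated by duality with the same bound on the relaxation. A second
    moment bound for u comes from Gronwall's lemma, applied on the event that the path
    has L^2 norm at most M, since only almost sure integrability of paths is known. *)

From HB Require Import structures.
Require Import Defs.
From mathcomp Require Import all_boot all_order all_algebra.
From mathcomp Require Import all_classical all_reals all_analysis.
From mathcomp Require Import ring lra measurable_realfun.

Import Order.TTheory GRing.Theory Num.Theory.
Import numFieldNormedType.Exports.

Local Open Scope classical_set_scope.
Local Open Scope ring_scope.

Set Implicit Arguments.
Unset Strict Implicit.
Unset Printing Implicit Defensive.

(** The signs of the relaxation come from a generating function: (1 - z)^(-y) / (1 + q (1 - z)^(-a))
    has coefficients [rfT n y], and its denominator yields recursions whose signs are fixed by 0 < a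
    < 1. With q = h^a and n h tending to t, these coefficients tend to E(-t^a). The Hartley
    transform is used so that every field stays real.

    Two obstacles shape the stochastic part. The integrands of the mild formulation are given for
    each x by an existence statement, with no measurability in x; and the coefficient of the
    stochastic convolution along phi_k is not known to be a Wiener integral, which would take a
    stochastic Fubini theorem. Both are avoided by a deterministic field with the same Gram kernel,
    jointly measurable and with explicit coefficients: the second moment of a coefficient depends on
    the Gram kernel alone.

    Moreover [L2lim] selects an arbitrary limit, and neither the drift nor [Apow] is known to be
    measurable in the sample point. Estimates are therefore made path by path against measurable
    majorants, which are integrated afterwards. *)

Section integrable_real.
Context d (T : measurableType d) (R : realType) (mu : {measure set T -> \bar R}).
Variables (D : set T) (mD : measurable D).
Implicit Types f g : T -> R.

Lemma RintegrableD f g : mu.-integrable D (EFin \o f) -> mu.-integrable D (EFin \o g) ->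
  mu.-integrable D (EFin \o (fun x => f x + g x)).
Proof. by move=> hf hg; have := integrableD mD hf hg; apply: eq_integrable. Qed.

Lemma RintegrableB f g : mu.-integrable D (EFin \o f) -> mu.-integrable D (EFin \o g) ->
  mu.-integrable D (EFin \o (fun x => f x - g x)).
Proof. by move=> hf hg; have := integrableB mD hf hg; apply: eq_integrable. Qed.

Lemma RintegrableZ (c : R) f : mu.-integrable D (EFin \o f) ->
  mu.-integrable D (EFin \o (fun x => c * f x)).
Proof. by move=> hf; have := integrableZl mD c hf; apply: eq_integrable. Qed.

Lemma Rintegrable_le f g : measurable_fun D f -> mu.-integrable D (EFin \o g) ->
  (forall x, D x -> `|f x| <= g x) -> mu.-integrable D (EFin \o f).
Proof.
move=> mf hg fg; apply: (le_integrable mD _ _ hg); first exact/measurable_EFinP.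
by move=> x Dx /=; rewrite lee_fin (le_trans (fg x Dx))// ler_norm.
Qed.

Lemma RintegralE f : mu.-integrable D (EFin \o f) ->
  (\int[mu]_(x in D) (f x)%:E = (\int[mu]_(x in D) f x)%R%:E)%E.
Proof. by move=> hf; rewrite /Rintegral fineK//; exact: integrable_fin_num. Qed.

End integrable_real.

Lemma powRDp {R : realType} (x r s : R) : 0 < x -> x `^ (r + s) = x `^ r * x `^ s.
Proof. by move=> x0; rewrite powRD// (gt_eqF x0) implybT. Qed.

Lemma cvg_mul1 {R : realType} (f g : nat -> R) :
  f @ \oo --> (1 : R) -> g @ \oo --> (1 : R) -> (fun n => f n * g n) @ \oo --> (1 : R).
Proof. by move=> f1 g1; rewrite -[X in _ --> X](mulr1 (1 : R)); apply: cvgM. Qed.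

Lemma one_powR {R : realType} (r : R) : 1 `^ r = 1.
Proof. by rewrite powR1. Qed.

(** * Complete monotonicity bounds for the Mittag-Leffler function *)

Section rising.
Context {R : realType}.
Implicit Types (x y q a : R) (n : nat).

(* The coefficient of z^n in (1 - z)^(-x); hence the Vandermonde convolution. *)
Definition rf n x : R := \prod_(i < n) ((x + i%:R) / i.+1%:R).

Lemma rf0 x : rf 0 x = 1. Proof. by rewrite /rf big_ord0. Qed.

Lemma rfS n x : rf n.+1 x = rf n x * ((x + n%:R) / n.+1%:R).
Proof. by rewrite /rf big_ord_recr. Qed.

Lemma rfSM n x : n.+1%:R * rf n.+1 x = (x + n%:R) * rf n x.
Proof. by rewrite rfS mulrC -mulrA divfK ?pnatr_eq0// mulrC. Qed.

Lemma rf_ge0 n x : 0 <= x -> 0 <= rf n x.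
Proof. by move=> x0; apply: prodr_ge0 => i _; rewrite divr_ge0// addr_ge0. Qed.

Lemma rf1 n : rf n 1 = 1.
Proof.
apply: big1 => i _; rewrite (_ : 1 + _ = i.+1%:R) ?divff ?pnatr_eq0//.
by rewrite -natr1 addrC.
Qed.

(** Induction after multiplying by n + 1: writing n + 1 = j + (n + 1 - j) lets [rfSM] act on one
    factor of each summand, and the two sums recombine into (x + y + n) times the previous one. *)
Lemma rf_Vandermonde n x y :
  \sum_(j < n.+1) rf j x * rf (n - j) y = rf n (x + y).
Proof.
elim: n => [|n IH]; first by rewrite big_ord1 !rf0 mulr1.
apply: (@mulfI _ n.+1%:R); first by rewrite pnatr_eq0.
rewrite rfSM -IH [in LHS]mulr_sumr.
have -> : \sum_(j < n.+2) n.+1%:R * (rf j x * rf (n.+1 - j) y) =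
  \sum_(j < n.+2) (j%:R * rf j x * rf (n.+1 - j) y) +
  \sum_(j < n.+2) (rf j x * ((n.+1 - j)%:R * rf (n.+1 - j) y)).
  rewrite -big_split/=; apply: eq_bigr => j _.
  have jn : (j <= n.+1)%N by rewrite -ltnS.
  rewrite -{1}(subnK jn) natrD; ring.
rewrite big_ord_recl/= !mul0r add0r [X in _ + X]big_ord_recr/= subnn mul0r mulr0 addr0.
rewrite -big_split/= mulr_sumr; apply: eq_bigr => i _.
have jn : (i <= n)%N by rewrite -ltnS.
rewrite /bump/= add1n rfSM subSS subSn// rfSM natrB//; ring.
Qed.

(** Crude, but for fixed n it is polynomial in x, which suffices for [rfT_normed], where x grows
    linearly along a geometric series. *)
Lemma rf_norm n x : `|rf n x| <= (1 + `|x|) ^+ n.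
Proof.
rewrite /rf normr_prod -[n in leRHS]card_ord -prodr_const; apply: ler_prod => i _.
rewrite normr_ge0/= normrM normfV [X in _ / X]ger0_norm// ler_pdivrMr//.
rewrite (le_trans (ler_normD _ _))// [X in _ + X]ger0_norm// mulrDl mul1r addrC.
by rewrite lerD ?ler_nat// ler_peMr// ler1n.
Qed.

(** The first factor is -a and all later ones are nonnegative: after its constant term, (1 - z)^a
    has nonpositive coefficients. The sign results on [rfT] below all come from this. *)
Lemma rf_neg n a : 0 < a < 1 -> rf n.+1 (- a) <= 0.
Proof.
move=> /andP[a0 a1]; elim: n => [|n IH].
  by rewrite rfS rf0 mul1r addr0 divr1 oppr_le0 ltW.
rewrite rfS; apply: mulr_le0_ge0 => //; rewrite divr_ge0//.
by rewrite addrC subr_ge0 (le_trans (ltW a1))// ler1n.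
Qed.

Lemma rf_sum n x : \sum_(j < n.+1) rf j x = rf n (x + 1).
Proof. by rewrite -rf_Vandermonde; apply: eq_bigr => j _; rewrite rf1 mulr1. Qed.

Lemma cvg_sum_ord n (f : 'I_n -> nat -> R) (l : 'I_n -> R) :
  (forall j, f j @ \oo --> l j) ->
  (fun k => \sum_(j < n) f j k) @ \oo --> \sum_(j < n) l j.
Proof.
by move=> fl; apply: cvg_big => // j; exact: add_continuous.
Qed.

End rising.

Section risingT.
Context {R : realType}.
Variables (a q : R).
Hypotheses (a01 : 0 < a < 1) (q01 : 0 < q < 1).
Implicit Types (x y : R) (n : nat).

Let tt n y (m : nat) : R := (- q) ^+ m * rf n (m%:R * a + y).

(* A discrete Mittag-Leffler function: [rfT n y] is the coefficient of z^n in
   (1 - z)^(-y) / (1 + q (1 - z)^(-a)), so that [rfT n 1] is the partial sum of the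
   [rfT j 0], which are nonpositive for j > 0. *)
Definition rfT n y : R := limn (series (tt n y)).

Lemma rfT_normed n y : cvgn (series (fun m => `|tt n y m|)).
Proof.
move: a01 q01 => /andP[a0 a1] /andP[q0 q1].
(* q^m = e^(-2 u m). Half of this decay absorbs the growth of [rf], through 1 + |x| <= dl^(-1) e^(dl
   |x|) with dl <= 1 so small that n dl a <= u; the other half is the geometric majorant. *)
pose u := - ln q / 2.
have u0 : 0 < u by rewrite divr_gt0// oppr_gt0 ln_lt0// q0.
pose dl := u / (u + n%:R * a + 1).
have den0 : 0 < u + n%:R * a + 1 by rewrite !ltr_wpDr// mulr_ge0// ltW.
have dl0 : 0 < dl by rewrite divr_gt0.
have dl1 : dl <= 1.
  by rewrite ler_pdivrMr// mul1r -addrA ler_wpDr// addr_ge0// mulr_ge0// ltW.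
have dlu : dl * (n%:R * a) <= u.
  rewrite /dl mulrAC ler_pdivrMr// ler_pM2l// -addrA addrC -addrA ler_wpDr//.
  by rewrite addr_ge0// ltW.
have qE : q = expR (- (u + u)) by rewrite /u -splitr opprK lnK// posrE.
pose K := dl ^- n * expR (dl * `|y|) ^+ n.
have K0 : 0 <= K by rewrite mulr_ge0// ?exprn_ge0 ?expR_ge0// invr_ge0 exprn_ge0// ltW.
apply: (@series_le_cvg _ _ (geometric K (expR (- u)))) => //.
- by move=> m; rewrite /= mulr_ge0// exprn_ge0// expR_ge0.
- move=> m; rewrite /= /tt normrM normrX normrN (gtr0_norm q0).
  have h : `|rf n (m%:R * a + y)| <= K * expR (dl * (m%:R * a)) ^+ n.
    apply: (le_trans (rf_norm _ _)); rewrite /K -mulrA -exprMn -expRD -exprVn -exprMn.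
    apply: lerXn2r; rewrite ?nnegrE ?addr_ge0// ?mulr_ge0 ?invr_ge0 ?expR_ge0 ?(ltW dl0)//.
    rewrite ler_pdivlMl// (le_trans _ (expR_ge1Dx _))// mulrDr mulr1 lerD//.
    rewrite -mulrDr ler_pM2l// (le_trans (ler_normD _ _))// addrC lerD2l ger0_norm//.
    by rewrite mulr_ge0// ltW.
  apply: (le_trans (ler_wpM2l _ h)); first by rewrite exprn_ge0// ltW.
  rewrite mulrCA; apply: ler_wpM2l => //.
  rewrite qE -!expRM_natl -expRD ler_expR -subr_ge0.
  set N := n%:R in dlu *; rewrite [X in 0 <= X](_ : _ = m%:R * (u - dl * (N * a))); last by ring.
  by rewrite mulr_ge0// subr_ge0.
- by apply: is_cvg_geometric_series; rewrite ger0_norm ?expR_ge0// expR_lt1 oppr_lt0.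
Qed.

Lemma rfT_cvg n y : series (tt n y) @ \oo --> rfT n y.
Proof. by apply: normed_cvg; exact: rfT_normed. Qed.

(** Raising the exponent by x multiplies the generating function by (1 - z)^(-x); [rf_Vandermonde]
    does this in each term of the series. *)
Lemma rfT_add n x y : rfT n (x + y) = \sum_(j < n.+1) rf j x * rfT (n - j) y.
Proof.
apply: cvg_lim => //.
have -> : series (tt n (x + y)) =
    (fun k => \sum_(j < n.+1) rf j x * series (tt (n - j) y) k).
  apply/funext => k; rewrite /series/= /tt.
  under [RHS]eq_bigr do rewrite mulr_sumr.
  rewrite exchange_big/=; apply: eq_bigr => m _.
  rewrite (addrCA _ x) -rf_Vandermonde mulr_sumr; apply: eq_bigr => j _; ring.
by apply: cvg_sum_ord => j; apply: cvgMr; exact: rfT_cvg.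
Qed.

(** This clears the denominator 1 + q (1 - z)^(-a). In the series, dropping the first term brings
    out a factor -q and moves y to y + a. *)
Lemma rfT_shift n y : rfT n y + q * rfT n (y + a) = rf n y.
Proof.
have h : series (tt n y) \o S @ \oo --> rfT n y.
  by rewrite cvg_shiftS; exact: rfT_cvg.
have h2 : series (tt n y) \o S @ \oo --> rf n y - q * rfT n (y + a).
  have -> : series (tt n y) \o S = (fun k => rf n y - q * series (tt n (y + a)) k).
    apply/funext => k; rewrite /series/= big_nat_recl// /tt expr0 mul1r mul0r add0r.
    congr +%R; rewrite mulr_sumr -sumrN; apply: eq_bigr => i _.
    rewrite exprS -mulrA mulNr; congr (- (_ * (_ * rf _ _))).
    by rewrite -natr1; ring.
  by apply: cvgB; [exact: cvg_cst|apply: cvgMr; exact: rfT_cvg].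
by have := cvg_unique _ h h2 => ->//; rewrite subrK.
Qed.

Lemma rfT00 : 0 < rfT 0 0 < 1.
Proof.
have := rfT_shift 0 0; rewrite add0r.
have -> : rfT 0 a = rfT 0 0.
  by congr (limn (series _)); apply/funext => m; rewrite /tt !rf0.
rewrite rf0 -{1}[rfT 0 0]mul1r -mulrDl => h.
have [q0 q1] := andP q01.
have q1' : 0 < 1 + q by rewrite addr_gt0.
have -> : rfT 0 0 = (1 + q)^-1 by apply: (mulfI (lt0r_neq0 q1')); rewrite h divff ?gt_eqF.
by rewrite invr_gt0 q1'/= invf_lt1// ltrDl.
Qed.

(** [rfT_shift] with [rfT n x] expanded by [rfT_add] at exponent -a and the term j = 0 moved to the
    left. By [rf_neg] this is a recursion on n with nonnegative weights. *)
Lemma rfT_step n x : (1 + q) * rfT n (x + a) =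
  rf n x - \sum_(j < n) rf j.+1 (- a) * rfT (n - j.+1) (x + a).
Proof.
have := rfT_shift n x.
have -> : rfT n x = \sum_(j < n.+1) rf j (- a) * rfT (n - j) (x + a).
  by rewrite -rfT_add addrC addrK.
rewrite big_ord_recl/= rf0 mul1r subn0 => <-.
rewrite (_ : \sum_(i < n) _ = \sum_(j < n) rf j.+1 (- a) * rfT (n - j.+1) (x + a)).
  by ring.
by apply: eq_bigr.
Qed.

(** Strong induction on [rfT_step] at x = -a. The source [rf n.+1 (- a)] joins the last summand into
    [rf n.+1 (- a) * (1 - rfT 0 0)], which is nonpositive by [rfT00]; in the other summands, which
    are subtracted, both factors are nonpositive. *)
Lemma rfT_0_le0 n : rfT n.+1 0 <= 0.
Proof.
have [q0 q1] := andP q01; have [d0 d1] := andP rfT00.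
elim/ltn_ind: n => n IH.
have q1' : 0 < 1 + q by rewrite addr_gt0.
rewrite -(pmulr_rle0 _ q1').
have := rfT_step n.+1 (- a); rewrite addNr => ->.
rewrite big_ord_recr/= subnn opprD addrCA.
rewrite -[X in _ + (X - _)]mulr1 -mulrBr addrC.
rewrite -oppr_ge0 opprD opprK addr_ge0//.
  by rewrite oppr_ge0; apply: mulr_le0_ge0; [exact: rf_neg|rewrite subr_ge0 ltW].
apply: sumr_ge0 => j _; apply: mulr_le0; first exact: rf_neg.
rewrite subSS; have jn := ltn_ord j.
by rewrite -(subnSK jn); apply: IH; rewrite -subSn// subSS leq_subr.
Qed.

Lemma rfT_1_decr n : rfT n.+1 1 <= rfT n 1.
Proof.
have E k : rfT k 1 = \sum_(j < k.+1) rfT j 0.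
  rewrite -[1]addr0 rfT_add (reindex_inj rev_ord_inj)/=; apply: eq_bigr => j _.
  by rewrite rf1 mul1r subSS subKn// -ltnS.
by rewrite !E [leLHS]big_ord_recr/= gerDl rfT_0_le0.
Qed.

Lemma rfT_1_decr_le m n : (m <= n)%N -> rfT n 1 <= rfT m 1.
Proof.
move=> mn; have := (@nonincreasing_seqP _ _ (fun n => rfT n 1)).1 rfT_1_decr.
exact.
Qed.

(** Strong induction on [rfT_step] at x = 1 - a, where the source is nonnegative because a < 1. *)
Lemma rfT_1_ge0 n : 0 <= rfT n 1.
Proof.
have [q0 q1] := andP q01; have [a0 a1] := andP a01.
elim/ltn_ind: n => n IH.
have q1' : 0 < 1 + q by rewrite addr_gt0.
rewrite -(pmulr_rge0 _ q1') ; have := rfT_step n (1 - a); rewrite subrK => ->; rewrite subr_ge0.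
apply: (@le_trans _ _ 0); last by rewrite rf_ge0// subr_ge0 ltW.
apply: sumr_le0 => j _; apply: mulr_le0_ge0; first exact: rf_neg.
by apply: IH; rewrite ltn_subrL/= (leq_ltn_trans _ (ltn_ord j)).
Qed.

(** The discrete form of the decay E(-x) <= Gamma(a + 1) / x. In 1 = rfT n 1 + q rfT n (1 + a) the
    second term is a convolution of [rf j a] with the nonincreasing sequence [rfT _ 1], hence at
    least [rfT n 1] times the sum of the [rf j a]. *)
Lemma rfT_1_le n : rfT n 1 * (1 + q * rf n (a + 1)) <= 1.
Proof.
have [q0 q1] := andP q01; have [a0 a1] := andP a01.
rewrite -[leRHS](rf1 n) -(rfT_shift n 1) mulrDr mulr1 lerD2l mulrCA ler_pM2l//.
rewrite [1 + a]addrC rfT_add -rf_sum mulr_sumr; apply: ler_sum => j _.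
by rewrite mulrC ler_wpM2l ?rf_ge0 ?(ltW a0)// rfT_1_decr_le// leq_subr.
Qed.

End risingT.

(** * The Gamma function: functional equation, asymptotics and Gauss's limit *)

Section gamma.
Context {R : realType}.
Implicit Types (x y t : R) (n : nat).
Notation mu := (@lebesgue_measure R).

Definition gE x t : R := t `^ x * expR (- t).
(* [gJ x] is Gamma (x + 1). *)
Definition gJ x : R := \int[mu]_(t in `]0, +oo[) gE x t.

Lemma gamma_funE x : gamma_fun (x + 1) = gJ x.
Proof. by rewrite /gamma_fun /gJ addrK. Qed.

Lemma gE_ge0 x t : 0 <= gE x t.
Proof. by rewrite mulr_ge0// ?powR_ge0 ?expR_ge0. Qed.

(** With u = t / (2 x + 1), u <= e^u gives u^x <= e^(x u), and x / (2 x + 1) <= 1/2. Half of the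
    decay of e^(-t) is left over, which is all that integrability of [gE] requires. *)
Lemma powR_le_expR x t : 0 <= x -> 0 <= t ->
  t `^ x <= (2 * x + 1) `^ x * expR (t / 2).
Proof.
move=> x0 t0.
have c0 : 0 < 2 * x + 1 by rewrite ltr_wpDl// mulr_ge0.
pose u := t / (2 * x + 1).
have u0 : 0 <= u by rewrite divr_ge0// ltW.
have -> : t `^ x = (2 * x + 1) `^ x * u `^ x.
  by rewrite -powRM ?(ltW c0)// /u mulrC divfK// gt_eqF.
apply: ler_wpM2l; first exact: powR_ge0.
apply: (@le_trans _ _ (expR u `^ x)).
  apply: ge0_ler_powR; rewrite ?nnegrE ?expR_ge0//.
  by rewrite (le_trans _ (expR_ge1Dx u))// lerDr.
rewrite -expRM ler_expR /u mulrAC ler_pdivrMr// -mulrA ler_wpM2l//.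
by rewrite mulrDr mulrA mulVf ?pnatr_eq0// mul1r lerDl mulr1 invr_ge0.
Qed.

Lemma measurable_gE x : measurable_fun setT (gE x).
Proof.
apply: measurable_funM; first exact: measurable_powR.
by apply: measurableT_comp => //; exact: measurable_oppr.
Qed.

Lemma integrable_expR_half : mu.-integrable `]0, +oo[ (EFin \o (fun t : R => expR (- (t / 2)))).
Proof.
have h2 : 0 < 2^-1 :> R by rewrite invr_gt0.
have := integrable_exponential_pdf h2.
move=> /(@integrableS _ _ _ mu setT `]0%R, +oo[%classic _ measurableT (measurable_itv _) (@subsetT _ _)) h.
have := @integrableZl _ _ _ mu `]0%R, +oo[%classic (measurable_itv _) 2 _ h.
apply: eq_integrable; first exact: measurable_itv.
move=> t; rewrite inE/= in_itv/= andbT => t0.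
rewrite exponential_pdfE ?ltW// -EFinM mulrA divff ?pnatr_eq0// mul1r; congr (expR _)%:E.
by rewrite mulrC mulrN.
Qed.

Lemma integrable_gE x : 0 <= x -> mu.-integrable `]0, +oo[ (EFin \o gE x).
Proof.
move=> x0; have h := @integrableZl _ _ _ mu `]0%R, +oo[%classic (measurable_itv _) ((2 * x + 1) `^ x) _ integrable_expR_half.
apply: (@le_integrable _ _ _ mu _ (measurable_itv _) (EFin \o gE x) _ _ _ h).
  by apply/measurable_EFinP; apply: measurable_funTS; exact: measurable_gE.
move=> t /=; rewrite in_itv/= andbT => t0.
rewrite ger0_norm ?gE_ge0// ger0_norm ?mulr_ge0 ?expR_ge0 ?powR_ge0// lee_fin.
rewrite /gE (le_trans (ler_wpM2r (expR_ge0 _) (powR_le_expR x0 (ltW t0))))//.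
by rewrite -mulrA -expRD ler_wpM2l ?powR_ge0// ler_expR -subr_ge0; lra.
Qed.

Lemma integral_gE x : 0 <= x -> (\int[mu]_(t in `]0%R, +oo[) (gE x t)%:E)%E = (gJ x)%:E.
Proof.
move=> x0; rewrite /gJ /Rintegral fineK//.
by have /integrable_fin_num := integrable_gE x0; apply; exact: measurable_itv.
Qed.

Lemma powR_continuous_at x t : 0 < t -> {for t, continuous (fun t => t `^ x)}.
Proof.
move=> t0; apply: differentiable_continuous; apply/derivable1_diffP.
by apply: derivable_powR; rewrite in_itv/= t0.
Qed.

Lemma powR_continuous x : 0 <= x -> forall b, {within `[0, b], continuous (fun t => t `^ x)}.
Proof.
move=> x0 b; have [b0|b0] := ltP 0 b; last first.
  have [->|bn] := eqVneq b 0; first by rewrite set_itv1; exact: continuous_subspace1.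
  by rewrite set_itv_ge ?bnd_simp -?ltNge ?lt_neqAle ?bn//; exact: continuous_subspace0.
have [->|xn0] := eqVneq x 0.
  rewrite (_ : (fun t : R => t `^ 0) = cst 1); first by apply: continuous_subspaceT => t; exact: cvg_cst.
  by apply/funext => t; rewrite powRr0.
have xp : 0 < x by rewrite lt_neqAle eq_sym xn0.
have cont t := @powR_continuous_at x t.
apply/continuous_within_itvP => //; split.
- by move=> t; rewrite in_itv/= => /andP[t0 _]; exact: cont.
- by rewrite powR0//; exact: powR_cvg0.
- by apply: cvg_at_left_filter; exact: cont.
Qed.

Lemma cvg_powR_expR x : 0 <= x -> (fun n => gE x n%:R) @ \oo --> 0.
Proof.
move=> x0; apply: (@squeeze_cvgr _ _ _ _ (cst 0) (fun n => (2 * x + 1) `^ x * expR (- (n%:R / 2)))).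
- apply: nearW => n; rewrite gE_ge0/= /gE.
  rewrite (le_trans (ler_wpM2r (expR_ge0 _) (powR_le_expR x0 (ler0n _ n))))//.
  by rewrite -mulrA -expRD ler_wpM2l ?powR_ge0// ler_expR; lra.
- exact: cvg_cst.
- rewrite -[X in _ --> X](mulr0 ((2 * x + 1) `^ x)); apply: cvgMr.
  apply: (cvg_comp _ _ _ (@cvgr_expR R)).
  have h : 0 < 2^-1 :> R by rewrite invr_gt0.
  exact: (cvg_comp _ _ (@cvgr_idn R) (gt0_cvgMly h cvg_id)).
Qed.

Lemma is_derive_expRN t : is_derive t 1 (fun t : R => expR (- t)) (- expR (- t)).
Proof.
rewrite (_ : (fun t => _) = expR \o -%R)//.
have := @is_derive1_comp R expR -%R t _ _ (is_derive_expR _) (is_deriveN _).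
by move=> /(_ _ (is_derive_id _ _)); rewrite mulrN1.
Qed.

(** Integration by parts on [0, n]; the boundary term at 0 vanishes because x + 1 > 0, the one at n
    tends to 0 by [cvg_powR_expR]. *)
Lemma gJ_FTC x n : 0 <= x -> (0 < n)%N ->
  \int[mu]_(t in `[0, n%:R]) (gE (x + 1) t) - (x + 1) * \int[mu]_(t in `[0, n%:R]) (gE x t)
  = - gE (x + 1) n%:R.
Proof.
move=> x0 n0.
have np : 0 < n%:R :> R by rewrite ltr0n.
have cE y : 0 <= y -> {within `[0, n%:R], continuous (gE y)}.
  move=> y0 t; apply: cvgM; first exact: powR_continuous.
  apply: continuous_subspaceT => {}t; apply: continuous_comp; first exact: continuousN.
  exact: continuous_expR.
have iE y : 0 <= y -> mu.-integrable `[0, n%:R] (EFin \o gE y).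
  by move=> y0; apply: continuous_compact_integrable; [exact: segment_compact|exact: cE].
have x10 : 0 <= x + 1 by rewrite addr_ge0.
have x1p : 0 < x + 1 by rewrite ltr_wpDl.
rewrite -RintegralZl; [|exact: measurable_itv|exact: iE].
rewrite -RintegralB; [|exact: measurable_itv|exact: iE|]; last first.
  by apply: (@integrableZl _ _ _ mu _ _ (x + 1) (EFin \o gE x)); [exact: measurable_itv|exact: iE].
rewrite /Rintegral (@continuous_FTC2 _ _ (fun t => - gE (x + 1) t))//=.
- by rewrite /gE powR0 ?gt_eqF// mul0r oppr0 subr0.
- move=> t; apply: cvgB; first exact: cE.
  by apply: cvgMr; exact: cE.
- split.
  + move=> t; rewrite in_itv/= => /andP[t0 _].
    apply: derivableN; apply: derivableM; first by apply: derivable_powR; rewrite in_itv/= t0.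
    by have [] := is_derive_expRN t.
  + have /continuous_within_itvP[//|_ h _] := cE _ x10.
    by apply: cvgN.
  + have /continuous_within_itvP[//|_ _ h] := cE _ x10.
    by apply: cvgN.
- move=> t; rewrite in_itv/= => /andP[t0 _]; rewrite derive1E.
  have := is_derive1_powR (x + 1) t0 => h1.
  have h2 := is_derive_expRN t.
  rewrite derive_val addrK /gE; rewrite /GRing.scale/=; ring.
Qed.

Lemma cvg_gJ x : 0 <= x -> (fun n => \int[mu]_(t in `[0, n%:R]) (gE x t)) @ \oo --> gJ x.
Proof.
move=> x0; apply: fine_cvg; rewrite -integral_gE//.
rewrite integral_itv_obnd_cbnd; last first.
  by apply/measurable_EFinP; apply: measurable_funTS; exact: measurable_gE.
by apply: ge0_cvgn_integral; [exact: gE_ge0|exact: measurable_gE].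
Qed.

Lemma gJS x : 0 <= x -> gJ (x + 1) = (x + 1) * gJ x.
Proof.
move=> x0; have x10 : 0 <= x + 1 by rewrite addr_ge0.
apply/eqP; rewrite -subr_eq0; apply/eqP.
have h1 := cvgB (cvg_gJ x10) (@cvgMl_tmp _ _ _ _ _ (x + 1) _ (cvg_gJ x0)).
have h2 := cvgN (cvg_powR_expR x10); rewrite oppr0 in h2.
apply: (cvg_unique _ (h1 _ _)) => //; apply: cvg_trans (h2 _); apply: near_eq_cvg.
near=> n; symmetry; apply: gJ_FTC => //; near: n; exact: nbhs_infty_gt.
Unshelve. all: by end_near. Qed.

Lemma gJ0 : gJ 0 = 1.
Proof.
rewrite /gJ (_ : gE 0 = (fun t => expR (- t))); last first.
  by apply/funext => t; rewrite /gE powRr0 mul1r.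
have cN : continuous (fun t : R => expR (- t)).
  by move=> t; apply: continuous_comp; [exact: continuousN|exact: continuous_expR].
rewrite /Rintegral integral_itv_obnd_cbnd; last first.
  by apply/measurable_EFinP; apply: measurable_funTS; exact: continuous_measurable_fun.
rewrite (@ge0_continuous_FTC2y _ _ (fun t : R => - expR (- t)) _ 0).
- by rewrite oppr0 expR0 sub0e/= opprK.
- by move=> t _; exact: expR_ge0.
- exact: continuous_subspaceT.
- by rewrite -[X in _ --> X]oppr0; apply: cvgN; exact: cvgr_expR.
- by move=> t _; apply: derivableN; have [] := is_derive_expRN t.
- by apply: cvg_at_right_filter; apply: cvgN; exact: cN.
- move=> t _; rewrite derive1E; have h := is_derive_expRN t.
  by rewrite derive_val opprK.
Qed.

Lemma rf_gJ n x : 0 <= x -> rf n (x + 1) * gJ x * n`!%:R = gJ (x + n%:R).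
Proof.
move=> x0; elim: n => [|n IH]; first by rewrite rf0 mul1r fact0 mulr1 addr0.
have h := gJS (addr_ge0 x0 (ler0n _ n)).
rewrite -natr1 addrA h -IH rfS factS natrM -natr1; field.
by rewrite natr1 pnatr_eq0.
Qed.

Lemma gJ_nat n : gJ n%:R = n`!%:R.
Proof. by have := @rf_gJ n 0 (lexx _); rewrite add0r rf1 gJ0 !mul1r add0r. Qed.

(** Concavity, from the tangent line of the exponential at x ln u: it is evaluated at ln u with
    weight x and at 0 with weight 1 - x, and the first-order terms cancel. *)
Lemma powR_le_tangent x u : 0 <= x <= 1 -> 0 <= u -> u `^ x <= 1 + x * (u - 1).
Proof.
move=> /andP[x0 x1]; rewrite le_eqVlt => /predU1P[<-|u0].
  have [->|xn0] := eqVneq x 0; first by rewrite powRr0 mul0r addr0.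
  by rewrite powR0// sub0r mulrN1 subr_ge0.
rewrite /powR gt_eqF//; set L := ln u.
have h w z : expR w * (1 + (z - w)) <= expR z :> R.
  by rewrite -{2}(subrK w z) [leRHS]expRD [leRHS]mulrC ler_wpM2l ?expR_ge0// expR_ge1Dx.
have uE : u = expR L by rewrite lnK.
rewrite {1}uE; have h1 := h (x * L) L; have h2 := h (x * L) 0.
rewrite expR0 in h2.
have h3 := ler_wpM2l x0 h1.
have x1' : 0 <= 1 - x by rewrite subr_ge0.
have h4 := ler_wpM2l x1' h2.
have := lerD h3 h4; set E := expR (x * L); set U := expR L.
rewrite [leLHS](_ : _ = E); last by ring.
by rewrite (_ : x * U + _ = 1 + x * (U - 1)); last by ring.
Qed.

Lemma powRN_ge_tangent y u : 0 <= y -> 0 < u -> 1 - y * (u - 1) <= u `^ (- y).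
Proof.
move=> y0 u0; rewrite /powR gt_eqF//.
apply: (le_trans _ (expR_ge1Dx _)); rewrite lerD2l mulNr lerN2 ler_wpM2l//.
rewrite -ler_expR lnK// (le_trans _ (expR_ge1Dx _))//; lra.
Qed.

(** Bounding t^x by its tangent at t = n and integrating against t^n e^(-t) leaves only [gJ n] and
    [gJ (n + 1)]. *)
Lemma gJ_upper n x : 0 <= x <= 1 -> (0 < n)%N ->
  gJ (n%:R + x) <= n%:R `^ x * n`!%:R * (1 + x / n%:R).
Proof.
move=> x01 n0; have [x0 x1] := andP x01.
have np : 0 < n%:R :> R by rewrite ltr0n.
pose c := n%:R `^ x.
have h1 := integrable_gE (ler0n R n).
have h2 := integrable_gE (addr_ge0 (ler0n R n) ler01).
pose g t : R := c * (1 - x) * gE n%:R t + c * (x / n%:R) * gE (n%:R + 1) t.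
have ig1 : mu.-integrable `]0%R, +oo[ (EFin \o (fun t => c * (1 - x) * gE n%:R t)).
  by apply: RintegrableZ => //; exact: measurable_itv.
have ig2 : mu.-integrable `]0%R, +oo[ (EFin \o (fun t => c * (x / n%:R) * gE (n%:R + 1) t)).
  by apply: RintegrableZ => //; exact: measurable_itv.
have ig : mu.-integrable `]0%R, +oo[ (EFin \o g) by apply: RintegrableD => //; exact: measurable_itv.
apply: (@le_trans _ _ (\int[mu]_(t in `]0, +oo[) g t)).
  apply: le_Rintegral; [by []|by apply: integrable_gE; rewrite addr_ge0|exact: ig|].
  move=> t /=; rewrite in_itv/= andbT => t0; rewrite /g /gE.
  rewrite !(@powRDp _ t)// powRr1 ?(ltW t0)//.
  have h := powR_le_tangent x01 (divr_ge0 (ltW t0) (ltW np)).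
  have tE : t `^ x = c * (t / n%:R) `^ x.
    by rewrite /c -powRM ?divr_ge0 ?(ltW np) ?(ltW t0)// mulrC divfK ?gt_eqF.
  have h' : t `^ x <= c * (1 + x * (t / n%:R - 1)) by rewrite tE ler_wpM2l// powR_ge0.
  have := ler_wpM2l (mulr_ge0 (powR_ge0 t n%:R) (expR_ge0 (- t))) h'.
  by rewrite -subr_ge0 => h''; rewrite -subr_ge0 [X in 0 <= X](_ : _ = t `^ n%:R * expR (- t) * (c * (1 + x * (t / n%:R - 1))) - t `^ n%:R * expR (- t) * t `^ x)//; ring.
rewrite RintegralD//; try exact: measurable_itv.
rewrite !RintegralZl//; try exact: measurable_itv.
rewrite -!/(gJ _) gJS// gJ_nat -/c -subr_ge0 [X in 0 <= X](_ : _ = 0)//.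
by field; rewrite gt_eqF.
Qed.

(** For the opposite direction t^x is written t * t^(-y) with y = 1 - x: the convex factor t^(-y)
    lies above its tangent at n, and only [gJ (n + 1)] and [gJ (n + 2)] occur. *)
Lemma gJ_lower n x : 0 <= x <= 1 -> (0 < n)%N ->
  n%:R `^ x * n`!%:R * ((n%:R + 1) / n%:R * (1 - 2 * (1 - x) / n%:R)) <= gJ (n%:R + x).
Proof.
move=> x01 n0; have [x0 x1] := andP x01.
have np : 0 < n%:R :> R by rewrite ltr0n.
pose c : R := n%:R `^ x; pose y := 1 - x.
have y0 : 0 <= y by rewrite subr_ge0.
have n10 : 0 <= n%:R + 1 :> R by rewrite addr_ge0.
have h1 := integrable_gE n10.
have h2 := integrable_gE (addr_ge0 n10 ler01).
pose a1 := c / n%:R * (1 + y); pose a2 := c / n%:R * (- y / n%:R).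
pose g t : R := a1 * gE (n%:R + 1) t + a2 * gE (n%:R + 1 + 1) t.
have ig1 : mu.-integrable `]0%R, +oo[ (EFin \o (fun t => a1 * gE (n%:R + 1) t)).
  by apply: RintegrableZ => //; exact: measurable_itv.
have ig2 : mu.-integrable `]0%R, +oo[ (EFin \o (fun t => a2 * gE (n%:R + 1 + 1) t)).
  by apply: RintegrableZ => //; exact: measurable_itv.
have ig : mu.-integrable `]0%R, +oo[ (EFin \o g) by apply: RintegrableD => //; exact: measurable_itv.
apply: (@le_trans _ _ (\int[mu]_(t in `]0, +oo[) g t)); last first.
  apply: le_Rintegral; [by []|exact: ig|by apply: integrable_gE; rewrite addr_ge0|].
  move=> t /=; rewrite in_itv/= andbT => t0; rewrite /g /gE.
  rewrite !(@powRDp _ t)// powRr1 ?(ltW t0)//.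
  have h := powRN_ge_tangent y0 (divr_gt0 t0 np).
  have tE : t `^ x = t * (c / n%:R * (t / n%:R) `^ (- y)).
    have -> : c / n%:R = n%:R `^ (- y).
      by rewrite /c /y opprB powRDp// powRN powRr1// ltW.
    rewrite -powRM ?divr_ge0 ?(ltW np) ?(ltW t0)// [n%:R * _]mulrC divfK ?gt_eqF// /y opprB mulrC.
    by rewrite -{3}(powRr1 (ltW t0)) -powRDp// subrK.
  have h' : t * (c / n%:R * (1 - y * (t / n%:R - 1))) <= t `^ x.
    by rewrite tE ler_wpM2l ?(ltW t0)// ler_wpM2l// divr_ge0 ?powR_ge0.
  have := ler_wpM2l (mulr_ge0 (powR_ge0 t n%:R) (expR_ge0 (- t))) h'.
  rewrite -subr_ge0 => h''; rewrite -subr_ge0.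
  rewrite [X in 0 <= X](_ : _ = t `^ n%:R * expR (- t) * t `^ x - t `^ n%:R * expR (- t) *
     (t * (c / n%:R * (1 - y * (t / n%:R - 1)))))//; rewrite /a1 /a2; field.
  by rewrite gt_eqF.
rewrite RintegralD//; try exact: measurable_itv.
rewrite !RintegralZl//; try exact: measurable_itv.
rewrite -!/(gJ _) !gJS// gJ_nat -/c -subr_ge0 [X in 0 <= X](_ : _ = 0)//.
by rewrite /a1 /a2 /y; field; rewrite gt_eqF.
Qed.


Lemma cvg_inv_nat (c : R) : (fun n : nat => c / n%:R) @ \oo --> 0.
Proof.
rewrite -[X in _ --> X](mulr0 c); apply: cvgMl_tmp.
by rewrite -cvg_shiftS; exact: cvg_harmonic.
Qed.

Lemma cvg_1Dinv (c : R) : (fun n : nat => 1 + c / n%:R) @ \oo --> (1 : R).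
Proof.
rewrite -[X in _ --> X](addr0 1); apply: cvgD; last exact: cvg_inv_nat.
exact: cvg_cst.
Qed.

Let rho x n : R := gJ (x + n%:R) / (n`!%:R * n%:R `^ x).

Lemma cvg_rho01 x : 0 <= x <= 1 -> rho x @ \oo --> (1 : R).
Proof.
move=> x01; apply: (@squeeze_cvgr _ _ _ _
  (fun n : nat => (1 + 1 / n%:R) * (1 - 2 * (1 - x) / n%:R)) (fun n : nat => 1 + x / n%:R)).
- near=> n; have n0 : (0 < n)%N by near: n; exact: nbhs_infty_gt.
  have np : 0 < n%:R :> R by rewrite ltr0n.
  have dp : 0 < n`!%:R * n%:R `^ x :> R by rewrite mulr_gt0 ?ltr0n ?fact_gt0// powR_gt0.
  rewrite /rho (addrC x) ler_pdivlMr// ler_pdivrMr//; apply/andP; split.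
    apply: le_trans (gJ_lower x01 n0); rewrite le_eqVlt; apply/orP; left; apply/eqP.
    by field; rewrite gt_eqF.
  apply: le_trans (gJ_upper x01 n0) _; rewrite le_eqVlt; apply/orP; left; apply/eqP.
  by field; rewrite gt_eqF.
- apply: cvg_mul1; first exact: cvg_1Dinv.
  have := cvg_1Dinv (- (2 * (1 - x))); apply: cvg_trans; apply: near_eq_cvg.
  by apply: nearW => n; rewrite /= mulNr.
- exact: cvg_1Dinv.
Unshelve. all: by end_near. Qed.

(** The tangent bounds cover 0 <= x <= 1. Beyond, the functional equation multiplies rho by 1 + (z +
    1) / n for each unit step, which does not change the limit. *)
Lemma cvg_rho x : 0 <= x -> rho x @ \oo --> (1 : R).
Proof.
move=> x0.
suff h k y : 0 <= y <= 1 -> rho (y + k%:R) @ \oo --> (1 : R).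
  have kx := truncn_itv x0.
  rewrite -(subrK (Num.truncn x)%:R x); apply: h.
  have /andP[h1 h2] := truncn_itv x0.
  by rewrite subr_ge0 h1/= lerBlDr addrC natr1 ltW.
move=> y01; have [y0 y1] := andP y01; elim: k => [|k IH]; first by rewrite addr0; exact: cvg_rho01.
pose z := y + k%:R.
have z0 : 0 <= z by rewrite addr_ge0.
have h : (fun n : nat => (1 + (z + 1) / n%:R) * rho z n) @ \oo --> (1 : R).
  by apply: cvg_mul1; [exact: cvg_1Dinv|exact: IH].
apply: cvg_trans h; apply: near_eq_cvg; near=> n.
have n0 : (0 < n)%N by near: n; exact: nbhs_infty_gt.
have np : n%:R != 0 :> R by rewrite pnatr_eq0 -lt0n.
rewrite -natr1 addrA -/z /rho (addrAC z 1) gJS ?addr_ge0//.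
rewrite (@powRDp _ _ z 1) ?ltr0n// powRr1//; field.
by rewrite np gt_eqF ?powR_gt0 ?ltr0n// pnatr_eq0 -lt0n fact_gt0.
Unshelve. all: by end_near. Qed.

(** Read off the asymptotics: by [rf_gJ], a zero of [gJ] at x would make every [rho x n] vanish,
    while their limit is 1. *)
Lemma gJ_gt0 x : 0 <= x -> 0 < gJ x.
Proof.
move=> x0; have g0 : 0 <= gJ x by apply: Rintegral_ge0 => t _; exact: gE_ge0.
rewrite lt_neqAle g0 andbT eq_sym; apply/negP => /eqP gJx0.
have h := cvg_rho x0.
have h0 : rho x @ \oo --> (0 : R).
  rewrite (_ : rho x = cst 0); first exact: cvg_cst.
  by apply/funext => n; rewrite /rho -rf_gJ// gJx0 mulr0 !mul0r.
have E : (1 : R) = 0 by apply: (cvg_unique _ h h0).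
by move/eqP : E; rewrite oner_eq0.
Qed.

(** Gauss's approximation of 1 / Gamma(x + 1); it is nonincreasing in n from n = 1 on, so that an
    early value dominates all later ones. *)
Definition rfn n x : R := rf n (x + 1) * n%:R `^ (- x).

Lemma rfn_ge0 n x : 0 <= x -> 0 <= rfn n x.
Proof. by move=> x0; rewrite mulr_ge0 ?powR_ge0// rf_ge0// addr_ge0. Qed.

Lemma rfnE n x : (0 < n)%N -> 0 <= x -> rfn n x = rho x n / gJ x.
Proof.
move=> n0 x0; rewrite /rfn /rho -rf_gJ// powRN invfM; field.
by rewrite !gt_eqF ?gJ_gt0 ?powR_gt0 ?ltr0n ?fact_gt0.
Qed.

Lemma cvg_rfn x : 0 <= x -> (rfn ^~ x) @ \oo --> (gJ x)^-1.
Proof.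
move=> x0.
have h : (fun n => rho x n / gJ x) @ \oo --> (gJ x)^-1.
  by rewrite -[X in _ --> X]mul1r; apply: cvgMr_tmp; exact: cvg_rho.
apply: cvg_trans h; apply: near_eq_cvg; near=> n.
by symmetry; apply: rfnE => //; near: n; exact: nbhs_infty_gt.
Unshelve. all: by end_near. Qed.

Lemma inv_powR (y x : R) : 0 <= y -> (y^-1) `^ x = y `^ (- x).
Proof. by move=> y0; rewrite -powR_inv1// -powRrM mulN1r. Qed.

(** The ratio is (1 + x / (n + 1)) (n / (n + 1))^x, and the two factors are at most e^(x / (n + 1))
    and e^(-x / (n + 1)). *)
Lemma rfn_decr n x : (0 < n)%N -> 0 <= x -> rfn n.+1 x <= rfn n x.
Proof.
move=> n0 x0; rewrite /rfn rfS -mulrA ler_wpM2l ?rf_ge0 ?addr_ge0//.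
have np : 0 < n%:R :> R by rewrite ltr0n.
have n1p : 0 < n.+1%:R :> R by rewrite ltr0n.
have -> : n.+1%:R `^ (- x) = n%:R `^ (- x) * (n%:R / n.+1%:R) `^ x.
  rewrite powRM ?invr_ge0 ?(ltW np) ?(ltW n1p)// mulrA -powRDp//.
  by rewrite addNr powRr0 mul1r inv_powR ?(ltW n1p).
rewrite mulrCA ler_piMr ?powR_ge0//.
have h1 : (x + 1 + n%:R) / n.+1%:R <= expR (x / n.+1%:R).
  apply: (le_trans _ (expR_ge1Dx _)).
  by rewrite -addrA (addrC 1 n%:R) natr1 mulrDl divff ?gt_eqF// addrC.
have h2 : (n%:R / n.+1%:R) `^ x <= expR (- (x / n.+1%:R)).
  apply: (@le_trans _ _ (expR (- n.+1%:R^-1) `^ x)).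
    apply: ge0_ler_powR; rewrite ?nnegrE ?expR_ge0 ?divr_ge0//.
    apply: (le_trans _ (expR_ge1Dx _)).
    by rewrite ler_pdivrMr// mulrDl mul1r mulNr mulVf ?gt_eqF// -natr1 addrK.
  by rewrite -expRM mulNr mulrC.
apply: (@le_trans _ _ (expR (x / n.+1%:R) * expR (- (x / n.+1%:R)))); last first.
  by rewrite -expRD addrN expR0.
by apply: ler_pM => //; rewrite ?powR_ge0// divr_ge0 ?addr_ge0.
Qed.

Lemma rfn_decr_le m n x : (0 < m)%N -> (m <= n)%N -> 0 <= x -> rfn n x <= rfn m x.
Proof.
move=> m0 + x0; elim: n => [|n IH]; first by rewrite leqn0 => /eqP mE; rewrite mE in m0.
rewrite leq_eqVlt => /predU1P[->//|mn]; apply: (le_trans _ (IH mn)).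
by apply: rfn_decr => //; exact: leq_trans m0 mn.
Qed.

End gamma.

(** * Dominated convergence for series *)

Section tannery.
Context {R : realType}.

Lemma series_tail_le (u b : nat -> R) M : (forall m, `|u m| <= b m) -> cvgn (series b) ->
  `|limn (series u) - series u M| <= limn (series b) - series b M.
Proof.
move=> ub cb.
have cu : cvgn (series u).
  apply: normed_cvg; apply: series_le_cvg cb => m //=; exact: le_trans (ub m).
have h1 : (fun N => `|series u N - series u M|) @ \oo --> `|limn (series u) - series u M|.
  by apply: cvg_norm; apply: cvgB; [exact: cu|exact: cvg_cst].
have h2 : (fun N => series b N - series b M) @ \oo --> limn (series b) - series b M.
  by apply: cvgB; [exact: cb|exact: cvg_cst].
apply: (ler_cvg_to h1 h2); near=> N.
have MN : (M <= N)%N by near: N; exact: nbhs_infty_ge.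
rewrite !sub_series_geq// (le_trans (ler_norm_sum _ _ _))//.
by apply: ler_sum.
Unshelve. all: by end_near. Qed.

(** Domination is only asked for large n: in [cvg_sampled] it starts once the sampling index has
    passed a fixed n0. *)
Lemma tannery (f : nat -> nat -> R) (b g : nat -> R) :
  (\forall n \near \oo, forall m, `|f n m| <= b m) -> cvgn (series b) ->
  (forall m, f ^~ m @ \oo --> g m) ->
  (fun n => limn (series (f n))) @ \oo --> limn (series g).
Proof.
move=> fb cb fg.
have gb m : `|g m| <= b m.
  have h : (fun n => `|f n m|) @ \oo --> `|g m| by apply: cvg_norm; exact: fg.
  apply: (cvgr_to_le h).
  by near=> n; near: n; apply: filterS fb => n; exact.
apply/cvgrPdist_le => e e0.
have e3 : 0 < e / 3 by rewrite divr_gt0.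
have [M _ hM] : \forall M \near \oo, limn (series b) - series b M <= e / 3.
  have /cvgrPdist_le /(_ _ e3) := cb; apply: filterS => M.
  exact: le_trans (ler_norm _).
have {}hM := hM _ (leqnn M).
have hs : (fun n => series (f n) M) @ \oo --> series g M.
  rewrite /series/= big_mkord (_ : (fun n => _) = (fun n => \sum_(j < M) f n j)).
    by apply: cvg_sum_ord => j; exact: fg.
  by apply/funext => n; rewrite big_mkord.
near=> n.
have h1 : `|limn (series (f n)) - series (f n) M| <= e / 3.
  apply: (le_trans _ hM); apply: series_tail_le => //.
  by near: n.
have h2 := le_trans (series_tail_le M gb cb) hM.
have h3 : `|series g M - series (f n) M| <= e / 3.
  by near: n; move/cvgrPdist_le : hs => /(_ _ e3).
rewrite (_ : _ - _ = (limn (series g) - series g M) + (series g M - series (f n) M)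
  - (limn (series (f n)) - series (f n) M)); last by ring.
rewrite (le_trans (ler_normB _ _))// (le_trans (lerD (ler_normD _ _) (lexx _)))//.
rewrite (le_trans (lerD (lerD h2 h3) h1))//; lra.
Unshelve. all: by end_near. Qed.

End tannery.

(** * Positivity, monotonicity and decay of the Mittag-Leffler relaxation *)

Section mittag_leffler_bounds.
Context {R : realType}.
Variable a : R.
Hypothesis a01 : 0 < a < 1.
Implicit Types (t x : R) (n : nat).

Definition mlneg x : R := mittag_leffler a 1 (- x).

Lemma mlnegE x : mlneg x = limn (series (fun k => (- x) ^+ k / gJ (k%:R * a))).
Proof.
congr (limn (series _)); apply/funext => k; by rewrite gamma_funE.
Qed.

Lemma mlneg0 : mlneg 0 = 1.
Proof.
rewrite mlnegE; apply: cvg_lim => //; rewrite -cvg_shiftS.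
rewrite (_ : [sequence _]_n = cst 1); first exact: cvg_cst.
apply/funext => n /=.
rewrite /series/= big_nat_recl// expr0 mul0r gJ0 invr1 mulr1 big1 ?addr0// => i _.
by rewrite oppr0 expr0n/= mul0r.
Qed.

Lemma sampled_term n h m : (0 < n)%N -> 0 < h ->
  (- (h `^ a)) ^+ m * rf n (m%:R * a + 1) =
  (- ((h * n%:R) `^ a)) ^+ m * rfn n (m%:R * a).
Proof.
move=> n0 h0; have np : 0 < n%:R :> R by rewrite ltr0n.
rewrite /rfn powRM ?(ltW h0) ?(ltW np)// -mulNr exprMn -!mulrA; congr *%R.
rewrite mulrCA mulrA -mulrA -{1}[rf n _]mulr1; congr *%R.
by rewrite -powR_mulrn ?powR_ge0// -powRrM [a * _]mulrC -powRDp// subrr powRr0.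
Qed.

(* Post-Widder sampling: [rfT a (h `^ a) n 1] is the average of the Mittag-Leffler
   function against a Gamma law with mean [h * (n + 1)]; the limit is taken
   termwise, the terms being nonincreasing in n. *)
Lemma cvg_sampled (n : nat -> nat) (h : nat -> R) t : 0 < t ->
  (forall N, 0 < h N) -> (forall M, \forall N \near \oo, (M <= n N)%N) ->
  (fun N => h N * (n N)%:R) @ \oo --> t ->
  (fun N => rfT a ((h N) `^ a) (n N) 1) @ \oo --> mlneg (t `^ a).
Proof.
move=> t0 h0 noo hn; have [a0 a1] := andP a01.
(* n0 > t + 1 makes h1 = (t + 1) / n0 < 1, so [rfT_normed] applies to q = h1^a. Since [rfn] is
   nonincreasing and h n is eventually at most t + 1 = h1 n0, the terms of this one series dominate
   those of all later samples. *)
pose n0 := (Num.truncn (t + 1)).+1.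
have t10 : 0 < t + 1 by rewrite addr_gt0.
have n0t : t + 1 < n0%:R by have /andP[] := truncn_itv (ltW t10).
have n0p : 0 < n0%:R :> R by rewrite ltr0n.
pose h1 := (t + 1) / n0%:R.
have h10 : 0 < h1 by rewrite divr_gt0.
have q01 : 0 < h1 `^ a < 1.
  rewrite powR_gt0//= -[ltRHS](one_powR a); apply: gt0_ltr_powR => //.
  - by rewrite nnegrE ltW.
  - by rewrite nnegrE.
  - by rewrite ltr_pdivrMr// mul1r.
have cp : (fun N => (h N * (n N)%:R) `^ a) @ \oo --> t `^ a.
  have h2 : {for t, continuous (fun u => u `^ a)} := powR_continuous_at t0.
  exact: (continuous_cvg _ h2 hn).
rewrite mlnegE.
pose f N m := (- ((h N * (n N)%:R) `^ a)) ^+ m * rfn (n N) (m%:R * a).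
have : (fun N => limn (series (f N))) @ \oo -->
    limn (series (fun k => (- (t `^ a)) ^+ k / gJ (k%:R * a))).
  apply: (tannery (b := fun m => `|(- (h1 `^ a)) ^+ m * rf n0 (m%:R * a + 1)|)).
  - near=> N => m; rewrite /f sampled_term// [leLHS]normrM [leRHS]normrM !normrX !normrN.
    have ma0 : 0 <= m%:R * a by rewrite mulr_ge0// ltW.
    have nN : (n0 <= n N)%N by near: N; exact: noo.
    apply: ler_pM => //; rewrite ?exprn_ge0//; last first.
      by rewrite !ger0_norm ?rfn_ge0// rfn_decr_le.
    apply: lerXn2r; rewrite ?nnegrE// !ger0_norm ?powR_ge0//.
    rewrite /h1 divfK ?gt_eqF//; apply: ge0_ler_powR; rewrite ?nnegrE ?(ltW a0) ?(ltW t10)//.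
      by rewrite mulr_ge0// ltW.
    by near: N; apply: (cvgr_le _ hn); rewrite ltrDl.
  - exact: (rfT_normed a01 q01).
  - move=> m; apply: cvgM.
      apply: (@cvg_comp _ _ _ _ (fun u => u ^+ m) _ _ _ (cvgN cp)).
      exact: exprn_continuous.
    apply: (@cvg_comp _ _ _ n (fun k => rfn k (m%:R * a)) _ \oo).
      by move=> A [M _ MA]; near=> N; apply: MA => /=; near: N; exact: noo.
    by apply: cvg_rfn; rewrite mulr_ge0// ltW.
apply: cvg_trans; apply: near_eq_cvg; near=> N.
congr (limn (series _)); apply/funext => m; rewrite sampled_term//.
by near: N; exact: (noo 1%N).
Unshelve. all: by end_near. Qed.

(** The sampling step is 1 / (N + 2), below 1 already for N = 0, as [q01] demands; then h * n is t
    up to one step. *)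
Let grid t N := Num.truncn (t * N.+2%:R).

Let gridP t : 0 < t -> [/\ (forall M, \forall N \near \oo, (M <= grid t N)%N) &
  (fun N => N.+2%:R^-1 * (grid t N)%:R) @ \oo --> t].
Proof.
move=> t0.
have gt N : t * N.+2%:R - 1 < (grid t N)%:R <= t * N.+2%:R.
  have h : 0 <= t * N.+2%:R by rewrite mulr_ge0// ltW.
  by have /andP[h1 h2] := truncn_itv h; rewrite h1 ltrBlDr natr1 h2.
split.
  move=> M; near=> N.
  rewrite -ltnS -(ltr_nat R) -natr1 -ltrBlDr.
  apply: (@lt_trans _ _ (t * N.+2%:R - 1)); last by have /andP[] := gt N.
  rewrite ltrD2r -ltr_pdivrMl//.
  rewrite (@lt_trans _ _ N%:R) ?ltr_nat ?leqnSn//.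
  near: N; exact: nbhs_infty_gtr.
apply: (@squeeze_cvgr _ _ _ _ (fun N => t - N.+2%:R^-1) (cst t)).
- apply: nearW => N; have /andP[h1 h2] := gt N.
  have Np : 0 < N.+2%:R :> R by rewrite ltr0n.
  rewrite ler_pdivlMl// ler_pdivrMl// mulrBr mulfV ?gt_eqF// [N.+2%:R * _]mulrC (ltW h1)/=; exact: h2.
- rewrite -[X in _ --> X](subr0 t); apply: cvgB; first exact: cvg_cst.
  rewrite (cvg_shiftS (fun N => N.+1%:R^-1 : R)); exact: cvg_harmonic.
- exact: cvg_cst.
Unshelve. all: by end_near. Qed.

Let cvg_grid t : 0 < t ->
  (fun N => rfT a (N.+2%:R^-1 `^ a) (grid t N) 1) @ \oo --> mlneg (t `^ a).
Proof.
move=> t0; have [h1 h2] := gridP t0; apply: (cvg_sampled t0) => //.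
Qed.

Let q01 N : 0 < (N.+2%:R^-1 : R) `^ a < 1.
Proof.
have [a0 a1] := andP a01.
rewrite powR_gt0 ?invr_gt0//= -[ltRHS](one_powR a); apply: gt0_ltr_powR; rewrite ?nnegrE//.
by rewrite invf_lt1// ltr1n.
Qed.

Lemma root_powR x : 0 < x -> exists2 t, 0 < t & x = t `^ a.
Proof.
move=> x0; have [a0 a1] := andP a01; exists (x `^ a^-1); first exact: powR_gt0.
by rewrite -powRrM mulVf ?gt_eqF// powRr1// ltW.
Qed.

Lemma mlneg_ge0 x : 0 <= x -> 0 <= mlneg x.
Proof.
rewrite le_eqVlt => /predU1P[<-|/root_powR[t t0 ->]]; first by rewrite mlneg0.
apply: (cvgr_to_ge (cvg_grid t0)); apply: nearW => N; exact: (rfT_1_ge0 a01 (q01 N)).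
Qed.

Lemma mlneg_le1 x : 0 <= x -> mlneg x <= 1.
Proof.
rewrite le_eqVlt => /predU1P[<-|/root_powR[t t0 ->]]; first by rewrite mlneg0.
have [a0 a1] := andP a01.
apply: (cvgr_to_le (cvg_grid t0)); apply: nearW => N.
apply: le_trans (rfT_1_le a01 (q01 N) (grid t N)).
rewrite ler_peMr ?(rfT_1_ge0 a01 (q01 N))// lerDl mulr_ge0 ?powR_ge0// rf_ge0//.
by rewrite addr_ge0// ltW.
Qed.

Lemma mlneg_noninc x y : 0 <= x -> x <= y -> mlneg y <= mlneg x.
Proof.
rewrite le_eqVlt => /predU1P[<-|x0]; first by move=> y0; rewrite mlneg0 mlneg_le1.
rewrite le_eqVlt => /predU1P[->//|xy].
have y0 := lt_trans x0 xy; have [a0 a1] := andP a01.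
have [t t0 xE] := root_powR x0; have [u u0 yE] := root_powR y0.
have tu : t < u.
  rewrite ltNge; apply/negP => ut; move: xy; rewrite xE yE ltNge => /negP; apply.
  by apply: ge0_ler_powR => //; rewrite ?nnegrE ltW.
rewrite xE yE; apply: (ler_cvg_to (cvg_grid u0) (cvg_grid t0)).
apply: nearW => N; apply: (rfT_1_decr_le a01 (q01 N)).
by apply: le_truncn; rewrite ler_wpM2r// ltW.
Qed.

(** The limit of [rfT_1_le]: there q * rf n (a + 1) is (h n)^a * rfn n a, which tends to x / Gamma(a
    + 1). *)
Lemma mlneg_decay x : 0 < x -> mlneg x * x <= gJ a.
Proof.
move=> x0; have [t t0 ->] := root_powR x0; have [a0 a1] := andP a01.
have J0 := gJ_gt0 (ltW a0).
rewrite -[leRHS]mul1r -ler_pdivrMr// -mulrA.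
have [goo gt] := gridP t0.
have h : (fun N => rfT a (N.+2%:R^-1 `^ a) (grid t N) 1 *
    ((N.+2%:R^-1 * (grid t N)%:R) `^ a * rfn (grid t N) a)) @ \oo -->
    mlneg (t `^ a) * (t `^ a / gJ a).
  apply: cvgM; first exact: cvg_grid.
  apply: cvgM.
    have h2 : {for t, continuous (fun u => u `^ a)} := powR_continuous_at t0.
    exact: (continuous_cvg _ h2 gt).
  apply: (@cvg_comp _ _ _ (grid t) (fun k => rfn k a) _ \oo).
    by move=> A [M _ MA]; near=> N; apply: MA => /=; near: N; exact: goo.
  by apply: cvg_rfn; exact: ltW.
apply: (cvgr_to_le h); near=> N.
have g0 : (0 < grid t N)%N by near: N; exact: (goo 1%N).
have Np : 0 < N.+2%:R^-1 :> R by rewrite invr_gt0.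
have := @sampled_term (grid t N) _ 1 g0 Np; rewrite !expr1 mul1r !mulNr => /oppr_inj <-.
apply: le_trans (rfT_1_le a01 (q01 N) (grid t N)).
by rewrite ler_wpM2l ?(rfT_1_ge0 a01 (q01 N))// lerDr.
Unshelve. all: by end_near. Qed.

(** For x <= 1 the bound by 1 is enough, for x > 1 the decay in 1 / x; the constant is the sum of
    the two. *)
Lemma mlneg_bound x g : 0 <= g <= 1 -> 0 < x -> mlneg x <= (gJ a + 1) * x `^ (- g).
Proof.
move=> /andP[g0 g1] x0; have [a0 a1] := andP a01.
have J0 := gJ_gt0 (ltW a0).
have [x1|x1] := leP x 1.
  apply: (le_trans (mlneg_le1 (ltW x0))).
  rewrite -[leLHS]mulr1 ler_pM// ?lerDr ?(ltW J0)//.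
  rewrite powRN -[leLHS]invr1 lef_pV2 ?posrE ?powR_gt0//.
  rewrite -(one_powR g) ge0_ler_powR// nnegrE ltW//.
have h : mlneg x <= gJ a * x^-1 by rewrite ler_pdivlMr// mlneg_decay.
apply: (le_trans h); apply: ler_pM; rewrite ?(ltW J0) ?invr_ge0 ?(ltW x0) ?lerDl//.
rewrite -[leLHS]powR_inv1 ?(ltW x0)//; apply: ler_powR; first exact: ltW.
by rewrite lerN2.
Qed.

End mittag_leffler_bounds.

(** * Square integrable functions *)

Section ae_tools.
Context d (T : measurableType d) (R : realType) (mu : {measure set T -> \bar R}).

Lemma fatou_ae (f : nat -> T -> R) (g : T -> R) (B : \bar R) :
  (forall n, measurable_fun setT (f n)) -> measurable_fun setT g ->
  (forall n x, 0 <= f n x) -> (forall x, 0 <= g x) ->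
  {ae mu, forall x, f ^~ x @ \oo --> g x} ->
  (\forall n \near \oo, (\int[mu]_x (f n x)%:E <= B)%E) ->
  (\int[mu]_x (g x)%:E <= B)%E.
Proof.
move=> mf mg f0 g0 fg fB.
have mfE n : measurable_fun setT (EFin \o f n) by apply/measurable_EFinP.
have f0E n x : setT x -> (0 <= (EFin \o f n) x)%E by rewrite /= lee_fin.
have := @fatou _ _ _ mu _ measurableT (fun n => EFin \o f n) mfE f0E.
move=> h.
apply: (@le_trans _ _ (\int[mu]_x (limn_einf (fun n => (f n x)%:E)))%E).
  apply: ae_ge0_le_integral => //.
  - by move=> x _; rewrite lee_fin.
  - exact/measurable_EFinP.
  - move=> x _; rewrite limn_einf_lim; apply: lime_ge; first exact: is_cvg_einfs.
    apply: nearW => n; apply: le_ereal_inf_tmp => _ [m _ <-] /=; by rewrite lee_fin.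
  - apply: (emeasurable_fun_cvg (fun n x => einfs (fun m => (f m x)%:E) n)).
      exact: (measurable_fun_einfs mfE).
    by move=> x _; rewrite limn_einf_lim; exact: is_cvg_einfs.
  - apply: filterS fg => x fgx _.
    have fgxE : (fun n => (f n x)%:E) @ \oo --> (g x)%:E by apply/fine_cvgP; split; [exact: nearW|].
    by rewrite (cvg_limn_einf_sup fgxE).1.
apply: (le_trans h); rewrite limn_einf_lim.
apply: lime_le; first exact: is_cvg_einfs.
apply: nearW => n.
case: fB => N _ NB.
apply: le_trans (NB (maxn n N) (leq_maxr _ _)).
by apply: ereal_inf_lbound; exists (maxn n N) => //=; exact: leq_maxl.
Qed.

End ae_tools.

Section restriction.
Context d (T : measurableType d) (R : realType) (mu : {measure set T -> \bar R}).
Context (D : set T) (mD : measurable D).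

Lemma ge0_integral_mrestr (f : T -> \bar R) : measurable_fun setT f ->
  (forall x, 0 <= f x)%E ->
  (\int[mrestr mu mD]_x f x = \int[mu]_(x in D) f x)%E.
Proof.
move=> mf f0.
rewrite (@ge0_negligible_integral _ _ _ (mrestr mu mD) setT (~` D))//; last 2 first.
  exact: measurableC.
  by rewrite /= /mrestr setICl measure0.
rewrite setDE setCK setTI; apply: eq_measure_integral => A mA AD.
by rewrite /= /mrestr setIidl.
Qed.

Lemma integral_mrestr (f : T -> \bar R) : measurable_fun setT f ->
  (\int[mrestr mu mD]_x f x = \int[mu]_(x in D) f x)%E.
Proof.
move=> mf; rewrite [LHS]integralE [RHS]integralE.
by rewrite !ge0_integral_mrestr//; [exact: measurable_funeneg|exact: measurable_funepos].
Qed.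

End restriction.

(** * Inner product, Cauchy-Schwarz and completeness of L^2 *)

Section L2.
Context d (T : measurableType d) (R : realType) (mu : {measure set T -> \bar R}).
Notation L2 := (LfunType mu (lee1n 2)).
Implicit Types (u v w : L2).

Definition nrm v : R := fine ('N[mu]_2%:R%:E [EFin \o v])%E.
Definition ip v w : R := \int[mu]_x (v x * w x).

Lemma L2_measurable v : measurable_fun setT v.
Proof. by []. Qed.

Lemma ip_integrable v w : mu.-integrable setT (EFin \o (fun x => v x * w x)).
Proof. by have := Lfun2_mul_Lfun1 (LfunP v) (LfunP w) => /Lfun1_integrable. Qed.

Lemma nrm_ge0 v : 0 <= nrm v.
Proof. by rewrite fine_ge0// Lnorm_ge0. Qed.

Lemma integral_sq v : (\int[mu]_x (v x ^+ 2)%:E = (nrm v ^+ 2)%:E)%E.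
Proof.
have -> : (nrm v ^+ 2)%:E = (('N[mu]_2%:R%:E [EFin \o v]) `^ 2%:R)%E.
  rewrite -(finite_norm_fine v) poweR_EFin powR_mulrn ?nrm_ge0//.
rewrite powR_Lnorm ?pnatr_eq0//; apply: eq_integral => x _ /=.
by rewrite ?poweR_EFin powR_mulrn// real_normK// num_real.
Qed.

Lemma ip_sq v : ip v v = nrm v ^+ 2.
Proof.
by rewrite /ip /Rintegral; under eq_integral do rewrite -expr2; rewrite integral_sq.
Qed.

Lemma integral_ip v w : (\int[mu]_x (v x * w x)%:E = (ip v w)%:E)%E.
Proof. exact: (RintegralE measurableT (ip_integrable v w)). Qed.

Lemma ipC v w : ip v w = ip w v.
Proof. by apply: eq_Rintegral => x _; rewrite mulrC. Qed.

Lemma ipDl u v w : ip (u + v) w = ip u w + ip v w.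
Proof.
rewrite /ip -RintegralD//; try exact: ip_integrable.
by apply: eq_Rintegral => x _; rewrite -mulrDl.
Qed.

Lemma ipZl c v w : ip (c *: v) w = c * ip v w.
Proof.
rewrite /ip -RintegralZl//; try exact: ip_integrable.
by apply: eq_Rintegral => x _; rewrite mulrA.
Qed.

Lemma ipNl v w : ip (- v) w = - ip v w.
Proof. by rewrite -scaleN1r ipZl mulN1r. Qed.

Lemma ipBl u v w : ip (u - v) w = ip u w - ip v w.
Proof. by rewrite ipDl ipNl. Qed.

Lemma ip0l w : ip 0 w = 0.
Proof. by rewrite -(scale0r w) ipZl mul0r. Qed.

Lemma ip_suml (I : Type) (r : seq I) (P : pred I) (F : I -> L2) w :
  ip (\sum_(i <- r | P i) F i) w = \sum_(i <- r | P i) ip (F i) w.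
Proof.
by elim/big_rec2 : _ => [|i y x _ <-]; [exact: ip0l|rewrite ipDl].
Qed.

Lemma ipDr u v w : ip w (u + v) = ip w u + ip w v.
Proof. by rewrite ipC ipDl !(ipC w). Qed.

Lemma ipZr c v w : ip w (c *: v) = c * ip w v.
Proof. by rewrite ipC ipZl (ipC w). Qed.

Lemma ipBr u v w : ip w (u - v) = ip w u - ip w v.
Proof. by rewrite ipC ipBl !(ipC w). Qed.

Lemma ip_sumr (I : Type) (r : seq I) (P : pred I) (F : I -> L2) w :
  ip w (\sum_(i <- r | P i) F i) = \sum_(i <- r | P i) ip w (F i).
Proof. by rewrite ipC ip_suml; apply: eq_bigr => i _; rewrite ipC. Qed.

Lemma nrmZ c v : nrm (c *: v) = `|c| * nrm v.
Proof.
apply/eqP; rewrite -(@eqrXn2 _ 2) ?mulr_ge0 ?nrm_ge0//.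
by rewrite -ip_sq ipZl ipZr ip_sq exprMn real_normK ?num_real// mulrA.
Qed.

Lemma nrmN v : nrm (- v) = nrm v.
Proof. by rewrite -scaleN1r nrmZ normrN1 mul1r. Qed.

Lemma nrmBC v w : nrm (v - w) = nrm (w - v).
Proof. by rewrite -opprB nrmN. Qed.

Lemma nrmD v w : nrm (v + w) <= nrm v + nrm w.
Proof. exact: ler_LnormD. Qed.

Lemma nrm_triangle u v w : nrm (u - w) <= nrm (u - v) + nrm (v - w).
Proof. by rewrite -{1}(subrK v u) -addrA; exact: nrmD. Qed.

Lemma nrm_dist v w : `|nrm v - nrm w| <= nrm (v - w).
Proof.
rewrite ler_norml; apply/andP; split.
  have := nrmD (w - v) v; rewrite subrK nrmBC; lra.
have := nrmD (v - w) w; rewrite subrK; lra.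
Qed.

Lemma ip_CS v w : `|ip v w| <= nrm v * nrm w.
Proof.
have pol t : 0 <= nrm v ^+ 2 - 2 * t * ip v w + t ^+ 2 * nrm w ^+ 2.
  have := sqr_ge0 (nrm (v - t *: w)).
  rewrite (_ : nrm (v - t *: w) ^+ 2 = nrm v ^+ 2 - 2 * t * ip v w + t ^+ 2 * nrm w ^+ 2)//.
  by rewrite -ip_sq ipBl !ipBr !ipZl !ipZr !ip_sq (ipC w v); ring.
have [w0|w0] := eqVneq (nrm w) 0.
  have [->|vw0] := eqVneq (ip v w) 0; first by rewrite normr0 mulr_ge0 ?nrm_ge0.
  (* When [nrm w] is 0 the polynomial is affine in t, and this t gives it the value -1. *)
  have := pol ((nrm v ^+ 2 + 1) / (2 * ip v w)).
  rewrite w0 expr0n/= mulr0 addr0.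
  rewrite [X in _ - X](_ : _ = nrm v ^+ 2 + 1); last by field.
  by rewrite opprD addNKr oppr_ge0 ler10.
have := pol (ip v w / nrm w ^+ 2).
rewrite [X in 0 <= X](_ : _ = nrm v ^+ 2 - ip v w ^+ 2 / nrm w ^+ 2); last by field.
rewrite subr_ge0 ler_pdivrMr ?exprn_gt0// ?lt0r ?w0 ?nrm_ge0// -exprMn => h.
by rewrite -(@ler_pXn2r _ 2) ?nnegrE ?mulr_ge0 ?nrm_ge0// real_normK ?num_real.
Qed.

Definition cvgL2 (v : nat -> L2) w := (fun n => nrm (v n - w)) @ \oo --> (0 : R).

Lemma cvgL2_ipl (v : nat -> L2) w w' : cvgL2 v w ->
  (fun n => ip (v n) w') @ \oo --> ip w w'.
Proof.
move=> vw.
apply/subr_cvg0; apply: (@squeeze_cvgr _ _ _ _ (fun n => - (nrm (v n - w) * nrm w'))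
  (fun n => nrm (v n - w) * nrm w')).
- by apply: nearW => n /=; rewrite -ler_norml -ipBl ip_CS.
- rewrite -oppr0 -(mul0r (nrm w')); apply: cvgN; exact: cvgMr_tmp.
- rewrite -(mul0r (nrm w')); exact: cvgMr_tmp.
Qed.

Lemma cvgL2_nrm (v : nat -> L2) w : cvgL2 v w -> (fun n => nrm (v n)) @ \oo --> nrm w.
Proof.
move=> vw; apply/subr_cvg0; apply: (@squeeze_cvgr _ _ _ _ (fun n => - (nrm (v n - w)))
  (fun n => nrm (v n - w))) => //.
- by apply: nearW => n /=; rewrite -ler_norml nrm_dist.
- by rewrite -oppr0; exact: cvgN.
Qed.

Lemma cvgL2_unique (v : nat -> L2) w w' : cvgL2 v w -> cvgL2 v w' -> nrm (w - w') = 0.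
Proof.
move=> vw vw'; apply/eqP; rewrite eq_le nrm_ge0 andbT.
have h := cvgD vw vw'; rewrite addr0 in h.
apply: (cvgr_to_ge (h _)); apply: nearW => n /=.
by rewrite -[leRHS]/(nrm (v n - w) + nrm (v n - w')) (nrmBC (v n) w) nrm_triangle.
Qed.

Lemma nrm0_ip v w : nrm v = 0 -> ip v w = 0.
Proof.
by move=> v0; apply/eqP; rewrite -normr_eq0 eq_le normr_ge0 andbT (le_trans (ip_CS v w))// v0 mul0r.
Qed.

Lemma mkL2 (f : T -> R) : measurable_fun setT f ->
  (\int[mu]_x (f x ^+ 2)%:E < +oo)%E -> exists v : L2, (v : T -> R) = f.
Proof.
move=> mf fint.
have fL : f \in Lfun mu 2%:R%:E.
  rewrite inE; apply/andP; split; first by rewrite inE.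
  rewrite inE /finite_norm /= unlock poweR_lty//.
  rewrite (le_lt_trans _ fint)//.
  rewrite le_eqVlt; apply/orP; left; apply/eqP; apply: eq_integral => x _ /=.
  by rewrite ?poweR_EFin powR_mulrn// real_normK// num_real.
by exists (Lfun_Sub (lee1n 2) fL).
Qed.

Lemma nrm_ae_eq v w : {ae mu, forall x, v x = w x} -> nrm (v - w) = 0.
Proof.
move=> vw; apply/eqP; rewrite -sqrf_eq0 -eqe -integral_sq.
rewrite (@ae_eq_integral _ _ _ _ _ (cst 0%E)) ?integral0//.
  by apply/measurable_EFinP; exact: measurable_funX.
by apply: filterS vw => x vwx _; rewrite [(v - w) x](_ : _ = v x - w x)// vwx subrr expr0n.
Qed.


(* Along a subsequence with [nrm (v (s k.+1) - v (s k)) ^+ 2 <= 8 ^- k] the series of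
   [4 ^ k * (v (s k.+1) x - v (s k) x) ^ 2] has a finite integral, so that v (s k) x
   converges for almost every x. *)
Lemma L2_complete (v : nat -> L2) :
  (forall e, 0 < e -> exists N, forall m n, (N <= m)%N -> (N <= n)%N -> nrm (v m - v n) <= e) ->
  exists w, cvgL2 v w.
Proof.
move=> cv.
have e8 k : 0 < (8 ^- k : R) by rewrite invr_gt0 exprn_gt0.
have [N0 hN0] := choice (fun k => cv _ (e8 k)).
(* Summing the thresholds makes s nondecreasing and at least [N0 k]; the extra k makes it
   unbounded. *)
pose s k := (k + \sum_(j < k.+1) N0 j)%N.
have sN k : (N0 k <= s k)%N by rewrite /s big_ord_recr/= addnA leq_addl.
have sS k : (s k <= s k.+1)%N by rewrite /s [in leqRHS]big_ord_recr/= leq_add// leq_addr.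
pose d_ k x := v (s k.+1) x - v (s k) x.
have md k : measurable_fun setT (d_ k) by apply: measurable_funB.
pose G x := (\sum_(0 <= k <oo) ((4 ^+ k * d_ k x ^+ 2)%:E))%E.
have mt k : measurable_fun setT (fun x => (4 ^+ k * d_ k x ^+ 2)%:E).
  apply/measurable_EFinP; apply: measurable_funM => //.
  exact: measurable_funX.
have G0 k x : setT x -> (0 <= (4 ^+ k * d_ k x ^+ 2)%:E)%E.
  by move=> _; rewrite lee_fin mulr_ge0// ?sqr_ge0// exprn_ge0.
have intG : (\int[mu]_x G x < +oo)%E.
  rewrite /G integral_nneseries//.
  apply: (@le_lt_trans _ _ (\sum_(0 <= k <oo) (2 ^- k)%:E)%E); last first.
    have h := cvg_lim _ (@cvg_geometric_eseries_half R 2 0).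
    rewrite [X in (X < _)%E](_ : _ = (2 / 2 ^+ 0)%:E) ?ltry// -h//.
    congr (limn _); apply/funext => n; rewrite /eseries/=; apply: eq_bigr => k _.
    by rewrite addn1 natrX exprS invfM mulrA divff ?pnatr_eq0// mul1r.
  apply: lee_nneseries => [k *|k *]; first by apply: integral_ge0 => x; exact: G0.
  under eq_integral do rewrite EFinM.
  rewrite ge0_integralZl//; last 2 first.
    by apply/measurable_EFinP; exact: measurable_funX.
    by move=> x _; rewrite lee_fin sqr_ge0.
  have -> : (\int[mu]_x (d_ k x ^+ 2)%:E = (nrm (v (s k.+1) - v (s k)) ^+ 2)%:E)%E.
    by rewrite -integral_sq.
  rewrite -EFinM lee_fin.
  have h := hN0 k _ _ (leq_trans (sN k) (sS k)) (sN k).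
  have h2 : nrm (v (s k.+1) - v (s k)) ^+ 2 <= 8 ^- k.
    apply: (@le_trans _ _ (8 ^- k * 8 ^- k)).
      by rewrite expr2 ler_pM// nrm_ge0.
    by rewrite ler_piMr ?(ltW (e8 k))// invf_le1 ?exprn_gt0// exprn_ege1// ler1n.
  rewrite (le_trans (ler_wpM2l _ h2)) ?exprn_ge0//.
  by rewrite -!exprVn -exprMn; apply: lerXn2r; rewrite ?nnegrE//; lra.
have mG : measurable_fun setT G by apply: ge0_emeasurable_sum => [k x * |k *]; [exact: G0|exact: mt].
pose A := [set x | (G x < +oo)%E].
have mA : measurable A.
  by rewrite -[A]setTI; exact: emeasurable_fun_infty_o.
have aeA : {ae mu, forall x, A x}.
  have iG : mu.-integrable setT G.
    apply/integrableP; split => //.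
    rewrite (eq_integral G)// => x _; rewrite gee0_abs// nneseries_ge0// => *; exact: G0.
  have := integrable_ae measurableT iG; apply: filterS => x /(_ I).
  by rewrite /A/= ltey => /fin_numP[_].
have cA x : A x -> cvgn (fun k => v (s k) x).
  move=> Ax.
  have C k : `|d_ k x| <= (1 + fine (G x)) * 2 ^- k.
    have Gx0 : (0 <= G x)%E by apply: nneseries_ge0 => i _ _; exact: G0.
    have hk : 4 ^+ k * d_ k x ^+ 2 <= fine (G x).
      rewrite -lee_fin fineK ?ge0_fin_numE//.
      apply: (le_trans _ (nneseries_lim_ge k.+1 _)); last by move=> *; exact: G0.
      by rewrite big_nat_recr//= leeDr// sume_ge0// => i _; exact: G0.
    have g0 : 0 <= fine (G x) by rewrite fine_ge0.
    rewrite -(@ler_pXn2r _ 2)// ?nnegrE ?mulr_ge0 ?addr_ge0 ?invr_ge0 ?exprn_ge0//.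
    rewrite real_normK ?num_real// exprMn.
    have -> : (2 ^- k) ^+ 2 = (4 ^+ k)^-1 :> R by rewrite exprVn -exprM mulnC exprM -natrX.
    rewrite ler_pdivlMr ?exprn_gt0// mulrC (le_trans hk)// expr2; nra.
  have : cvgn (series (d_ ^~ x)).
    apply: normed_cvg; apply: (@series_le_cvg _ _ (geometric (1 + fine (G x)) 2^-1)) => //.
    - by move=> k /=.
    - by move=> k /=; rewrite mulr_ge0// ?exprn_ge0// addr_ge0// fine_ge0// nneseries_ge0// => *; exact: G0.
    - by move=> k /=; rewrite exprVn.
    - by apply: is_cvg_geometric_series; rewrite ger0_norm ?invf_lt1// ltr1n.
  have -> : series (d_ ^~ x) = (fun k => v (s k) x - v (s 0%N) x).
    by apply/funext => k; rewrite /series/= (telescope_sumr (fun k => v (s k) x)).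
  move=> /cvg_ex[l hl]; apply/cvg_ex; exists (l + v (s 0%N) x).
  have hc : (fun k => v (s k) x - v (s 0%N) x + v (s 0%N) x) @ \oo --> l + v (s 0%N) x.
    by apply: cvgD => //; exact: cvg_cst.
  by apply: cvg_trans hc; apply: near_eq_cvg; apply: nearW => k; rewrite subrK.
pose h k x := \1_A x * v (s k) x.
have mh k : measurable_fun setT (h k) by apply: measurable_funM.
pose w x := limn (h ^~ x).
have hw x : h ^~ x @ \oo --> w x.
  rewrite /w /h; have [Ax|nAx] := pselect (A x).
    rewrite (_ : (fun k => _) = (fun k => v (s k) x)); first exact: cA.
    by apply/funext => k; rewrite indicE mem_set// mul1r.
  rewrite (_ : (fun k => _) = cst 0); first by rewrite lim_cst//; exact: cvg_cst.
  by apply/funext => k; rewrite indicE memNset// mul0r.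
have mw : measurable_fun setT w by apply: (measurable_fun_cvg mh) => x _; exact: hw.
have vw e : 0 < e -> exists N, forall m, (N <= m)%N ->
    (\int[mu]_x ((v m x - w x) ^+ 2)%:E <= (e ^+ 2)%:E)%E.
  move=> e0; have [N hN] := cv e e0; exists N => m Nm.
  apply: (@fatou_ae _ _ _ _ (fun k x => (v m x - v (s k) x) ^+ 2)).
  - by move=> k; apply: measurable_funX; apply: measurable_funB.
  - by apply: measurable_funX; apply: measurable_funB.
  - by move=> k x; rewrite sqr_ge0.
  - by move=> x; rewrite sqr_ge0.
  - apply: filterS aeA => x Ax.
    have := hw x; rewrite (_ : h ^~ x = (fun k => v (s k) x)); last first.
      by apply/funext => k; rewrite /h indicE mem_set// mul1r.
    move=> hx; have hd : (fun k => v m x - v (s k) x) @ \oo --> v m x - w x.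
      by apply: cvgB => //; exact: cvg_cst.
    exact: (cvgM hd hd).
  - near=> k.
    have -> : (\int[mu]_x ((v m x - v (s k) x) ^+ 2)%:E = (nrm (v m - v (s k)) ^+ 2)%:E)%E.
      by rewrite -integral_sq.
    rewrite lee_fin; apply: lerXn2r; rewrite ?nnegrE ?nrm_ge0 ?(ltW e0)//.
    apply: hN => //; apply: (@leq_trans k); last exact: leq_addr.
    by near: k; exact: nbhs_infty_ge.
have [N1 hN1] := vw 1 ltr01.
have mvw : measurable_fun setT (fun x => v N1 x - w x) by apply: measurable_funB.
have [z zE] : exists z : L2, (z : T -> R) = (fun x => v N1 x - w x).
  by apply: mkL2 => //; apply: (le_lt_trans (hN1 _ (leqnn _))); rewrite ltry.
have wE : ((v N1 - z : L2) : T -> R) = w.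
  by apply/funext => x; rewrite -[LHS]/(v N1 x - z x) zE opprB addrC subrK.
exists (v N1 - z); apply/cvgrPdist_le => e e0.
have [N hN] := vw e e0; exists N => // m Nm /=.
rewrite sub0r normrN ger0_norm ?nrm_ge0//.
rewrite -(@ler_pXn2r _ 2)// ?nnegrE ?nrm_ge0 ?(ltW e0)//.
rewrite -lee_fin -integral_sq.
rewrite (_ : (fun x => _) = (fun x => ((v m x - w x) ^+ 2)%:E)); first exact: hN.
by apply/funext => x; rewrite -wE.
Unshelve. all: by end_near. Qed.


End L2.

(** * Orthonormal sequences and spectral series *)

Section orthonormal.
Context d (T : measurableType d) (R : realType) (mu : {measure set T -> \bar R}).
Notation L2 := (LfunType mu (lee1n 2)).
Variable phi : nat -> L2.
Hypothesis hphi : forall j k, ip (phi j) (phi k) = (j == k)%:R.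

Definition opsum (a : nat -> R) n : L2 := \sum_(0 <= k < n) a k *: phi k.

Lemma ip_opsum a n j : ip (opsum a n) (phi j) = (j < n)%:R * a j.
Proof.
rewrite /opsum ip_suml big_mkord.
under eq_bigr do rewrite ipZl hphi.
have [jn|nj] := ltnP j n.
  rewrite (bigD1 (Ordinal jn))//= eqxx mulr1 big1 ?addr0 ?mul1r// => i.
  by rewrite -val_eqE/= => /negPf ->; rewrite mulr0.
rewrite mul0r big1// => i _; rewrite ltn_eqF ?mulr0//.
exact: leq_trans (ltn_ord i) nj.
Qed.

Lemma opsum_nrm a n : nrm (opsum a n) ^+ 2 = \sum_(0 <= k < n) a k ^+ 2.
Proof.
rewrite -ip_sq {2}/opsum ip_sumr; apply: eq_big_nat => k /andP[_ kn].
by rewrite ipZr ip_opsum kn mul1r expr2.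
Qed.

Lemma opsumB_nrm a m n : (m <= n)%N ->
  nrm (opsum a n - opsum a m) ^+ 2 = \sum_(m <= k < n) a k ^+ 2.
Proof.
move=> mn.
have -> : opsum a n - opsum a m = opsum (fun k => (m <= k)%:R * a k) n.
  rewrite /opsum (big_cat_nat (n := m))//= addrAC subrr add0r.
  rewrite [RHS](big_cat_nat (n := m))//= [X in _ = X + _]big1_seq ?add0r.
    by apply: eq_big_nat => k /andP[-> _]; rewrite mul1r.
  by move=> k /andP[_]; rewrite mem_index_iota => /andP[_ km]; rewrite leqNgt km mul0r scale0r.
rewrite opsum_nrm (big_cat_nat (n := m))//= [X in X + _]big1_seq ?add0r.
  by apply: eq_big_nat => k /andP[-> _]; rewrite mul1r.
by move=> k /andP[_]; rewrite mem_index_iota => /andP[_ km]; rewrite leqNgt km mul0r expr0n.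
Qed.

Lemma bessel v n : \sum_(0 <= k < n) ip v (phi k) ^+ 2 <= nrm v ^+ 2.
Proof.
set a := fun k => ip v (phi k).
have h := sqr_ge0 (nrm (v - opsum a n)); rewrite -subr_ge0.
suff : nrm (v - opsum a n) ^+ 2 = nrm v ^+ 2 - \sum_(0 <= k < n) a k ^+ 2 by move=> <-.
rewrite -ip_sq ipBl !ipBr !ip_sq opsum_nrm.
have -> : ip v (opsum a n) = \sum_(0 <= k < n) a k ^+ 2.
  by rewrite /opsum ip_sumr; apply: eq_bigr => k _; rewrite ipZr expr2.
rewrite (ipC (opsum a n)).
have -> : ip v (opsum a n) = \sum_(0 <= k < n) a k ^+ 2.
  by rewrite /opsum ip_sumr; apply: eq_bigr => k _; rewrite ipZr expr2.
by ring.
Qed.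

Lemma riesz_fischer (a : nat -> R) B :
  (forall n, \sum_(0 <= k < n) a k ^+ 2 <= B) ->
  exists w, [/\ cvgL2 (opsum a) w, nrm w ^+ 2 <= B & forall k, ip w (phi k) = a k].
Proof.
move=> aB.
have ca : cvgn (series (fun k => a k ^+ 2)).
  apply: nondecreasing_is_cvgn; first by apply: nondecreasing_series => *; exact: sqr_ge0.
  by exists B => _ [n _ <-]; exact: aB.
have [w hw] : exists w, cvgL2 (opsum a) w.
  apply: L2_complete => e e0.
  have e20 : 0 < e ^+ 2 / 2 by rewrite divr_gt0// exprn_gt0.
  move/cvgrPdist_le : ca => /(_ _ e20)[N _ hN].
  have key m n : (N <= m)%N -> (m <= n)%N -> nrm (opsum a m - opsum a n) <= e.
    move=> Nm mn; have Nn := leq_trans Nm mn.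
    rewrite -(@ler_pXn2r _ 2)// ?nnegrE ?nrm_ge0 ?(ltW e0)// nrmBC opsumB_nrm//.
    rewrite -(sub_series_geq _ mn).
    have h1 := hN _ Nm; have h2 := hN _ Nn.
    apply: (le_trans (ler_norm _)).
    set L := limn _ in h1 h2.
    rewrite (_ : _ - _ = (L - series (fun k => a k ^+ 2) m) - (L - series (fun k => a k ^+ 2) n)); last by ring.
    by rewrite (le_trans (ler_normB _ _))// (le_trans (lerD h1 h2))// -splitr.
  exists N => m n Nm Nn; have [mn|/ltnW nm] := leqP m n; first exact: key.
  by rewrite nrmBC; exact: key.
exists w; split => //.
- have h := cvgL2_nrm hw.
  apply: (cvgr_to_le (cvgM h h)); apply: nearW => n.
  by rewrite -[leLHS]/(nrm (opsum a n) * nrm (opsum a n)) -expr2 opsum_nrm.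
- move=> k; have h : (fun n => ip (opsum a n) (phi k)) @ \oo --> ip w (phi k) := cvgL2_ipl hw.
  have h2 : (fun n => ip (opsum a n) (phi k)) @ \oo --> a k.
    apply: cvg_trans (@cvg_cst _ (a k) _ \oo _); apply: near_eq_cvg; near=> n.
    rewrite ip_opsum (_ : (k < n)%N = true) ?mul1r//.
    by near: n; exact: nbhs_infty_gt.
  exact: (cvg_unique _ h h2).
Unshelve. all: by end_near. Qed.

End orthonormal.

Section spectral.
Context {R : realType}.
Variables (lam : nat -> R) (phi : nat -> L2D R).
Hypothesis hphi : forall j k, inner (phi j) (phi k) = (j == k)%:R.

Let hphi' : forall j k, ip (phi j) (phi k) = (j == k)%:R := hphi.

Lemma L2limP (v : nat -> L2D R) w : L2cvg v w -> L2cvg v (L2lim v).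
Proof.
by move=> vw; rewrite /L2lim; case: xgetP => [x _ //|/(_ w)]; exact.
Qed.

(** [L2lim] selects an arbitrary limit, which agrees with the one from [riesz_fischer] only up to
    norm 0. Norms and coefficients do not see the difference. *)
Lemma spectral_series_summable c v B :
  (forall n, \sum_(0 <= k < n) (c k * inner v (phi k)) ^+ 2 <= B) ->
  [/\ exists w, L2cvg (spectral_psum phi c v) w,
     L2norm (L2lim (spectral_psum phi c v)) ^+ 2 <= B &
     forall k, inner (L2lim (spectral_psum phi c v)) (phi k) = c k * inner v (phi k)].
Proof.
move=> hB.
have [w [h1 h2 h3]] := riesz_fischer hphi' hB.
have h4 := L2limP h1.
have h0 := cvgL2_unique h1 h4.
split; first by exists w.
- have := nrm_dist w (L2lim (spectral_psum phi c v)).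
  rewrite h0 normr_le0 subr_eq0 => /eqP E.
  by rewrite -[L2norm _]/(nrm _) -E.
- move=> k; rewrite -h3; apply/eqP; rewrite eq_sym -subr_eq0 -[inner _ _]/(ip _ _) -ipBl.
  by rewrite nrm0_ip.
Qed.

Lemma spectral_bounded c v : (forall k, `|c k| <= 1) ->
  L2norm (L2lim (spectral_psum phi c v)) <= L2norm v /\
  forall k, inner (L2lim (spectral_psum phi c v)) (phi k) = c k * inner v (phi k).
Proof.
move=> c1.
have hB n : \sum_(0 <= k < n) (c k * inner v (phi k)) ^+ 2 <= L2norm v ^+ 2.
  apply: le_trans (bessel hphi' v n); apply: ler_sum => k _.
  rewrite exprMn ler_piMl ?sqr_ge0// -real_normK ?num_real//.
  by rewrite expr_le1.
have [_ h2 h3] := spectral_series_summable hB; split=> //.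
by rewrite -(@ler_pXn2r _ 2)// nnegrE; exact: nrm_ge0.
Qed.

End spectral.

(** * The Dirichlet eigensystem *)

Section lebD_integral.
Context {R : realType}.

Lemma lebD_finite : fin_num_fun (lebD R).
Proof.
move=> U mU; rewrite ge0_fin_numE//.
apply: (@le_lt_trans _ _ (lebesgue_measure (@D R))).
  rewrite /lebD/= /mrestr le_measure// ?inE//; first by apply: measurableI => //; exact: measurable_D.
  exact: measurable_D.
by rewrite /D lebesgue_measure_itv/= lte_fin ltr01 oppr0 adde0 ltry.
Qed.

Definition lebDm : set (measurableTypeR R) -> \bar R := lebD R.

HB.instance Definition _ := Measure.on lebDm.

Lemma lebDm_finite : fin_num_fun lebDm.
Proof. exact: lebD_finite. Qed.

HB.instance Definition _ := Measure_isFinite.Build _ _ R lebDm lebDm_finite.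

Lemma integral_lebD (f : measurableTypeR R -> \bar R) : measurable_fun setT f ->
  (\int[lebD R]_x f x = \int[lebesgue_measure]_(x in D) f x)%E.
Proof. exact: integral_mrestr. Qed.

End lebD_integral.

(** * Classification of the Dirichlet eigenfunctions *)

Section dirichlet.
Context {R : realType}.
Implicit Types (x y l w : R).

Lemma derive0_constant (f : R -> R) a b :
  (forall x, a < x < b -> is_derive x 1 f 0) ->
  forall x y, a < x < b -> a < y < b -> f x = f y.
Proof.
move=> df.
suff h x y : x < y -> a < x < b -> a < y < b -> f x = f y.
  move=> x y xab yab; have [xy|yx|->//] := ltgtP x y; first exact: h.
  by apply/esym; exact: h.
move=> xy /andP[ax xb] /andP[ay yb].
have df' z : z \in `]x, y[ -> is_derive z 1 f 0.
  by rewrite in_itv/= => /andP[xz zy]; apply: df; rewrite (lt_trans ax)//= (lt_trans zy).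
have cf : {within `[x, y], continuous f}.
  apply: derivable_within_continuous => z; rewrite in_itv/= => /andP[xz zy].
  have [] := df z; first by rewrite (lt_le_trans ax)//= (le_lt_trans zy).
  by [].
have [c _] := MVT xy df' cf.
by rewrite mul0r => /eqP; rewrite subr_eq0 => /eqP.
Qed.

Lemma derive_ge0_nondecreasing (f df : R -> R) a b :
  (forall x, a < x < b -> is_derive x 1 f (df x)) ->
  (forall x, a < x < b -> 0 <= df x) ->
  forall x y, a < x -> x <= y -> y < b -> f x <= f y.
Proof.
move=> hdf df0 x y ax; rewrite le_eqVlt => /predU1P[->//|xy yb].
have df' z : z \in `]x, y[ -> is_derive z 1 f (df z).
  by rewrite in_itv/= => /andP[xz zy]; apply: hdf; rewrite (lt_trans ax)//= (lt_trans zy).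
have cf : {within `[x, y], continuous f}.
  apply: derivable_within_continuous => z; rewrite in_itv/= => /andP[xz zy].
  have [] := hdf z; first by rewrite (lt_le_trans ax)//= (le_lt_trans zy).
  by [].
have [c cxy h] := MVT xy df' cf.
rewrite -subr_ge0 h mulr_ge0 ?subr_ge0 ?(ltW xy)//.
move: cxy; rewrite in_itv/= => /andP[xc cy]; apply: df0.
by rewrite (lt_trans ax)//= (lt_trans cy).
Qed.

Lemma is_derive_sinM w x : is_derive x 1 (fun z => sin (w * z)) (w * cos (w * x)).
Proof.
have := @is_derive1_comp _ sin ( *%R w) x _ _ (is_derive_sin _) (is_deriveZ _ _).
by move=> /(_ _ (is_derive_id _ _)); rewrite /GRing.scale/= mulr1 mulrC; exact.
Qed.

Lemma is_derive_cosM w x : is_derive x 1 (fun z => cos (w * z)) (- (w * sin (w * x))).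
Proof.
have := @is_derive1_comp _ cos ( *%R w) x _ _ (is_derive_cos _) (is_deriveZ _ _).
by move=> /(_ _ (is_derive_id _ _)); rewrite /GRing.scale/= mulr1 mulNr mulrC; exact.
Qed.

Section eigenpair.
Variables (l : R) (p : L2D R).
Hypothesis hp : dirichlet_eigenpair l p.
Let q : R -> R := p.
Let dq := derive1 q.

Let dp x : 0 < x < 1 -> is_derive x 1 q (dq x).
Proof.
move=> x01; have [h _] := eigen_derivable hp x01.
by rewrite /dq derive1E; exact: derivableP.
Qed.

Let ddp x : 0 < x < 1 -> is_derive x 1 dq (- l * q x).
Proof.
move=> x01; have [_ h] := eigen_derivable hp x01.
have := derivableP h; rewrite -derive1E.
by have := eigen_eq hp x01; rewrite mulNr => <-; rewrite opprK.
Qed.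

Let cq0 : q x @[x --> 0^'+] --> (0 : R).
Proof.
have := eigen_continuous hp => /continuous_within_itvP -/(_ ltr01)[_ h _].
by rewrite (eigen_left hp) in h.
Qed.

Let cq1 : q x @[x --> 1^'-] --> (0 : R).
Proof.
have := eigen_continuous hp => /continuous_within_itvP -/(_ ltr01)[_ _ h].
by rewrite (eigen_right hp) in h.
Qed.

(** For l <= 0 the product q q' is nondecreasing, its derivative being q'^2 - l q^2. But if q x is
    not 0, then q^2, which vanishes at both ends, has positive derivative somewhere left of x and
    negative derivative somewhere right of x. *)
Lemma eigen_nonpos : l <= 0 -> forall x, 0 < x < 1 -> q x = 0.
Proof.
move=> l0 x x01.
have d2 y : 0 < y < 1 -> is_derive y 1 (fun z => q z * q z) (2 * (q y * dq y)).
  move=> y01; have h := dp y01.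
  by apply: is_derive_eq; rewrite /GRing.scale/=; ring.
have dm y : 0 < y < 1 -> is_derive y 1 (fun z => q z * dq z) (dq y ^+ 2 - l * q y ^+ 2).
  move=> y01; have h := dp y01; have h' := ddp y01.
  by apply: is_derive_eq; rewrite /GRing.scale/=; ring.
have mono := derive_ge0_nondecreasing dm.
have {}mono : forall x y, 0 < x -> x <= y -> y < 1 -> q x * dq x <= q y * dq y.
  by apply: mono => z z01; rewrite subr_ge0 (@le_trans _ _ 0) ?sqr_ge0// mulr_le0_ge0// sqr_ge0.
have [x0 x1] := andP x01.
apply/eqP; rewrite -sqrf_eq0 expr2; apply/negP => /negP qx0.
have qx : 0 < q x * q x by rewrite lt_neqAle eq_sym qx0 -expr2 sqr_ge0.
have cq2 : {within `[0, 1], continuous (fun z => q z * q z)}.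
  have h := eigen_continuous hp.
  by move=> z; apply: cvgM; exact: h.
have c1 : {within `[0, x], continuous (fun z => q z * q z)}.
  by apply: continuous_subspaceW cq2; apply: subset_itvl; rewrite bnd_simp ltW.
have c2 : {within `[x, 1], continuous (fun z => q z * q z)}.
  by apply: continuous_subspaceW cq2; apply: subset_itvr; rewrite bnd_simp ltW.
have [y1 +] := @MVT _ _ (fun z => 2 * (q z * dq z)) _ _ x0
  (fun z zi => d2 z (ltac:(move: zi; rewrite in_itv/= => /andP[-> /lt_trans]; exact))) c1.
rewrite in_itv/= => /andP[y10 y1x].
have -> : q 0 = 0 by exact: eigen_left hp.
rewrite mul0r !subr0 => e1.
have [y2 +] := @MVT _ _ (fun z => 2 * (q z * dq z)) _ _ x1
  (fun z zi => d2 z (ltac:(move: zi; rewrite in_itv/= => /andP[xz z1]; exact/andP/(conj (lt_trans x0 xz) z1)))) c2.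
rewrite in_itv/= => /andP[xy2 y21].
have -> : q 1 = 0 by exact: eigen_right hp.
rewrite mul0r sub0r => e2.
have := mono y1 y2 y10 (ltW (lt_trans y1x xy2)) y21.
apply/negP; rewrite -ltNge; apply: (@lt_trans _ _ 0).
  have : 2 * (q y2 * dq y2) * (1 - x) < 0 by rewrite -e2 oppr_lt0.
  by rewrite pmulr_llt0 ?subr_gt0// pmulr_rlt0.
have : 0 < 2 * (q y1 * dq y1) * x by rewrite -e1.
by rewrite pmulr_lgt0// pmulr_rgt0.
Qed.

(** [A] and [B] are the Wronskians of q with sin (w x) and cos (w x), hence constant, and q is
    recovered from them. Derivatives exist only inside the interval, so the boundary conditions
    enter as one-sided limits: A = 0 at 0, then B sin w = 0 at 1. *)
Lemma eigen_pos w : 0 < w -> l = w ^+ 2 ->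
  exists2 c, (c != 0 -> sin w = 0) & forall x, 0 < x < 1 -> q x = c * sin (w * x).
Proof.
move=> w0 lw.
have ds x := is_derive_sinM w x.
have dc x := is_derive_cosM w x.
pose A x := dq x * sin (w * x) - w * (q x * cos (w * x)).
pose B x := dq x * cos (w * x) + w * (q x * sin (w * x)).
have dA x : 0 < x < 1 -> is_derive x 1 A 0.
  move=> x01; have h := dp x01; have h' := ddp x01; have h1 := ds x; have h2 := dc x.
  by apply: is_derive_eq; rewrite /GRing.scale/= lw; ring.
have dB x : 0 < x < 1 -> is_derive x 1 B 0.
  move=> x01; have h := dp x01; have h' := ddp x01; have h1 := ds x; have h2 := dc x.
  by apply: is_derive_eq; rewrite /GRing.scale/= lw; ring.
have h12 : 0 < (2^-1 : R) < 1 by rewrite invr_gt0 ltr0n/= invf_lt1// ltr1n.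
pose a := A 2^-1; pose b := B 2^-1.
have E x : 0 < x < 1 -> q x = (b * sin (w * x) - a * cos (w * x)) / w.
  move=> x01; rewrite /a /b (derive0_constant dA h12 x01) (derive0_constant dB h12 x01).
  apply: (mulIf (lt0r_neq0 w0)); rewrite divfK ?gt_eqF// /A /B.
  have cs := cos2Dsin2 (w * x).
  rewrite [RHS](_ : _ = w * q x * (cos (w * x) ^+ 2 + sin (w * x) ^+ 2)); last by ring.
  by rewrite cs mulr1 mulrC.
have cs x : {for x, continuous (fun x => sin (w * x))}.
  have [h _] := ds x.
  by apply: differentiable_continuous; apply/derivable1_diffP.
have cc x : {for x, continuous (fun x => cos (w * x))}.
  have [h _] := dc x.
  by apply: differentiable_continuous; apply/derivable1_diffP.
have crhs x : {for x, continuous (fun x => (b * sin (w * x) - a * cos (w * x)) / w)}.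
  apply: cvgMr_tmp; apply: cvgB; apply: cvgMl_tmp; [exact: cs|exact: cc].
have a0 : a = 0.
  have h1 : (b * sin (w * x) - a * cos (w * x)) / w @[x --> 0^'+] --> (0 : R).
    apply: cvg_trans cq0; apply: near_eq_cvg; near=> x.
    by apply: E; apply/andP; split; near: x; [exact: nbhs_right_gt|exact: nbhs_right_lt].
  have h2 := cvg_at_right_filter (crhs 0).
  have /eqP : (0 : R) = (b * sin (w * 0) - a * cos (w * 0)) / w by apply: (cvg_unique _ h1 h2).
  rewrite mulr0 sin0 cos0 mulr0 mulr1 sub0r eq_sym.
  by rewrite mulf_eq0 invr_eq0 (gt_eqF w0) orbF oppr_eq0 => /eqP.
have bs : b * sin w = 0.
  have h1 : (b * sin (w * x) - a * cos (w * x)) / w @[x --> 1^'-] --> (0 : R).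
    apply: cvg_trans cq1; apply: near_eq_cvg; near=> x.
    by apply: E; apply/andP; split; near: x; [exact: nbhs_left_gt|exact: nbhs_left_lt].
  have h2 := cvg_at_left_filter (crhs 1).
  have /eqP : (0 : R) = (b * sin (w * 1) - a * cos (w * 1)) / w by apply: (cvg_unique _ h1 h2).
  rewrite mulr1 a0 mul0r subr0 eq_sym.
  by rewrite mulf_eq0 invr_eq0 (gt_eqF w0) orbF => /eqP.
exists (b / w).
  rewrite mulf_eq0 invr_eq0 (gt_eqF w0) orbF => b0.
  by move/eqP : bs; rewrite mulf_eq0 (negPf b0) => /eqP.
by move=> x x01; rewrite (E x x01) a0 mul0r subr0 mulrAC.
Unshelve. all: by end_near. Qed.


Lemma sin_natpi x n : sin (x + n%:R * pi) = (-1) ^+ n * sin x.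
Proof.
elim: n => [|n IH]; first by rewrite mul0r addr0 expr0 mul1r.
by rewrite -natr1 mulrDl mul1r addrA sinDpi IH exprS mulN1r mulNr.
Qed.

Lemma sin_eq0_natpi w : 0 <= w -> sin w = 0 -> exists m : nat, w = m%:R * pi.
Proof.
move=> w0 sw; exists (Num.truncn (w / pi)).
have pi0 := @pi_gt0 R.
have /andP[h1 h2] := truncn_itv (divr_ge0 w0 (ltW pi0)).
set m := Num.truncn _ in h1 h2 *.
apply/eqP; rewrite -subr_eq0; apply/negP => /negP x0.
set x := w - _ in x0.
have xpos : 0 < x < pi.
  rewrite lt_neqAle eq_sym x0 /x subr_ge0 -ler_pdivlMr// h1/=.
  by rewrite ltrBlDr -{1}(mul1r pi) -mulrDl -ltr_pdivrMr// addrC natr1.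
have : sin x = 0.
  have := sin_natpi x m; rewrite /x subrK sw => /eqP.
  by rewrite eq_sym mulf_eq0 signr_eq0 => /eqP.
by have /andP[? ?] := xpos; have := sin_gt0_pi xpos => /[swap] ->; rewrite ltxx.
Qed.

Hypothesis p1 : ip p p = 1.

(** The normalisation excludes the zero function, hence l <= 0 by [eigen_nonpos]; it also makes c
    nonzero in [eigen_pos], so the square root of l is a zero of the sine. *)
Lemma eigen_sin : exists m : nat, [/\ (0 < m)%N, l = (m%:R * pi) ^+ 2 &
  exists c, forall x, 0 < x < 1 -> p x = c * sin (m%:R * pi * x)].
Proof.
have p0 : (forall x, 0 < x < 1 -> q x = 0) -> False.
  move=> q0; have : ip p p = 0.
    rewrite /ip /Rintegral integral_lebD; last first.
      by apply/measurable_EFinP; apply: measurable_funM.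
    rewrite (eq_integral (cst 0%E)) ?integral0// => x; rewrite inE /D/= in_itv/= => x01.
    by rewrite -/q q0// mul0r.
  by rewrite p1 => /eqP; rewrite oner_eq0.
have [l0|l0] := leP l 0; first by exfalso; apply: p0; exact: eigen_nonpos.
have s0 : 0 < Num.sqrt l by rewrite sqrtr_gt0.
have lE : l = Num.sqrt l ^+ 2 by rewrite sqr_sqrtr// ltW.
have [c sc qE] := eigen_pos s0 lE.
have c0 : c != 0.
  by apply/negP => /eqP c0; apply: p0 => x x01; rewrite qE// c0 mul0r.
have [m mE] := sin_eq0_natpi (ltW s0) (sc c0).
exists m; split; last by exists c => x x01; rewrite -mE; exact: qE.
  by rewrite lt0n; apply/negP => /eqP m0; move: s0; rewrite mE m0 mul0r ltxx.
by rewrite -mE.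
Qed.

End eigenpair.

Lemma integral_sin2 (m : nat) : (0 < m)%N ->
  \int[lebD R]_x (sin (m%:R * pi * x) ^+ 2) = 2^-1.
Proof.
move=> m0; pose w : R := m%:R * pi.
have w0 : 0 < w by rewrite mulr_gt0 ?ltr0n// pi_gt0.
have cs : continuous (fun x => sin (w * x)).
  by move=> x; apply: continuous_comp; [exact: mulrl_continuous|exact: continuous_sin].
have cs2 : continuous (fun x => sin (w * x) ^+ 2).
  rewrite (_ : (fun x => _) = (fun x => sin (w * x) * sin (w * x))); last first.
    by apply/funext => x; rewrite expr2.
  by move=> x; apply: cvgM; exact: cs.
rewrite /Rintegral integral_lebD; last first.
  by apply/measurable_EFinP; exact: continuous_measurable_fun.
rewrite /D -(@integral_itv_bndoo _ 0 1 _ true false); last first.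
  by apply/measurable_EFinP; apply: measurable_funTS; exact: continuous_measurable_fun.
pose F x : R := (x - sin (w * x) * cos (w * x) / w) / 2.
have dF (x : R) : is_derive x 1 F (sin (w * x) ^+ 2).
  have d1 : is_derive x 1 (fun z => sin (w * z)) (w * cos (w * x)) := is_derive_sinM w x.
  have d2 : is_derive x 1 (fun z => cos (w * z)) (- (w * sin (w * x))) := is_derive_cosM w x.
  have d3 : is_derive x 1 (fun z => z - w^-1 * (sin (w * z) * cos (w * z))) (2 * sin (w * x) ^+ 2).
    apply: is_derive_eq; rewrite /GRing.scale/=.
    rewrite [LHS](_ : _ = 1 - cos (w * x) ^+ 2 + sin (w * x) ^+ 2); last by field; rewrite gt_eqF.
    by have := cos2Dsin2 (w * x); lra.
  rewrite (_ : F = (fun z => 2^-1 * (z - w^-1 * (sin (w * z) * cos (w * z))))); last first.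
    by apply/funext => z; rewrite /F; field; rewrite gt_eqF.
  by apply: is_derive_eq; rewrite /GRing.scale/=; field.
rewrite (@continuous_FTC2 _ (fun x => sin (w * x) ^+ 2) F) //.
- rewrite -EFinB /= /F /w !mulr0 sin0 !mul0r subr0 mul0r mulr1.
  have := sin_natpi 0 m; rewrite add0r sin0 mulr0 => ->.
  by rewrite !mul0r !subr0 div1r.
- exact: continuous_subspaceT.
- have cF x : {for x, continuous F}.
    by apply: differentiable_continuous; apply/derivable1_diffP; have [] := dF x.
  split; first by move=> x _; have [] := dF x.
  + apply: cvg_at_right_filter; exact: cF.
  + apply: cvg_at_left_filter; exact: cF.
- by move=> x _; rewrite derive1E; have h := dF x; rewrite derive_val.
Qed.

(** Two equal frequencies would give the inner product c_j c_k / 2, which is not 0, against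
    orthogonality. As the eigenvalues are nondecreasing, the frequencies are then strictly
    increasing, whence k < m k. *)
Lemma dirichlet_eigensystemP (lam : nat -> R) (phi : nat -> L2D R) :
  dirichlet_eigensystem lam phi ->
  exists (m : nat -> nat) (c : nat -> R), forall k,
    [/\ (k < m k)%N, lam k = ((m k)%:R * pi) ^+ 2, c k ^+ 2 = 2 &
      forall x, 0 < x < 1 -> phi k x = c k * sin ((m k)%:R * pi * x)].
Proof.
move=> hA.
have h k : exists mc : nat * R, [/\ (0 < mc.1)%N, lam k = (mc.1%:R * pi) ^+ 2 &
    forall x, 0 < x < 1 -> phi k x = mc.2 * sin (mc.1%:R * pi * x)].
  have := eigensystem_orthonormal hA k k; rewrite eqxx => h1.
  by have [m [m0 lm [c hc]]] := eigen_sin (eigensystem_pair hA k) h1; exists (m, c).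
have [mc hmc] := choice h.
pose m k := (mc k).1; pose c k := (mc k).2.
have inn j k : m j = m k -> inner (phi j) (phi k) = c j * c k / 2.
  move=> mjk; have [mj0 _ hj] := hmc j; have [_ _ hk] := hmc k.
  rewrite -[2^-1](integral_sin2 mj0) -/(m j).
  have cs : continuous (fun x : R => sin ((m j)%:R * pi * x)).
    by move=> x; apply: continuous_comp; [exact: mulrl_continuous|exact: continuous_sin].
  have cs2 : continuous (fun x => sin ((m j)%:R * pi * x) ^+ 2).
    rewrite (_ : (fun x => _) = (fun x => sin ((m j)%:R * pi * x) * sin ((m j)%:R * pi * x))); last first.
      by apply/funext => x; rewrite expr2.
    by move=> x; apply: cvgM; exact: cs.
  have ms : measurable_fun setT (EFin \o (fun x => sin ((m j)%:R * pi * x) ^+ 2)).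
    by apply/measurable_EFinP; exact: continuous_measurable_fun.
  rewrite /inner /Rintegral !integral_lebD//; last first.
    by apply/measurable_EFinP; apply: measurable_funM.
  have iS : lebesgue_measure.-integrable D (EFin \o (fun x : measurableTypeR R => sin ((m j)%:R * pi * x) ^+ 2)).
    apply: (@integrableS _ _ _ lebesgue_measure `[0, 1]%classic); [exact: measurable_itv|exact: measurable_D|..].
      by apply: subset_itv; rewrite bnd_simp.
    apply: continuous_compact_integrable; first exact: segment_compact.
    exact: continuous_subspaceT.
  rewrite -/(Rintegral _ _ _) -/(Rintegral _ _ _) -RintegralZl//; last exact: measurable_D.
  apply: eq_Rintegral => x.
  rewrite inE /D/= in_itv/= => x01; rewrite hj// hk// -/(m j) -/(m k) -mjk -/(c j) -/(c k).
  by ring.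
have c2 k : c k ^+ 2 = 2.
  have := eigensystem_orthonormal hA k k; rewrite inn// eqxx => /eqP.
  by rewrite -(inj_eq (mulIf (lt0r_neq0 (ltr0Sn R 1)))) divfK ?pnatr_eq0// mul1r -expr2 => /eqP.
have mS k : (m k < m k.+1)%N.
  have [_ lk _] := hmc k; have [mS0 lk1 _] := hmc k.+1.
  have := eigensystem_nondecreasing hA (leqnSn k).
  rewrite lk lk1 ler_pXn2r ?nnegrE ?mulr_ge0 ?pi_ge0// ler_pM2r ?pi_gt0// ler_nat.
  rewrite -/(m k) -/(m k.+1) leq_eqVlt => /predU1P[mE|//].
  have := eigensystem_orthonormal hA k k.+1; rewrite inn// ltn_eqF// => /eqP.
  rewrite mulf_eq0 invr_eq0 pnatr_eq0 orbF -sqrf_eq0 exprMn !c2 -natrM pnatr_eq0//.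
exists m, c => k; have [m0 lk hk] := hmc k; split => //.
elim: k {m0 lk hk} => [|k IH]; first by have [] := hmc 0%N.
exact: leq_ltn_trans IH (mS k).
Qed.

End dirichlet.

(** * Hartley transforms and fractional covariance *)

Section change_of_variables.
Context {R : realType}.
Notation mu := (@lebesgue_measure R).
Local Open Scope ereal_scope.

Lemma integral_indic_mul d (T : measurableType d) (m : {measure set T -> \bar R})
    (A : set T) (f : T -> R) :
  \int[m]_(x in A) (f x)%:E = \int[m]_x (\1_A x * f x)%:E.
Proof.
rewrite integral_mkcond; apply: eq_integral => x _.
by rewrite patchE indicE; case: ifPn => /= _; rewrite ?mul1r ?mul0r.
Qed.

(** By uniqueness of Lebesgue measure: the scaled image measure agrees with it on half-open
    intervals. *)
Lemma lebesgue_measure_affine (a b : R) : (0 < a)%R -> forall A, measurable A ->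
  mu A = a%:E * mu ((fun x : measurableTypeR R => (a * x + b)%R) @^-1` A).
Proof.
move=> a0.
have mf : measurable_fun setT ((fun x => (a * x + b)%R) : measurableTypeR R -> measurableTypeR R).
  by apply: measurable_funD => //; apply: measurable_funM.
pose g (x : measurableTypeR R) : measurableTypeR R := (a * x + b)%R.
pose nu : {measure set (measurableTypeR R) -> \bar R} := mscale (NngNum (ltW a0)) (pushforward mu g).
move=> A mA; rewrite (@lebesgue_measure_unique _ (nu mf))// => _ [[c d]] _ <-.
rewrite /nu/= /mscale/= /pushforward.
rewrite (_ : _ @^-1` _ = `](c - b) / a, (d - b) / a]%classic)%R; last first.
  apply/seteqP; split => x /=; rewrite !in_itv/= => /andP[h1 h2]; apply/andP; split;
    move: h1 h2; rewrite ?ltr_pdivrMr// ?ler_pdivlMr// mulrC ?ltrBlDr ?lerBrDr//.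
rewrite !lebesgue_measure_itv/= !lte_fin.
rewrite (_ : ((c - b) / a < (d - b) / a)%R = (c < d)%R); last first.
  by rewrite ltr_pM2r ?invr_gt0// ltrD2r.
case: ifPn => _; last by rewrite mule0.
by rewrite -!EFinB -EFinM; congr EFin; field; rewrite gt_eqF.
Qed.

Lemma ge0_integral_affine (a b : R) (f : R -> \bar R) : (0 < a)%R ->
  measurable_fun setT f -> (forall x, 0 <= f x) ->
  a%:E * \int[mu]_x f (a * x + b)%R = \int[mu]_x f x.
Proof.
move=> a0 mf0 f0.
have mf : measurable_fun setT ((fun x => (a * x + b)%R) : measurableTypeR R -> measurableTypeR R).
  by apply: measurable_funD => //; apply: measurable_funM.
pose g (x : measurableTypeR R) : measurableTypeR R := (a * x + b)%R.
pose nu : {measure set (measurableTypeR R) -> \bar R} := mscale (NngNum (ltW a0)) (pushforward mu g).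
rewrite [RHS](@eq_measure_integral _ _ _ _ (nu mf)); last first.
  by move=> A mA _; exact: (lebesgue_measure_affine b a0).
rewrite ge0_integral_mscale//=; congr (_ * _).
by rewrite (@ge0_integral_pushforward _ _ _ _ _ _ mf mu setT f).
Qed.

Lemma ge0_integral_opp (f : R -> \bar R) :
  measurable_fun setT f -> (forall x, 0 <= f x) ->
  \int[mu]_x f (- x)%R = \int[mu]_x f x.
Proof.
move=> mf f0.
have mN : measurable_fun setT (-%R : measurableTypeR R -> measurableTypeR R) by exact: oppr_measurable.
pose nu : {measure set (measurableTypeR R) -> \bar R} := pushforward mu (-%R : measurableTypeR R -> measurableTypeR R).
rewrite [RHS](@eq_measure_integral _ _ _ _ (nu mN)); last first.
  by move=> A mA _; apply/esym; exact: lebesgue_measureN.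
by rewrite (@ge0_integral_pushforward _ _ _ _ _ _ mN mu setT f).
Qed.

Lemma ge0_integral_shift (b : R) (f : R -> \bar R) :
  measurable_fun setT f -> (forall x, 0 <= f x) ->
  \int[mu]_x f (x + b)%R = \int[mu]_x f x.
Proof.
move=> mf f0; rewrite -(ge0_integral_affine b ltr01 mf f0) mul1e.
by apply: eq_integral => x _; rewrite mul1r.
Qed.

Lemma ge0_integral_reflect (b : R) (f : R -> \bar R) :
  measurable_fun setT f -> (forall x, 0 <= f x) ->
  \int[mu]_x f (b - x)%R = \int[mu]_x f x.
Proof.
move=> mf f0; rewrite -(ge0_integral_shift b mf f0) -[RHS]ge0_integral_opp//.
  by apply: eq_integral => x _; rewrite addrC.
by apply: measurableT_comp => //; apply: measurable_funD.
Qed.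

Lemma ge0_integral_reflect_itv (t : R) (f : R -> R) : measurable_fun setT f ->
  (forall x, 0 <= f x)%R ->
  \int[mu]_(x in `]0%R, t[) (f (t - x))%:E = \int[mu]_(x in `]0%R, t[) (f x)%:E.
Proof.
move=> mf f0; rewrite !(integral_indic_mul mu `]0%R, t[%classic).
pose g (x : R) : \bar R := ((\1_(`]0%R, t[) x : R) * f x)%:E.
have mg : measurable_fun setT g.
  by apply/measurable_EFinP; apply: measurable_funM.
have g0 x : 0 <= g x by rewrite lee_fin mulr_ge0.
rewrite -/(g _) -[RHS](ge0_integral_reflect t mg g0).
apply: eq_integral => x _; congr (_ * _)%:E.
rewrite !indicE; congr (_%:R); congr nat_of_bool; rewrite !mem_setE !in_itv/=.
by rewrite subr_gt0 ltrBlDr ltrDl andbC.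
Qed.

End change_of_variables.

(** * Integrals of powers near 0 and at infinity *)

Section power_integrals.
Context {R : realType}.
Notation mu := (@lebesgue_measure R).

Lemma is_derive_powR (p x : R) : 0 < x -> p != 0 ->
  is_derive x 1 (fun x => p^-1 * x `^ p) (x `^ (p - 1)).
Proof.
move=> x0 p0.
have xi : x \in `]0, +oo[ by rewrite in_itv/= x0.
have h := derivableP (@derivable_powR R 1 p x xi).
have /= e := @powR_derive1 R p x xi; rewrite derive1E in e; rewrite e in h.
by apply: is_derive_eq; rewrite /GRing.scale/= mulrA mulVf// mul1r.
Qed.

Lemma integral_powR_itv (p a b : R) : 0 < a -> a < b -> p + 1 != 0 ->
  (\int[mu]_(x in `[a, b]) (x `^ p)%:E = ((b `^ (p + 1) - a `^ (p + 1)) / (p + 1))%:E)%E.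
Proof.
move=> a0 ab p1.
pose F x := (p + 1)^-1 * x `^ (p + 1).
have dF x : a <= x -> is_derive x 1 F (x `^ p).
  by move=> ax; have := is_derive_powR (lt_le_trans a0 ax) p1; rewrite addrK.
have cF x : a <= x -> {for x, continuous F}.
  by move=> ax; apply: differentiable_continuous; apply/derivable1_diffP; have [] := dF _ ax.
rewrite (@continuous_FTC2 _ (fun x => x `^ p) F)//.
- by rewrite -EFinB /F; congr EFin; ring.
- apply: continuous_in_subspaceT => x; rewrite inE/= in_itv/= => /andP[ax _].
  by apply: powR_continuous_at; exact: lt_le_trans ax.
- split.
  + by move=> x; rewrite in_itv/= => /andP[/ltW ax _]; have [] := dF _ ax.
  + apply: cvg_at_right_filter; exact: cF.
  + apply: cvg_at_left_filter; apply: cF; exact: ltW.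
- by move=> x; rewrite in_itv/= => /andP[/ltW ax _]; rewrite derive1E; have h := dF _ ax; rewrite derive_val.
Qed.

(** An upper bound is enough, so Fatou's lemma along the intervals from h / (n + 2) to h takes care
    of the singularity at 0. *)
Lemma integral_powR_0 (p h : R) : -1 < p -> 0 <= h ->
  (\int[mu]_(x in `]0%R, h[) (x `^ p)%:E <= (h `^ (p + 1) / (p + 1))%:E)%E.
Proof.
move=> p1; rewrite le_eqVlt => /predU1P[<-|h0].
  rewrite set_itv_ge ?bnd_simp ?ltxx// integral_set0 lee_fin divr_ge0 ?powR_ge0//.
  by rewrite -lerBlDr sub0r ltW.
have pp : 0 < p + 1 by rewrite -ltrBlDr sub0r.
rewrite integral_indic_mul.
pose f (n : nat) (x : R) : R := \1_(`]h * n.+2%:R^-1, h[) x * x `^ p.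
have a0 (n : nat) : 0 < h * n.+2%:R^-1 by rewrite mulr_gt0// invr_gt0 ltr0n.
have ah (n : nat) : h * n.+2%:R^-1 < h by rewrite gtr_pMr// invf_lt1 ?ltr0n// ltr1n.
apply: (@fatou_ae _ _ _ mu f).
- by move=> n; apply: measurable_funM.
- by apply: measurable_funM.
- by move=> n x; rewrite mulr_ge0 ?powR_ge0.
- by move=> x; rewrite mulr_ge0 ?powR_ge0.
- apply: aeW => x; rewrite /f; have [x0|x0] := ltP 0 x; last first.
    apply: cvg_near_cst; apply: nearW => n; rewrite !indicE !mem_setE !in_itv/=.
    by rewrite !ltNge x0 (le_trans x0 (ltW (a0 n)))/= !mul0r.
  have hx : (fun n : nat => h * n.+2%:R^-1) @ \oo --> (0 : R).
    rewrite -[X in _ --> X](mulr0 h); apply: cvgM; first exact: cvg_cst.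
    by have := @cvg_harmonic R; rewrite -cvg_shiftS.
  have hN := @cvgr_lt _ _ _ _ _ _ hx x x0.
  apply: cvg_near_cst; near=> n.
  have hn : h * n.+2%:R^-1 < x by near: n; exact: hN.
  by congr (_ * _); rewrite !indicE !mem_setE !in_itv/= hn x0.
- apply: nearW => n; rewrite /f -integral_indic_mul -(@integral_itv_bndoo _ _ _ _ true false); last first.
    by apply/measurable_EFinP; apply: measurable_funTS.
  rewrite integral_powR_itv// ?gt_eqF//.
  by rewrite lee_fin ler_pM2r ?invr_gt0// gerBl powR_ge0.
Unshelve. all: by end_near. Qed.

Lemma integral_powR_y (p : R) : p < -1 ->
  (\int[mu]_(x in `[1%R, +oo[) (x `^ p)%:E <= (- (p + 1)^-1)%:E)%E.
Proof.
move=> p1.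
have pp : p + 1 < 0 by rewrite -ltrBrDr sub0r.
rewrite integral_indic_mul.
pose f (n : nat) (x : R) : R := \1_(`[1%R, n.+2%:R]) x * x `^ p.
apply: (@fatou_ae _ _ _ mu f).
- by move=> n; apply: measurable_funM.
- by apply: measurable_funM.
- by move=> n x; rewrite mulr_ge0 ?powR_ge0.
- by move=> x; rewrite mulr_ge0 ?powR_ge0.
- apply: aeW => x; rewrite /f; apply: cvg_near_cst.
  have [N xN] : exists N : nat, x <= N%:R.
    by exists (Num.truncn `|x|).+1; rewrite (le_trans (ler_norm x))// ltW// truncnS_gt.
  exists N => //= n /= Nn; congr (_ * _); rewrite !indicE !mem_setE !in_itv/= andbT.
  by rewrite (le_trans xN) ?andbT// ler_nat; exact: leq_trans Nn (leqW (leqnSn n)).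
- apply: nearW => n; rewrite /f -integral_indic_mul integral_powR_itv ?ltr1n// ?lt_eqF//.
  rewrite lee_fin one_powR mulrBl mul1r gerDr nmulr_lle0 ?invr_lt0// powR_ge0.
Qed.

(** Model integrand for the weighted transforms: |x|^p near 0 and |x|^(p - q) at infinity. *)
Definition powdec (p q x : R) : R := `|x| `^ p * (1 + `|x|) `^ (- q).

Lemma powdec_ge0 p q x : 0 <= powdec p q x.
Proof. by rewrite mulr_ge0 ?powR_ge0. Qed.

Lemma measurable_powdec p q : measurable_fun setT (powdec p q).
Proof.
apply: measurable_funM.
  by apply: (measurableT_comp (measurable_powR _)) => //.
apply: (measurableT_comp (measurable_powR _)) => //.
by apply: measurable_funD => //.
Qed.

Lemma powdec_integral (p q : R) : -1 < p -> 0 <= q -> p - q < -1 ->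
  (\int[mu]_x (powdec p q x)%:E < +oo)%E.
Proof.
move=> p1 q0 pq.
have mE : measurable_fun setT (EFin \o powdec p q) by apply/measurable_EFinP; exact: measurable_powdec.
have e0 x : (0 <= (powdec p q x)%:E)%E by rewrite lee_fin powdec_ge0.
have h : (\int[mu]_(x in `[0%R, +oo[) (powdec p q x)%:E < +oo)%E.
  rewrite -integral_itv_obnd_cbnd; last exact: measurable_funTS.
  have -> : `]0%R, +oo[%classic = `]0%R, 1%R[%classic `|` `[1%R, +oo[%classic :> set R.
    apply/seteqP; split => x /=; rewrite !in_itv/= !andbT.
      by move=> x0; have [x1|x1] := ltP x 1; [left; rewrite x0|right].
    by case=> [/andP[]//|]; exact: lt_le_trans.
  rewrite ge0_integral_setU//; last 2 first.
  - exact: measurable_funTS.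
  - apply/disj_setPS => x /= []; rewrite !in_itv/= andbT => /andP[_ x1].
    by rewrite leNgt x1.
  apply: lte_add_pinfty.
  - apply: le_lt_trans (ltry (1 `^ (p + 1) / (p + 1))).
    apply: le_trans (integral_powR_0 p1 ler01).
    apply: ge0_le_integral => //; first exact: measurable_funTS.
      by apply/measurable_EFinP; apply: measurable_funTS.
    move=> x; rewrite /= in_itv/= => /andP[x0 x1]; rewrite lee_fin /powdec ger0_norm ?(ltW x0)//.
    rewrite ler_piMr ?powR_ge0// powRN invf_le1 ?powR_gt0 ?addr_gt0//.
    by rewrite -[X in X <= _](powRr0 (1 + x)) ler_powR// lerDl ltW.
  - apply: le_lt_trans (ltry (- (p - q + 1)^-1)).
    apply: le_trans (integral_powR_y pq).
    apply: ge0_le_integral => //; first exact: measurable_funTS.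
      by apply/measurable_EFinP; apply: measurable_funTS.
    move=> x; rewrite /= in_itv/= andbT => x1; have x0 := lt_le_trans ltr01 x1.
    rewrite lee_fin /powdec ger0_norm ?(ltW x0)//.
    rewrite powRDp// ler_wpM2l ?powR_ge0// !powRN lef_pV2 ?posrE ?powR_gt0 ?addr_gt0//.
    by rewrite ge0_ler_powR ?nnegrE ?addr_ge0 ?(ltW x0)// lerDr.
apply: (@le_lt_trans _ _ (\int[mu]_(x in `[0%R, +oo[) (powdec p q x)%:E
   + \int[mu]_(x in `[0%R, +oo[) (powdec p q x)%:E)%E); last exact: lte_add_pinfty.
pose g x : R := \1_(`[0%R, +oo[) x * powdec p q x.
have mg : measurable_fun setT (EFin \o g).
  by apply/measurable_EFinP; apply: measurable_funM => //; exact: measurable_powdec.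
have g0 x : (0 <= (g x)%:E)%E by rewrite lee_fin mulr_ge0// powdec_ge0.
rewrite (integral_indic_mul mu `[0%R, +oo[%classic).
have e : (\int[mu]_x (g x)%:E = \int[mu]_x (g (- x))%:E)%E.
  by have <- := ge0_integral_opp mg g0.
rewrite [leRHS](_ : _ = \int[mu]_x (g x)%:E + \int[mu]_x (g (- x))%:E)%E; last by rewrite -e.
have mgo : measurable_fun setT (fun x : R => (g (- x))%:E).
  by apply: (measurableT_comp mg); exact: oppr_measurable.
rewrite -(@ge0_integralD _ _ _ mu setT measurableT _ _ (fun x _ => g0 x) mg (fun x _ => g0 (- x)) mgo).
apply: (@ge0_le_integral _ _ _ mu setT measurableT _ _ (fun x _ => e0 x) mE (emeasurable_funD mg mgo)).
move=> x _; rewrite /g /= -EFinD lee_fin /powdec normrN !indicE !mem_setE !in_itv/= !andbT oppr_ge0.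
have [x0|x0] := leP 0 x; first by rewrite mul1r lerDl mulr_ge0 ?powdec_ge0.
by rewrite (ltW x0) mul0r add0r mul1r.
Qed.

End power_integrals.

Section sine_facts.
Context {R : realType}.
Implicit Types x b : R.

Lemma measurable_sinM b : measurable_fun setT (fun x => sin (b * x)).
Proof.
apply: continuous_measurable_fun => x.
by apply: continuous_comp; [exact: mulrl_continuous|exact: continuous_sin].
Qed.

Lemma measurable_cosM b : measurable_fun setT (fun x => cos (b * x)).
Proof.
apply: continuous_measurable_fun => x.
by apply: continuous_comp; [exact: mulrl_continuous|exact: continuous_cos].
Qed.

Lemma abs_sin_le x : `|sin x| <= `|x|.
Proof.
wlog x0 : x / 0 <= x.
  move=> h; have [/h//|/ltW x0] := leP 0 x.
  by rewrite -normrN -sinN -(normrN x) h// oppr_ge0.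
have dsin z : z \in `]0, x[ -> is_derive z 1 sin (cos z) by move=> _; exact: is_derive_sin.
have cs : {within `[0, x], continuous (@sin R)}.
  by apply: continuous_subspaceT; exact: continuous_sin.
have [c _] := @MVT_segment _ sin cos 0 x x0 dsin cs.
by rewrite sin0 !subr0 => ->; rewrite normrM ler_piMl ?cos_max.
Qed.

Lemma normr_powRD (x p q : R) : x != 0 -> `|x| `^ (p + q) = `|x| `^ p * `|x| `^ q.
Proof. by move=> x0; rewrite powRDp// normr_gt0. Qed.

End sine_facts.

(** * Harmonizable representation of the fractional covariance *)

Section hartley.
Context {R : realType}.
Notation mu := (@lebesgue_measure R).
Variable H : R.
Hypothesis H01 : 0 < H <= 1 / 2.
Implicit Types x a b c d : R.

Let H0 : 0 < H. Proof. by case/andP : H01. Qed.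
Let H12 : H <= 1 / 2. Proof. by case/andP : H01. Qed.

(** The rescaled spectral density of a fractional Brownian increment; its integral gives the
    normalising constant [hconst]. *)
Definition sinc2 (x : R) : R := `|x| `^ (- 1 - 2 * H) * sin x ^+ 2.

Lemma measurable_normr_powR (p : R) : measurable_fun setT (fun x : R => `|x| `^ p).
Proof. by apply: (measurableT_comp (measurable_powR _)) => //. Qed.

Lemma measurable_sinc2 : measurable_fun setT sinc2.
Proof.
apply: measurable_funM; first exact: measurable_normr_powR.
apply: measurable_funX; have := measurable_sinM (1 : R).
by under eq_fun do rewrite mul1r.
Qed.

Lemma sinc2_ge0 x : 0 <= sinc2 x.
Proof. by rewrite mulr_ge0 ?powR_ge0// sqr_ge0. Qed.

Let EsincM : measurable_fun setT (EFin \o sinc2).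
Proof. by apply/measurable_EFinP; exact: measurable_sinc2. Qed.

Let Esinc0 x : (0 <= (sinc2 x)%:E)%E. Proof. by rewrite lee_fin sinc2_ge0. Qed.

(** From |sin x| (1 + |x|) <= 2 |x|, the sum of |sin x| <= |x| and |sin x| <= 1 times |x|: the
    square of the sine is at most 4 |x|^2 (1 + |x|)^(-2), and [powdec] takes over. *)
Lemma sinc2_lty : (\int[mu]_x (sinc2 x)%:E < +oo)%E.
Proof.
apply: (@le_lt_trans _ _ (\int[mu]_x (4%:E * (powdec (1 - 2 * H) 2 x)%:E))%E); last first.
  rewrite ge0_integralZl//; last 2 first.
  - by apply/measurable_EFinP; exact: measurable_powdec.
  - by move=> x _; rewrite lee_fin powdec_ge0.
  by rewrite lte_mul_pinfty//; apply: powdec_integral; move: H0 H12; lra.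
apply: (@ge0_le_integral _ _ _ mu setT measurableT _ _ (fun x _ => Esinc0 x) EsincM).
  by apply/measurable_EFinP; apply: measurable_funM => //; exact: measurable_powdec.
move=> x _; rewrite -EFinM lee_fin /sinc2 /powdec.
have [->|x0] := eqVneq x 0.
  by rewrite sin0 expr0n mulr0 mulr_ge0// mulr_ge0 ?powR_ge0.
have x1 : 0 < 1 + `|x| by rewrite addr_gt0// normr_gt0.
rewrite (_ : 1 - 2 * H = (- 1 - 2 * H) + 2); last by ring.
rewrite (normr_powRD (- 1 - 2 * H) 2 x0) -mulrA (mulrCA 4) ler_wpM2l ?powR_ge0//.
rewrite powRN !powR_mulrn ?(ltW x1)// mulrA ler_pdivlMr ?exprn_gt0//.
rewrite -(real_normK (num_real (sin x))) (_ : 4 = 2 ^+ 2) -?exprMn; last by rewrite -natrX.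
rewrite ler_pXn2r ?nnegrE ?mulr_ge0 ?(ltW x1)//.
rewrite mulrDr mulr1 (_ : 2 * `|x| = `|x| + `|x|); last by ring.
by rewrite lerD ?abs_sin_le// ler_piMl ?sin_max.
Qed.

Definition sinc2_int : R := fine (\int[mu]_x (sinc2 x)%:E)%E.

Lemma sinc2_intE : (\int[mu]_x (sinc2 x)%:E = sinc2_int%:E)%E.
Proof.
rewrite /sinc2_int fineK// ge0_fin_numE; first exact: sinc2_lty.
exact: integral_ge0.
Qed.

Lemma sinc2_int_gt0 : 0 < sinc2_int.
Proof.
have : 0 <= sinc2_int by rewrite -lee_fin -sinc2_intE; exact: integral_ge0.
rewrite le_eqVlt => /predU1P[E|//]; exfalso.
have hz : (\int[mu]_x `|(sinc2 x)%:E| = 0)%E.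
  rewrite -[RHS]/(0%:E) E -sinc2_intE; apply: eq_integral => x _.
  by rewrite gee0_abs.
have /(ae_eq_integral_abs mu measurableT EsincM) := hz.
case=> N [mN N0 sN].
have : `]0, 1[%classic `<=` N.
  move=> x /=; rewrite in_itv/= => /andP[x0 x1]; apply: sN => /= /(_ I)/eqP.
  apply/negP; rewrite eqe mulf_neq0 ?gt_eqF ?powR_gt0 ?normr_gt0 ?gt_eqF//.
  rewrite exprn_gt0// sin_gt0_pihalf// x0 (lt_le_trans x1)//.
  exact: pihalf_ge1.
move=> /(le_measure mu); rewrite !inE => /(_ (measurable_itv _) mN) h.
have : (mu `]0%R, 1%R[ <= 0)%E by rewrite -N0; exact: h.
by rewrite lebesgue_measure_itv/= lte_fin ltr01 oppr0 adde0 lee_fin ler10.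
Qed.

(* Real form of the harmonizable representation of fractional Brownian motion:
   [hprim b] is the Hartley transform of the indicator of [0, b] times
   xi |xi|^(-1/2 - H), and its inner products reproduce [fbm_cov] up to a constant. *)
Definition hker xi x : R := xi * `|xi| `^ (- (1 / 2 + H)) * (cos (xi * x) + sin (xi * x)).

Definition hprim b xi : R := `|xi| `^ (- (1 / 2 + H)) * (1 + sin (b * xi) - cos (b * xi)).

Lemma hprim0 xi : hprim 0 xi = 0.
Proof. by rewrite /hprim !mul0r sin0 cos0 addr0 subrr mulr0. Qed.

Lemma measurable_hprim b : measurable_fun setT (hprim b).
Proof.
apply: measurable_funM; first exact: measurable_normr_powR.
apply: measurable_funB; last exact: measurable_cosM.
by apply: measurable_funD => //; exact: measurable_sinM.
Qed.

(** Addition formulas around the midpoint. The point of this form is that the term with sin ((a + b)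
    xi) is odd in xi, all the rest even. *)
Lemma hprimB_sqr a b xi : (hprim b xi - hprim a xi) ^+ 2 =
  4 * (`|xi| `^ (- 1 - 2 * H) * sin ((b - a) / 2 * xi) ^+ 2) * (1 + sin ((a + b) * xi)).
Proof.
pose c := (a + b) / 2 * xi; pose e := (b - a) / 2 * xi.
rewrite /hprim.
have -> : b * xi = c + e by rewrite /c /e; field.
have -> : a * xi = c - e by rewrite /c /e; field.
have -> : (a + b) * xi = c + c by rewrite /c; field.
rewrite -/e; pose p := - (1 / 2 + H).
have -> : `|xi| `^ (- 1 - 2 * H) = `|xi| `^ p * `|xi| `^ p.
  have [->|x0] := eqVneq xi 0.
    by rewrite normr0 !powR0 ?mulr0// /p lt_eqF//; move: H0; lra.
  by rewrite -normr_powRD//; congr (_ `^ _); rewrite /p; field.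
rewrite -/p.
rewrite !(sinD, cosD, sinN, cosN); have := cos2Dsin2 c.
move: (sin c) (cos c) (sin e) (cos e) (`|xi| `^ _) => sc cc se ce w h.
rewrite [RHS](_ : _ = 4 * (w * w * se ^+ 2) * (cc ^+ 2 + sc ^+ 2 + 2 * (sc * cc))); first by ring.
by rewrite h; ring.
Qed.

(** Adding the reflected integrand removes the odd term of [hprimB_sqr]; scaling by e = |b - a| / 2
    then produces the power 2 H. *)
Lemma integral_hprimB_sqr a b :
  (\int[mu]_x ((hprim b x - hprim a x) ^+ 2)%:E =
    (4 * (`|b - a| / 2) `^ (2 * H) * sinc2_int)%:E)%E.
Proof.
have [->|ab] := eqVneq a b.
  rewrite subrr normr0 mul0r powR0 ?mulf_neq0 ?gt_eqF// mulr0 mul0r.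
  by rewrite integral0_eq// => x _; rewrite subrr expr0n.
pose e := `|b - a| / 2.
have e0 : 0 < e by rewrite divr_gt0// normr_gt0 subr_eq0 eq_sym.
pose g x : \bar R := (sinc2 (e * x + 0))%:E.
have mg : measurable_fun setT g.
  apply: (measurableT_comp EsincM); apply: measurable_funD => //; exact: measurable_funM.
have g0 x : (0 <= g x)%E by rewrite lee_fin sinc2_ge0.
have gE : (\int[mu]_x g x = (e^-1 * sinc2_int)%:E)%E.
  have := ge0_integral_affine 0 e0 EsincM Esinc0; rewrite sinc2_intE -/(g _) => h.
  have -> : (\int[mu]_x g x = e^-1%:E * (e%:E * \int[mu]_x g x))%E.
    by rewrite muleA -EFinM mulVf ?gt_eqF// mul1e.
  by rewrite h -EFinM.
pose F x : \bar R := ((hprim b x - hprim a x) ^+ 2)%:E.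
have mF : measurable_fun setT F.
  by apply/measurable_EFinP; apply: measurable_funX; apply: measurable_funB; exact: measurable_hprim.
have F0 x : (0 <= F x)%E by rewrite lee_fin sqr_ge0.
have FE x : (F x + F (- x)%R = (8 * e `^ (1 + 2 * H))%:E * g x)%E.
  rewrite /F /g !hprimB_sqr -EFinD -EFinM; congr EFin.
  rewrite normrN !mulrN !sinN sqrrN addr0 /sinc2 normrM (gtr0_norm e0) (powRM _ (ltW e0) (normr_ge0 _)).
  have -> : sin ((b - a) / 2 * x) ^+ 2 = sin (e * x) ^+ 2.
    rewrite /e; have [h|h] := leP 0 (b - a); first by rewrite ger0_norm.
    by rewrite ltr0_norm// mulNr mulNr sinN sqrrN.
  have : e `^ (1 + 2 * H) * e `^ (- 1 - 2 * H) = 1.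
    by rewrite -powRDp// (_ : _ + _ = 0) ?powRr0//; ring.
  move=> pq; rewrite [RHS](_ : _ = 8 * `|x| `^ (- 1 - 2 * H) * sin (e * x) ^+ 2 *
    (e `^ (1 + 2 * H) * e `^ (- 1 - 2 * H))); last by ring.
  by rewrite pq; ring.
have mFo : measurable_fun setT (fun x : R => F (- x)%R).
  by apply: (measurableT_comp mF); exact: oppr_measurable.
have : (\int[mu]_x F x + \int[mu]_x F x = (8 * e `^ (2 * H) * sinc2_int)%:E)%E.
  rewrite -{2}(ge0_integral_opp mF F0).
  rewrite -(@ge0_integralD _ _ _ mu setT measurableT _ _ (fun x _ => F0 x) mF (fun x _ => F0 (- x)) mFo).
  under eq_integral do rewrite FE.
  rewrite ge0_integralZl//; last by rewrite lee_fin mulr_ge0// powR_ge0.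
  rewrite gE -EFinM powRDp// (powRr1 (ltW e0)); congr EFin.
  by field; rewrite gt_eqF.
rewrite -/(F _) -/e; have : (0 <= \int[mu]_x F x)%E by exact: integral_ge0.
by case: (\int[mu]_x F x)%E => // r _ [] h; congr EFin; lra.
Qed.

Definition hconst : R := 4 * (2^-1) `^ (2 * H) * sinc2_int.

Lemma hconst_gt0 : 0 < hconst.
Proof. by rewrite !mulr_gt0// ?powR_gt0 ?invr_gt0// sinc2_int_gt0. Qed.

Lemma integral_hprimB_sqrE a b :
  (\int[mu]_x ((hprim b x - hprim a x) ^+ 2)%:E = (hconst * `|b - a| `^ (2 * H))%:E)%E.
Proof.
rewrite integral_hprimB_sqr; congr EFin; rewrite powRM ?invr_ge0// /hconst.
by ring.
Qed.

Lemma hprim_sqr_lty b : (\int[mu]_x (hprim b x ^+ 2)%:E < +oo)%E.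
Proof.
have := integral_hprimB_sqrE 0 b.
by under eq_integral do rewrite hprim0 subr0; move=> ->; rewrite ltry.
Qed.

(** Polarisation: [fbm_cov] is by definition the polar form of the squared distance |b - a|^(2 H),
    and [hprim 0] is 0. *)
Lemma integral_hprim_mul a b : 0 <= a -> 0 <= b ->
  mu.-integrable setT (EFin \o (fun x => hprim a x * hprim b x)) /\
  \int[mu]_x (hprim a x * hprim b x) = hconst * fbm_cov H a b.
Proof.
move=> a0 b0.
have [u uE] := @mkL2 _ (measurableTypeR R) R mu (hprim a) (measurable_hprim a) (hprim_sqr_lty a).
have [v vE] := @mkL2 _ (measurableTypeR R) R mu (hprim b) (measurable_hprim b) (hprim_sqr_lty b).
have nE c (w : LfunType mu (lee1n 2)) : w = hprim c :> (R -> R) -> 0 <= c ->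
    nrm w ^+ 2 = hconst * c `^ (2 * H).
  move=> wE c0; apply: EFin_inj; rewrite -integral_sq.
  have := integral_hprimB_sqrE 0 c; rewrite subr0 ger0_norm// => <-.
  by apply: eq_integral => x _; rewrite hprim0 subr0 wE.
have e2 : nrm (v - u) ^+ 2 = hconst * `|a - b| `^ (2 * H).
  apply: EFin_inj; rewrite -integral_sq distrC -integral_hprimB_sqrE.
  by apply: eq_integral => x _; rewrite -uE -vE.
split; first by have := ip_integrable u v; rewrite uE vE.
have -> : \int[mu]_x (hprim a x * hprim b x) = ip u v by rewrite /ip uE vE.
have := nE a u uE a0; have := nE b v vE b0; move: e2.
rewrite -!ip_sq ipBl !ipBr (ipC v u) /fbm_cov => e2 eb ea.
by rewrite mulrA mulrBr mulrDr -ea -eb -e2; field.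
Qed.

End hartley.

Section parametrized.
Context d1 d2 (T1 : measurableType d1) (T2 : measurableType d2) (R : realType).
Context (m2 : {sigma_finite_measure set T2 -> \bar R}).

Lemma measurable_parametrized_Rintegral (f : T1 * T2 -> R) :
  measurable_fun setT f ->
  measurable_fun setT (fun x => \int[m2]_y f (x, y)).
Proof.
move=> mf.
have mE : measurable_fun setT (EFin \o f) by exact/measurable_EFinP.
rewrite /Rintegral; apply: (measurableT_comp (@fine_measurable _ _ _)) => //.
rewrite (_ : (fun x => _) = (fun x => fubini_F m2 (EFin \o f)^\+ x - fubini_F m2 (EFin \o f)^\- x)%E); last first.
  apply/funext => x; rewrite integralE /=.
  by congr (_ - _)%E; apply: eq_integral => y _; rewrite ?funepos.unlock ?funeneg.unlock.
apply: emeasurable_funB; apply: measurable_fun_fubini_tonelli_F => //.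
  exact: measurable_funepos.
exact: measurable_funeneg.
Qed.

End parametrized.

Section signed_change_of_variables.
Context {R : realType}.
Notation mu := (@lebesgue_measure R).

Lemma Rintegral_comp (g : R -> R) :
  (forall f : R -> \bar R, measurable_fun setT f -> (forall x, 0 <= f x)%E ->
    (\int[mu]_x f (g x) = \int[mu]_x f x)%E) ->
  forall f : R -> R, measurable_fun setT f ->
  \int[mu]_x f (g x) = \int[mu]_x f x.
Proof.
move=> h f mf; rewrite /Rintegral; congr fine; rewrite integralE [RHS]integralE.
have mE : measurable_fun setT (EFin \o f) by exact/measurable_EFinP.
congr (_ - _)%E.
  rewrite -(h (EFin \o f)^\+)%E//; last exact: measurable_funepos.
  by apply: eq_integral => y _; rewrite !funepos.unlock.
rewrite -(h (EFin \o f)^\-)%E//; last exact: measurable_funeneg.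
by apply: eq_integral => y _; rewrite !funeneg.unlock.
Qed.

Lemma Rintegral_shift (b : R) (f : R -> R) : measurable_fun setT f ->
  \int[mu]_x f (x + b) = \int[mu]_x f x.
Proof. by apply: (@Rintegral_comp (fun x => x + b)) => g; exact: ge0_integral_shift. Qed.

Lemma Rintegral_reflect (b : R) (f : R -> R) : measurable_fun setT f ->
  \int[mu]_x f (b - x) = \int[mu]_x f x.
Proof. by apply: (@Rintegral_comp (fun x => b - x)) => g; exact: ge0_integral_reflect. Qed.

Lemma Rintegral_FTC (f F : R -> R) (a b : R) : a <= b -> continuous f ->
  (forall x : R, is_derive x 1 F (f x)) ->
  \int[mu]_(x in `]a, b[) f x = F b - F a.
Proof.
rewrite le_eqVlt => /predU1P[->|ab] cf dF.
  by rewrite set_itv_ge ?bnd_simp ?ltxx// Rintegral_set0 subrr.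
have cF x : {for x, continuous F}.
  by apply: differentiable_continuous; apply/derivable1_diffP; have [] := dF x.
rewrite /Rintegral -(@integral_itv_bndoo _ _ _ _ true false); last first.
  by apply/measurable_EFinP; apply: measurable_funTS; exact: continuous_measurable_fun.
rewrite (@continuous_FTC2 _ f F) //.
- exact: continuous_subspaceT.
- split; first by move=> x _; have [] := dF x.
  + apply: cvg_at_right_filter; exact: cF.
  + apply: cvg_at_left_filter; exact: cF.
- by move=> x _; rewrite derive1E; have h := dF x; rewrite derive_val.
Qed.

Lemma Rintegral_indic_mul d (T : measurableType d) (m : {measure set T -> \bar R})
    (A : set T) (f : T -> R) :
  \int[m]_(x in A) f x = \int[m]_x (\1_A x * f x).
Proof. by rewrite /Rintegral integral_indic_mul. Qed.

End signed_change_of_variables.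

(** * Weighted transform of the space factor *)

Section sine_transform.
Context {R : realType}.
Notation mu := (@lebesgue_measure R).
Implicit Types w xi x b : R.

Lemma continuous_sinM b : continuous (fun x => sin (b * x)).
Proof. by move=> x; apply: continuous_comp; [exact: mulrl_continuous|exact: continuous_sin]. Qed.

Lemma continuous_cosM b : continuous (fun x => cos (b * x)).
Proof. by move=> x; apply: continuous_comp; [exact: mulrl_continuous|exact: continuous_cos]. Qed.

Lemma continuous_integrable_itv (f : R -> R) (a b : R) : continuous f ->
  mu.-integrable `]a, b[ (EFin \o f).
Proof.
move=> cf; apply: (@integrableS _ _ _ mu `[a, b]%classic) => //.
  by apply: subset_itv; rewrite bnd_simp.
apply: continuous_compact_integrable; first exact: segment_compact.
exact: continuous_subspaceT.
Qed.

(** For |b| <= 2 the trivial bound 1 is below 3 / (1 + |b|); for |b| > 2 one has 2 / |b| <= 3 / (1 +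
    |b|). The bound has no singularity at b = 0. *)
Lemma osc_decay (g : R -> R) (b : R) : continuous g -> (forall x, `|g x| <= 1) ->
  (b != 0 -> `|\int[mu]_(x in `]0%R, 1%R[) g x| <= 2 / `|b|) ->
  `|\int[mu]_(x in `]0%R, 1%R[) g x| <= 3 / (1 + `|b|).
Proof.
move=> cg g1 gb.
have ig := continuous_integrable_itv 0 1 cg.
have le1 : `|\int[mu]_(x in `]0%R, 1%R[) g x| <= 1.
  apply: (le_trans (@le_normr_Rintegral _ _ _ mu _ g (measurable_itv _) ig)).
  have c1 : continuous (cst 1 : R -> R) by move=> x; exact: cvg_cst.
  have h1 : \int[mu]_(x in `]0%R, 1%R[) (cst 1 x) = 1 - 0.
    exact: (Rintegral_FTC ler01 c1 (fun x => is_derive_id x 1)).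
  have cn : continuous (fun x => `|g x|).
    by move=> x; apply: continuous_comp; [exact: cg|exact: norm_continuous].
  rewrite subr0 in h1; rewrite -[leRHS]h1.
  apply: (@le_Rintegral _ _ _ mu) => //.
  - exact: (continuous_integrable_itv 0 1 cn).
  - exact: (continuous_integrable_itv 0 1 c1).
have b0 : 0 <= `|b| by [].
have [b2|b2] := leP `|b| 2.
  by apply: (le_trans le1); rewrite ler_pdivlMr ?mul1r; lra.
have bn : b != 0 by rewrite -normr_gt0; lra.
apply: (le_trans (gb bn)).
have bp : 0 < `|b| by rewrite normr_gt0.
rewrite ler_pdivrMr// mulrAC ler_pdivlMr ?addr_gt0//; move: `|b| b2 => c; lra.
Qed.

Lemma sin_integral_decay b : `|\int[mu]_(x in `]0%R, 1%R[) sin (b * x)| <= 3 / (1 + `|b|).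
Proof.
apply: osc_decay; [exact: (@continuous_sinM b)|by move=> x; exact: sin_max|move=> b0].
have dF x : is_derive x 1 (fun x => - (b^-1 * cos (b * x))) (sin (b * x)).
  have h := is_derive_cosM b x; apply: is_derive_eq.
  by rewrite /GRing.scale/=; field.
rewrite (Rintegral_FTC ler01 (@continuous_sinM b) dF).
rewrite -opprD normrN -mulrBr normrM normfV mulrC ler_pM2r ?invr_gt0 ?normr_gt0//.
by rewrite (le_trans (ler_normB _ _))//; have := cos_max (b * 1); have := cos_max (b * 0); lra.
Qed.

Lemma cos_integral_decay b : `|\int[mu]_(x in `]0%R, 1%R[) cos (b * x)| <= 3 / (1 + `|b|).
Proof.
apply: osc_decay; [exact: (@continuous_cosM b)|by move=> x; exact: cos_max|move=> b0].
have dF x : is_derive x 1 (fun x => b^-1 * sin (b * x)) (cos (b * x)).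
  have h := is_derive_sinM b x; apply: is_derive_eq.
  by rewrite /GRing.scale/=; field.
rewrite (Rintegral_FTC ler01 (@continuous_cosM b) dF).
rewrite -mulrBr normrM normfV mulrC ler_pM2r ?invr_gt0 ?normr_gt0//.
by rewrite (le_trans (ler_normB _ _))//; have := sin_max (b * 1); have := sin_max (b * 0); lra.
Qed.

Definition sine_hartley w xi : R :=
  \int[mu]_(x in `]0%R, 1%R[) (sin (w * x) * (cos (xi * x) + sin (xi * x))).

Lemma sine_hartleyE w xi : sine_hartley w xi =
  2^-1 * (\int[mu]_(x in `]0%R, 1%R[) sin ((w + xi) * x) +
          \int[mu]_(x in `]0%R, 1%R[) sin ((w - xi) * x) +
          \int[mu]_(x in `]0%R, 1%R[) cos ((w - xi) * x) -
          \int[mu]_(x in `]0%R, 1%R[) cos ((w + xi) * x)).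
Proof.
have s b := continuous_integrable_itv 0 1 (@continuous_sinM b).
have c b := continuous_integrable_itv 0 1 (@continuous_cosM b).
rewrite -RintegralD// -RintegralD//; last by apply: RintegrableD.
rewrite -RintegralB//; last by apply: RintegrableD => //; apply: RintegrableD.
rewrite -RintegralZl//; last by apply: RintegrableB => //; apply: RintegrableD => //; apply: RintegrableD.
apply: eq_Rintegral => x _.
by rewrite !(mulrDl, mulrBl, sinD, cosD, sinB, cosB, mulNr, sinN, cosN); field.
Qed.

Lemma sine_hartley_sqr w xi : sine_hartley w xi ^+ 2 <=
  18 * ((1 + `|w - xi|) `^ (- 2) + (1 + `|w + xi|) `^ (- 2)).
Proof.
have p1 (z : R) : 0 < 1 + `|z| by rewrite ltr_pwDl.
have E (z : R) : (1 + `|z|) `^ (- 2) = (1 + `|z|)^-1 ^+ 2.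
  by rewrite powRN (powR_mulrn 2 (ltW (p1 z))) exprVn.
rewrite !E.
(* In [sine_hartleyE] two integrals oscillate with w - xi and two with w + xi, each at most 3 / (1 +
   |.|), with a common factor 1/2. Squaring by (3 p + 3 q)^2 <= 18 (p^2 + q^2) gives the constant
   18. *)
have : `|sine_hartley w xi| <= 3 * (1 + `|w - xi|)^-1 + 3 * (1 + `|w + xi|)^-1.
  rewrite sine_hartleyE normrM ger0_norm ?invr_ge0// ler_pdivrMl//.
  have := sin_integral_decay (w + xi); have := sin_integral_decay (w - xi).
  have := cos_integral_decay (w + xi); have := cos_integral_decay (w - xi).
  set a := \int[mu]_(_ in _) _; set b := \int[mu]_(_ in _) _.
  set c := \int[mu]_(_ in _) _; set e := \int[mu]_(_ in _) _.
  move=> ha hb hc he.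
  apply: (le_trans (ler_normB _ _)).
  have := le_trans (ler_normD _ _) (lerD (ler_normD e c) (lexx `|a|)).
  lra.
rewrite -(real_normK (num_real (sine_hartley _ _))).
have := normr_ge0 (sine_hartley w xi); move: `|sine_hartley w xi|.
move: ((1 + `|w - xi|)^-1) ((1 + `|w + xi|)^-1) => p q z z0 zpq.
apply: (@le_trans _ _ ((3 * p + 3 * q) ^+ 2)).
  by rewrite ler_pXn2r ?nnegrE// (le_trans z0).
by have := sqr_ge0 (p - q); lra.
Qed.

Lemma measurable_sine_hartley w : measurable_fun setT (sine_hartley w).
Proof.
rewrite /sine_hartley; under eq_fun do rewrite Rintegral_indic_mul.
apply: (@measurable_parametrized_Rintegral _ _ (measurableTypeR R) (measurableTypeR R) R mu
  (fun z => \1_(`]0%R, 1%R[) z.2 * (sin (w * z.2) * (cos (z.1 * z.2) + sin (z.1 * z.2))))).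
apply: measurable_funM; first by apply: (measurableT_comp (measurable_indic _)) => //.
apply: measurable_funM; first by apply: (measurableT_comp (measurable_sinM w)).
have m12 : measurable_fun setT (fun z : measurableTypeR R * measurableTypeR R => z.1 * z.2 : R).
  by apply: measurable_funM.
apply: measurable_funD.
  by apply: (measurableT_comp (continuous_measurable_fun (@continuous_cos R)) m12).
by apply: (measurableT_comp (continuous_measurable_fun (@continuous_sin R)) m12).
Qed.

(** The transform is concentrated near w and -w. After recentring, |x + w| <= w (1 + |x|) for w >= 1
    extracts w^(1 - 2 H), and the remaining power (1 - 2 H) - 2 of 1 + |x| is below -1. *)
Lemma sine_hartley_weighted (H : R) : 0 < H <= 1 / 2 -> exists2 C, 0 <= C &
  forall w, 1 <= w ->
  (\int[mu]_x (`|x| `^ (1 - 2 * H) * sine_hartley w x ^+ 2)%:E <= (C * w `^ (1 - 2 * H))%:E)%E.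
Proof.
move=> /andP[H0 H12]; pose p := 1 - 2 * H.
have p0 : 0 <= p by rewrite /p; lra.
pose I := (\int[mu]_x (powdec 0 (2 - p) x)%:E)%E.
have I0 : (0 <= I)%E by apply: integral_ge0 => x _; rewrite lee_fin powdec_ge0.
have Ioo : (I < +oo)%E by apply: powdec_integral; rewrite /p; lra.
have IE : I = (fine I)%:E by rewrite fineK// ge0_fin_numE.
exists (36 * fine I); first by rewrite mulr_ge0// fine_ge0.
move=> w w1; rewrite -/p; have w0 : 0 < w by exact: lt_le_trans w1.
pose g x : \bar R := (`|x| `^ p * (1 + `|x - w|) `^ (- 2))%:E.
have g0 x : (0 <= g x)%E by rewrite lee_fin mulr_ge0// powR_ge0.
have mdec b : measurable_fun setT (fun x : R => (1 + `|x - b|) `^ (- 2)).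
  apply: (measurableT_comp (measurable_powR _)) => //.
  apply: measurable_funD => //; apply: measurableT_comp; first exact: normr_measurable.
  exact: measurable_funB.
have mg : measurable_fun setT g.
  apply/measurable_EFinP; apply: measurable_funM; first exact: measurable_normr_powR.
  exact: mdec.
have mgN : measurable_fun setT (fun x : R => g (- x)).
  by apply: (measurableT_comp mg); exact: oppr_measurable.
have gI : (\int[mu]_x g x <= (w `^ p)%:E * I)%E.
  rewrite -(ge0_integral_shift w mg g0) /I -ge0_integralZl//; last 3 first.
  - by apply/measurable_EFinP; exact: measurable_powdec.
  - by move=> x _; rewrite lee_fin powdec_ge0.
  - by rewrite lee_fin powR_ge0.
  apply: ge0_le_integral => //.
  - by apply: (measurableT_comp mg); exact: measurable_funD.
  - by apply/measurable_EFinP; apply: measurable_funM => //; exact: measurable_powdec.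
  - move=> x _; rewrite /g /powdec addrK powRr0 mul1r -EFinM lee_fin.
    rewrite (_ : - (2 - p) = p + (- 2)); last by ring.
    have x1 : 0 < 1 + `|x| by rewrite ltr_pwDl.
    rewrite (powRDp p (- 2) x1) mulrA ler_wpM2r ?powR_ge0// -powRM ?(ltW x1) ?(ltW w0)//.
    rewrite ge0_ler_powR ?nnegrE ?mulr_ge0 ?(ltW x1) ?(ltW w0)//.
    rewrite (le_trans (ler_normD _ _))// (ger0_norm (ltW w0)) mulrDr mulr1 addrC lerD2l.
    by rewrite ler_peMl.
apply: (@le_trans _ _ (\int[mu]_x (18%:E * (g x + g (- x)%R)))%E).
  apply: ge0_le_integral => //.
  - by move=> x _; rewrite lee_fin mulr_ge0 ?powR_ge0// sqr_ge0.
  - apply/measurable_EFinP; apply: measurable_funM; first exact: measurable_normr_powR.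
    by apply: measurable_funX; exact: measurable_sine_hartley.
  - by apply: measurable_funeM; exact: emeasurable_funD.
  - move=> x _; rewrite /g normrN -EFinD -(EFinM 18) lee_fin.
    rewrite -mulrDr (mulrCA 18).
    rewrite ler_wpM2l ?powR_ge0//.
    have := sine_hartley_sqr w x.
    by rewrite (distrC x w) -opprD normrN (addrC x w).
rewrite ge0_integralZl//; last 2 first.
- exact: emeasurable_funD.
- by move=> x _; rewrite adde_ge0.
rewrite ge0_integralD// (ge0_integral_opp mg g0).
rewrite (_ : 36 * fine I * w `^ p = 18 * (w `^ p * fine I + w `^ p * fine I)); last by ring.
rewrite EFinM lee_wpmul2l// EFinD EFinM -IE.
exact: leeD.
Qed.

End sine_transform.

(** * Weighted transform of the monotone time factor *)

Section monotone_transform.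
Context {R : realType}.
Notation mu := (@lebesgue_measure R).
Variables (e : R -> R) (t : R).
Hypothesis me : measurable_fun setT e.
Hypothesis e0 : forall x, 0 < x -> 0 <= e x.
Hypothesis e1 : forall x, 0 < x -> e x <= 1.
Hypothesis emono : forall x y, 0 < x -> x <= y -> e y <= e x.

Let E x : R := \1_(`]0%R, t[) x * e x.

Let E_ge0 x : 0 <= E x.
Proof.
rewrite /E indicE mem_setE in_itv/=; have [/andP[x0 _]|_] := boolP (0 < x < t).
  by rewrite mul1r e0.
by rewrite mul0r.
Qed.

Let E_le0 x : x <= 0 -> E x = 0.
Proof. by move=> x0; rewrite /E indicE mem_setE in_itv/= ltNge x0 mul0r. Qed.

Let E_noninc x y : 0 < x -> x <= y -> E y <= E x.
Proof.
move=> x0 xy; rewrite /E !indicE !mem_setE !in_itv/= x0 (lt_le_trans x0 xy)/=.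
have [yt|yt] := ltP y t; last by rewrite mul0r mulr_ge0// e0.
by rewrite (le_lt_trans xy yt) !mul1r emono.
Qed.

Let mE : measurable_fun setT E.
Proof. exact: measurable_funM. Qed.

Let E_integrable : mu.-integrable setT (EFin \o E).
Proof.
apply/integrableP; split; first exact/measurable_EFinP.
apply: (@le_lt_trans _ _ (\int[mu]_(x in `]0%R, t[) (cst 1%E) x)%E); last first.
  rewrite integral_cst//= mul1e lebesgue_measure_itv/=.
  by case: ifPn; rewrite ?ltry// -EFinB ltry.
rewrite [leRHS](_ : _ = \int[mu]_x (\1_(`]0%R, t[) x * (cst 1 x))%:E)%E; last first.
  by rewrite -integral_indic_mul.
apply: ge0_le_integral => //.
- by apply: measurableT_comp => //; exact/measurable_EFinP.
- by apply/measurable_EFinP; apply: measurable_funM.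
- move=> x _ /=; rewrite lee_fin (ger0_norm (E_ge0 x)) /E indicE mem_setE in_itv/=.
  by have [/andP[x0 _]|_] := boolP (0 < x < t); rewrite ?mul0r// !mul1r e1.
Qed.

Let integrable_bounded_mul (s : R -> R) : measurable_fun setT s -> (forall x, `|s x| <= 2) ->
  mu.-integrable setT (EFin \o (fun x => E x * s x)).
Proof.
move=> ms s2; apply: (@Rintegrable_le _ _ _ mu _ _ _ (fun x => 2 * E x)) => //.
- exact: measurable_funM.
- exact: RintegrableZ.
- by move=> x _; rewrite normrM (ger0_norm (E_ge0 x)) mulrC ler_wpM2r.
Qed.

Let integrable_shift (f : R -> R) h : mu.-integrable setT (EFin \o f) ->
  mu.-integrable setT (EFin \o (fun x => f (x + h))).
Proof.
move=> /integrableP[mf fi]; apply/integrableP; split.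
  by apply: (measurableT_comp mf); exact: measurable_funD.
have mn : measurable_fun setT (fun x => `|(f x)%:E|)%E by apply: measurableT_comp.
by have := ge0_integral_shift h mn (fun x => abse_ge0 _) => /= ->.
Qed.

Definition time_hartley tau : R :=
  \int[mu]_(r in `]0%R, t[) (e (t - r) * (cos (tau * r) + sin (tau * r))).

Let s tau x : R := cos (tau * (t - x)) + sin (tau * (t - x)).

Let ms tau : measurable_fun setT (s tau).
Proof.
have mB : measurable_fun setT (fun x : R => t - x) by apply: measurable_funB.
apply: measurable_funD.
  exact: (measurableT_comp (measurable_cosM tau) mB).
exact: (measurableT_comp (measurable_sinM tau) mB).
Qed.

Let s2 tau x : `|s tau x| <= 2.
Proof.
rewrite (le_trans (ler_normD _ _))//.
by have := sin_max (tau * (t - x)); have := cos_max (tau * (t - x)); lra.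
Qed.

Lemma time_hartleyE tau : time_hartley tau = \int[mu]_x (E x * s tau x).
Proof.
rewrite /time_hartley Rintegral_indic_mul.
rewrite -(Rintegral_reflect t (f := fun x => E x * s tau x)); last exact: measurable_funM.
apply: eq_Rintegral => x _; rewrite /E /s subKr mulrA; congr (_ * _ * _).
rewrite !indicE; congr (_%:R); congr nat_of_bool; rewrite !mem_setE !in_itv/=.
by rewrite subr_gt0 ltrBlDr ltrDl andbC.
Qed.

Lemma time_hartley_le0 tau : `|time_hartley tau| <= 2 * \int[mu]_x E x.
Proof.
rewrite time_hartleyE (le_trans (@le_normr_Rintegral _ _ _ mu _ _ measurableT (integrable_bounded_mul (@ms tau) (@s2 tau))))//.
rewrite -RintegralZl//; apply: (@le_Rintegral _ _ _ mu) => //.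
- have := integrable_abse (integrable_bounded_mul (@ms tau) (@s2 tau)).
  by apply: eq_integrable.
- exact: RintegrableZ.
- by move=> x _; rewrite normrM (ger0_norm (E_ge0 x)) mulrC ler_wpM2r.
Qed.

(* Half a period of [s] turns the transform into an integral against the
   increments of [E], whose total variation telescopes. *)
Lemma time_hartley_le tau : tau != 0 ->
  `|time_hartley tau| <= 2 * \int[mu]_x (\1_(`]-oo, pi / `|tau|]) x * E x).
Proof.
move=> tau0; set h := pi / `|tau|.
have h0 : 0 < h by rewrite divr_gt0 ?pi_gt0 ?normr_gt0.
have sh x : s tau (x + h) = - s tau x.
  have hp : tau * (t - (x + h)) = tau * (t - x) - pi \/ tau * (t - (x + h)) = tau * (t - x) + pi.
    rewrite /h; have [tp|tn] := ltP 0 tau; [left; rewrite gtr0_norm//|right; rewrite ler0_norm//].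
      by field.
    by field.
  rewrite /s; case: hp => ->; rewrite ?cosDpi ?sinDpi ?opprD//.
  have := cosDpi (tau * (t - x) - pi); have := sinDpi (tau * (t - x) - pi).
  by rewrite subrK => -> ->; rewrite opprD !opprK.
have iEs := integrable_bounded_mul (@ms tau) (@s2 tau).
have iEh := integrable_shift h E_integrable.
have iEhs : mu.-integrable setT (EFin \o (fun x => E (x + h) * s tau x)).
  have := integrable_shift h iEs => /(@RintegrableZ _ _ _ mu _ measurableT (-1)).
  apply: eq_integrable => // x _ /=; rewrite sh; congr EFin; ring.
have i1 : \int[mu]_x (E x * s tau x) = - \int[mu]_x (E (x + h) * s tau x).
  rewrite -(@Rintegral_shift _ h (fun x => E x * s tau x)); last exact: measurable_funM.
  rewrite -[RHS]mulN1r -RintegralZl//; apply: eq_Rintegral => x _; rewrite sh; ring.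
have i2 : 2 * time_hartley tau = \int[mu]_x ((E x - E (x + h)) * s tau x).
  rewrite time_hartleyE mulr2n mulrDl !mul1r {2}i1 -RintegralB//.
  by apply: eq_Rintegral => x _; ring.
(* This is |E x - E (x + h)|: the increment is nonnegative for x > 0, while for x <= 0, where E x =
   0, the correction flips its sign. In this form the shifted integrals of E cancel. *)
pose v x : R := E x - E (x + h) + 2 * (\1_(`]-oo, 0]) x * E (x + h)).
have iv2 : mu.-integrable setT (EFin \o (fun x => \1_(`]-oo, 0%R]) x * E (x + h))).
  apply: (@Rintegrable_le _ _ _ mu _ _ _ (fun x => E (x + h))) => //.
    apply: measurable_funM => //.
    by apply: (measurableT_comp mE); exact: measurable_funD.
  move=> x _; rewrite normrM (ger0_norm (E_ge0 _)) ler_piMl// indicE.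
  by case: (_ \in _); rewrite ?normr0 ?normr1.
have iv : mu.-integrable setT (EFin \o v).
  apply: RintegrableD => //; first exact: RintegrableB.
  exact: RintegrableZ.
have absv x : `|(E x - E (x + h)) * s tau x| <= 2 * v x.
  rewrite normrM mulrC; apply: ler_pM => //; rewrite /v indicE mem_setE in_itv/=.
  have [x0|x0] := leP x 0.
    by rewrite E_le0// mul1r sub0r normrN (ger0_norm (E_ge0 _)); lra.
  rewrite mul0r mulr0 addr0 ger0_norm// subr_ge0 E_noninc//.
  by rewrite lerDl ltW.
have intv : \int[mu]_x v x = 2 * \int[mu]_x (\1_(`]-oo, h]) x * E x).
  rewrite /v RintegralD//; last 2 first.
  - exact: RintegrableB.
  - exact: RintegrableZ.
  rewrite RintegralB// (Rintegral_shift h mE) subrr add0r RintegralZl//; congr (_ * _).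
  rewrite -(@Rintegral_shift _ h (fun x => \1_(`]-oo, h]) x * E x)); last exact: measurable_funM.
  apply: eq_Rintegral => x _; congr (_ * _); rewrite !indicE !mem_setE !in_itv/=.
  by rewrite gerDr.
have iB : mu.-integrable setT (EFin \o (fun x => (E x - E (x + h)) * s tau x)).
  have := RintegrableB measurableT iEs iEhs; apply: eq_integrable => // x _ /=.
  by rewrite mulrBl.
rewrite -(ler_pM2l (ltr0Sn R 1)) -{1}(ger0_norm (ler0n R 2)) -normrM i2.
rewrite (le_trans (@le_normr_Rintegral _ _ _ mu _ _ measurableT iB))//.
rewrite -intv -RintegralZl//; apply: (@le_Rintegral _ _ _ mu) => //.
- by have := integrable_abse iB; apply: eq_integrable.
- exact: RintegrableZ.
Qed.

Lemma measurable_time_hartley : measurable_fun setT time_hartley.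
Proof.
rewrite (_ : time_hartley = fun tau => \int[mu]_x (E x * s tau x)); last first.
  by apply/funext => tau; exact: time_hartleyE.
apply: (@measurable_parametrized_Rintegral _ _ (measurableTypeR R) (measurableTypeR R) R mu
  (fun z => E z.2 * (cos (z.1 * (t - z.2)) + sin (z.1 * (t - z.2))))).
apply: measurable_funM; first by apply: (measurableT_comp mE).
have m12 : measurable_fun setT (fun z : measurableTypeR R * measurableTypeR R => z.1 * (t - z.2) : R).
  by apply: measurable_funM => //; apply: measurable_funB.
apply: measurable_funD.
  by apply: (measurableT_comp (continuous_measurable_fun (@continuous_cos R)) m12).
by apply: (measurableT_comp (continuous_measurable_fun (@continuous_sin R)) m12).
Qed.

Variables (K b T : R).
Hypothesis K0 : 0 <= K.
Hypothesis eK : forall x, 0 < x -> e x <= K * x `^ (- b).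
Hypothesis b1 : b < 1.
Hypothesis tT : 0 <= t <= T.

Let small_int (h : R) : 0 <= h -> \int[mu]_x (\1_(`]-oo, h]) x * E x) <= K * (h `^ (1 - b) / (1 - b)).
Proof.
move=> h0.
have iE : mu.-integrable setT (EFin \o (fun x => \1_(`]-oo, h]) x * E x)).
  apply: (@Rintegrable_le _ _ _ mu _ measurableT _ E) => //.
    by apply: measurable_funM.
  move=> x _; rewrite normrM (ger0_norm (E_ge0 _)) ler_piMl// indicE.
  by case: (_ \in _); rewrite ?normr0 ?normr1.
rewrite -lee_fin -(RintegralE measurableT iE).
apply: (@le_trans _ _ (\int[mu]_(x in `]0%R, h]) (K%:E * (x `^ (- b))%:E))%E).
  rewrite [leRHS](_ : _ = \int[mu]_x (\1_(`]0%R, h]) x * (K * x `^ (- b)))%:E)%E; last first.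
    by rewrite -integral_indic_mul; apply: eq_integral => x _; rewrite EFinM.
  apply: ge0_le_integral => //.
  - by move=> x _; rewrite lee_fin mulr_ge0.
  - by apply/measurable_EFinP; apply: measurable_funM.
  - by apply/measurable_EFinP; apply: measurable_funM => //; apply: measurable_funM.
  - move=> x _; rewrite lee_fin /E !indicE !mem_setE !in_itv/=.
    have [x0|x0] := leP x 0; first by rewrite !(mul0r, mulr0).
    rewrite /=; case: (x <= h); last by rewrite !mul0r.
    rewrite !mul1r; case: (x < t); first by rewrite mul1r eK.
    by rewrite mul0r mulr_ge0 ?powR_ge0.
rewrite ge0_integralZl//; last 2 first.
- by apply/measurable_EFinP; apply: measurable_funTS.
- by move=> x _; rewrite lee_fin powR_ge0.
rewrite EFinM lee_wpmul2l//.
rewrite (@integral_itv_bndoo _ _ _ _ false false); last first.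
  by apply/measurable_EFinP; apply: measurable_funTS.
have := @integral_powR_0 _ (- b) h; rewrite (addrC (- b)); apply => //.
by rewrite ltrN2.
Qed.

(** The cutoff m is the smaller of t and pi / |tau|. In either case m (1 + |tau|) <= pi + T, so low
    and high frequencies share one decay, of order (1 + |tau|)^(-(1 - b)). *)
Lemma time_hartley_bound tau :
  `|time_hartley tau| <= 2 * (K * (((pi + T) / (1 + `|tau|)) `^ (1 - b) / (1 - b))).
Proof.
have b1' : 0 < 1 - b by rewrite subr_gt0.
have [t0 tT'] := andP tT.
have T0 : 0 <= T by exact: le_trans tT'.
have p1 : 0 < 1 + `|tau| by rewrite ltr_pwDl.
have piT : 0 <= (pi + T) / (1 + `|tau|).
  exact: divr_ge0 (addr_ge0 (pi_ge0 _) T0) (ltW p1).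
have [m [m0 m1 m2]] : exists m, [/\ 0 <= m, m <= (pi + T) / (1 + `|tau|) &
    `|time_hartley tau| <= 2 * \int[mu]_x (\1_(`]-oo, m]) x * E x)].
  have tE : \int[mu]_x (\1_(`]-oo, t]) x * E x) = \int[mu]_x E x.
    apply: eq_Rintegral => x _; rewrite /E !indicE !mem_setE !in_itv/=.
    have [xt|xt] := leP x t; first by rewrite mul1r.
    by rewrite (ltNge x) (ltW xt) andbF !mul0r.
  have [->|tau0] := eqVneq tau 0.
    exists t; split => //; last by rewrite tE; exact: time_hartley_le0.
    by rewrite normr0 addr0 divr1 (le_trans tT')// lerDr pi_ge0.
  have [h|h] := leP t (pi / `|tau|).
    exists t; split => //; last by rewrite tE; exact: time_hartley_le0.
    move: h; rewrite ler_pdivlMr ?normr_gt0// => h.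
    by rewrite ler_pdivlMr// mulrDr mulr1 addrC lerD.
  exists (pi / `|tau|); split; [by rewrite divr_ge0 ?pi_ge0| |exact: time_hartley_le].
  rewrite ler_pdivlMr// mulrDr mulr1 divfK ?normr_eq0// addrC lerD2l.
  by rewrite (le_trans (ltW h)).
rewrite (le_trans m2)// ler_wpM2l// (le_trans (small_int m0))// ler_wpM2l//.
by rewrite ler_wpM2r ?invr_ge0 ?(ltW b1')// ge0_ler_powR ?nnegrE ?(ltW b1').
Qed.

End monotone_transform.

(** The weighted square is of order |x|^(1 - 2 H) (1 + |x|)^(-2 (1 - b)), and b < H is exactly its
    integrability at infinity. The dependence on e is only through K, so that the constant is
    uniform over the modes. *)
Lemma time_hartley_weighted {R : realType} (H b T : R) : 0 < H <= 1 / 2 -> b < H -> 0 <= T ->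
  exists2 C, 0 <= C & forall (e : R -> R) (t K : R), measurable_fun setT e ->
    (forall x, 0 < x -> 0 <= e x <= 1) ->
    (forall x y, 0 < x -> x <= y -> e y <= e x) ->
    0 <= K -> (forall x, 0 < x -> e x <= K * x `^ (- b)) -> 0 <= t <= T ->
    (\int[lebesgue_measure]_x (`|x| `^ (1 - 2 * H) * time_hartley e t x ^+ 2)%:E <=
      (C * K ^+ 2)%:E)%E.
Proof.
move=> /andP[H0 H12] bH T0.
have b1 : 0 < 1 - b by lra.
have pT : 0 <= pi + T by rewrite addr_ge0 ?pi_ge0.
pose I := (\int[lebesgue_measure]_x (powdec (1 - 2 * H) (2 * (1 - b)) x)%:E)%E.
have I0 : (0 <= I)%E by apply: integral_ge0 => x _; rewrite lee_fin powdec_ge0.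
have Ioo : (I < +oo)%E by apply: powdec_integral; lra.
have IE : I = (fine I)%:E by rewrite fineK// ge0_fin_numE.
pose c := (2 * ((pi + T) `^ (1 - b) / (1 - b))) ^+ 2.
exists (c * fine I); first by rewrite mulr_ge0 ?sqr_ge0// fine_ge0.
move=> e t K me e01 emono K0 eK tT.
have e0 x : 0 < x -> 0 <= e x by move=> /e01/andP[].
have e1 x : 0 < x -> e x <= 1 by move=> /e01/andP[].
apply: (@le_trans _ _ (\int[lebesgue_measure]_x ((c * K ^+ 2)%:E * (powdec (1 - 2 * H) (2 * (1 - b)) x)%:E))%E); last first.
  rewrite ge0_integralZl//; last 3 first.
  - by apply/measurable_EFinP; exact: measurable_powdec.
  - by move=> x _; rewrite lee_fin powdec_ge0.
  - by rewrite lee_fin mulr_ge0 ?sqr_ge0.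
  by rewrite -/I IE -EFinM lee_fin mulrAC.
apply: ge0_le_integral => //.
- by move=> x _; rewrite lee_fin mulr_ge0 ?powR_ge0 ?sqr_ge0.
- apply/measurable_EFinP; apply: measurable_funM; first exact: measurable_normr_powR.
  by apply: measurable_funX; exact: measurable_time_hartley.
- by apply/measurable_EFinP; apply: measurable_funM => //; exact: measurable_powdec.
- move=> x _; rewrite -EFinM lee_fin /powdec [leRHS]mulrCA ler_wpM2l ?powR_ge0//.
  have p1 : 0 < 1 + `|x| by rewrite ltr_pwDl.
  have b1' : b < 1 by lra.
  have h := time_hartley_bound me e0 e1 emono K0 eK b1' tT x.
  have := normr_ge0 (time_hartley e t x).
  rewrite -(real_normK (num_real (time_hartley e t x))).
  rewrite powRN (mulrC 2) powRrM (powR_mulrn 2 (powR_ge0 _ _)).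
  move: h; rewrite (powRM _ pT) ?invr_ge0 ?(ltW p1)// inv_powR//.
  rewrite /c -exprVn -!exprMn powRN => h h0.
  have hE : 2 * (K * ((pi + T) `^ (1 - b) * ((1 + `|x|) `^ (1 - b))^-1 / (1 - b))) =
    2 * ((pi + T) `^ (1 - b) / (1 - b)) * K / (1 + `|x|) `^ (1 - b) by ring.
  rewrite hE in h.
  by rewrite ler_pXn2r ?nnegrE// (le_trans h0).
Qed.

(** * Wiener integrals *)

Section sigma_finite_product.
Context d1 d2 (T1 : measurableType d1) (T2 : measurableType d2) (R : realType).
Context (m1 : {sigma_finite_measure set T1 -> \bar R}).
Context (m2 : {sigma_finite_measure set T2 -> \bar R}).

(* The library attaches to [m1 \x m2] itself only the sigma-finiteness of
   products of subprobabilities. *)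
Definition pmeasure : set (T1 * T2) -> \bar R := (m1 \x m2)%E.

HB.instance Definition _ := Measure.on pmeasure.

Lemma pmeasure_sigma_finite : sigma_finite setT pmeasure.
Proof.
have [F TF Foo] := sigma_finiteT m1; have [G TG Goo] := sigma_finiteT m2.
pose ij n : nat * nat := odflt (0, 0)%N (unpickle n).
exists (fun n => F (ij n).1 `*` G (ij n).2).
  apply/seteqP; split=> // -[x y] _.
  have [i _ Fx] : (\bigcup_i F i) x by rewrite -TF.
  have [j _ Gy] : (\bigcup_j G j) y by rewrite -TG.
  by exists (pickle (i, j)) => //; rewrite /ij pickleK.
move=> n; have [? ?] := Foo (ij n).1; have [? ?] := Goo (ij n).2.
split; first exact: measurableX.
by rewrite /pmeasure product_measure1E// lte_mul_pinfty// ge0_fin_numE.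
Qed.

HB.instance Definition _ :=
  Measure_isSigmaFinite.Build _ _ _ pmeasure pmeasure_sigma_finite.

End sigma_finite_product.

Section product_tools.
Context d1 d2 (T1 : measurableType d1) (T2 : measurableType d2) (R : realType).
Context (m1 : {sigma_finite_measure set T1 -> \bar R}).
Context (m2 : {sigma_finite_measure set T2 -> \bar R}).

Lemma measurable_tensor (a : T1 -> R) (b : T2 -> R) : measurable_fun setT a ->
  measurable_fun setT b -> measurable_fun setT (fun z : T1 * T2 => a z.1 * b z.2).
Proof.
move=> ma mb; apply: measurable_funM.
  by apply: (measurableT_comp ma).
by apply: (measurableT_comp mb).
Qed.

Lemma ge0_integral_tensor (a : T1 -> R) (b : T2 -> R) : measurable_fun setT a ->
  measurable_fun setT b -> (forall x, 0 <= a x) -> (forall y, 0 <= b y) ->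
  (\int[m1 \x m2]_z (a z.1 * b z.2)%:E = \int[m1]_x (a x)%:E * \int[m2]_y (b y)%:E)%E.
Proof.
move=> ma mb a0 b0.
rewrite fubini_tonelli1//; last 2 first.
- by apply/measurable_EFinP; exact: measurable_tensor.
- by move=> z; rewrite lee_fin mulr_ge0.
rewrite /fubini_F/= -ge0_integralZr//; last 3 first.
- exact/measurable_EFinP.
- by move=> x _; rewrite lee_fin.
- by apply: integral_ge0 => y _; rewrite lee_fin.
apply: eq_integral => x _; under eq_integral do rewrite EFinM.
rewrite ge0_integralZl//.
- exact/measurable_EFinP.
- by move=> y _; rewrite lee_fin.
- by rewrite lee_fin.
Qed.

Lemma integrable_tensor (a : T1 -> R) (b : T2 -> R) :
  m1.-integrable setT (EFin \o a) -> m2.-integrable setT (EFin \o b) ->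
  (m1 \x m2)%E.-integrable setT (EFin \o (fun z => a z.1 * b z.2)).
Proof.
move=> /integrableP[/measurable_EFinP ma ia] /integrableP[/measurable_EFinP mb ib].
apply/integrableP; split; first by apply/measurable_EFinP; exact: measurable_tensor.
rewrite (_ : (\int[_]_x _ = \int[m1 \x m2]_z (`|a z.1| * `|b z.2|)%:E)%E); last first.
  by apply: eq_integral => z _ /=; rewrite normrM.
rewrite (@ge0_integral_tensor (fun x => `|a x|) (fun y => `|b y|))//; last 2 first.
- by apply: measurableT_comp => //.
- by apply: measurableT_comp => //.
by apply: lte_mul_pinfty; rewrite ?integral_ge0// ge0_fin_numE// integral_ge0.
Qed.

Lemma Rintegral_tensor (a : T1 -> R) (b : T2 -> R) :
  m1.-integrable setT (EFin \o a) -> m2.-integrable setT (EFin \o b) ->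
  Rintegral (m1 \x m2)%E setT (fun z => a z.1 * b z.2) = (\int[m1]_x a x) * \int[m2]_y b y.
Proof.
move=> ia ib; have iab := integrable_tensor ia ib.
rewrite {1}/Rintegral -(integral12_prod_meas1 iab) /fubini_F/=.
under eq_integral => x _.
  rewrite (_ : (\int[m2]_y _ = (a x * \int[m2]_y b y)%:E)%E); last first.
    by rewrite -RintegralZl// -RintegralE//; exact: RintegrableZ.
  over.
rewrite -/(Rintegral m1 setT (fun x => a x * \int[m2]_y b y)).
by rewrite RintegralZr.
Qed.

End product_tools.

Section indicator.
Context d (T : measurableType d) (R : realType) (mu : {measure set T -> \bar R}).

Lemma integrable_indic_mul (A : set T) (f : T -> R) : measurable A ->
  mu.-integrable A (EFin \o f) -> mu.-integrable setT (EFin \o (fun x => \1_A x * f x)).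
Proof.
move=> mA; rewrite (integrable_mkcond _ mA); apply: eq_integrable => // x _.
by rewrite patchE /= indicE; case: ifPn => _; rewrite ?mul1r ?mul0r.
Qed.

End indicator.

Section L2_more.
Context d (T : measurableType d) (R : realType) (mu : {measure set T -> \bar R}).
Notation L2 := (LfunType mu (lee1n 2)).

(** Fatou's lemma in k for the square of v m - v k bounds the distance from v m to the pointwise
    limit by the Cauchy modulus. *)
Lemma L2_pointwise_limit (v : nat -> L2) (f : T -> R) : measurable_fun setT f ->
  {ae mu, forall x, (fun n => v n x) @ \oo --> f x} ->
  (forall e, 0 < e -> exists N, forall m n, (N <= m)%N -> (N <= n)%N -> nrm (v m - v n) <= e) ->
  exists2 w : L2, (w : T -> R) = f & cvgL2 v w.
Proof.
move=> mf vf cv.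
have vw e : 0 < e -> exists N, forall m, (N <= m)%N ->
    (\int[mu]_x ((v m x - f x) ^+ 2)%:E <= (e ^+ 2)%:E)%E.
  move=> e0; have [N hN] := cv e e0; exists N => m Nm.
  apply: (@fatou_ae _ _ _ _ (fun k x => (v m x - v k x) ^+ 2)).
  - by move=> k; apply: measurable_funX; apply: measurable_funB.
  - by apply: measurable_funX; apply: measurable_funB.
  - by move=> k x; rewrite sqr_ge0.
  - by move=> x; rewrite sqr_ge0.
  - apply: filterS vf => x hx.
    have hd : (fun k => v m x - v k x) @ \oo --> v m x - f x.
      by apply: cvgB => //; exact: cvg_cst.
    exact: (cvgM hd hd).
  - near=> k.
    have -> : (\int[mu]_x ((v m x - v k x) ^+ 2)%:E = (nrm (v m - v k) ^+ 2)%:E)%E.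
      by rewrite -integral_sq.
    rewrite lee_fin; apply: lerXn2r; rewrite ?nnegrE ?nrm_ge0 ?(ltW e0)//.
    by apply: hN => //; near: k; exact: nbhs_infty_ge.
have [N1 hN1] := vw 1 ltr01.
have mvw : measurable_fun setT (fun x => v N1 x - f x) by apply: measurable_funB.
have [z zE] : exists z : L2, (z : T -> R) = (fun x => v N1 x - f x).
  by apply: mkL2 => //; apply: (le_lt_trans (hN1 _ (leqnn _))); rewrite ltry.
have wE : ((v N1 - z : L2) : T -> R) = f.
  by apply/funext => x; rewrite -[LHS]/(v N1 x - z x) zE opprB addrC subrK.
exists (v N1 - z) => //; apply/cvgrPdist_le => e e0.
have [N hN] := vw e e0; exists N => // m Nm /=.
rewrite sub0r normrN ger0_norm ?nrm_ge0//.
rewrite -(@ler_pXn2r _ 2)// ?nnegrE ?nrm_ge0 ?(ltW e0)//.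
rewrite -lee_fin -integral_sq.
rewrite (_ : (fun x => _) = (fun x => ((v m x - f x) ^+ 2)%:E)); first exact: hN.
by apply/funext => x; rewrite -wE.
Unshelve. all: by end_near. Qed.

Lemma cvgL2_cauchy (v : nat -> L2) w : cvgL2 v w ->
  forall e, 0 < e -> exists N, forall m n, (N <= m)%N -> (N <= n)%N -> nrm (v m - v n) <= e.
Proof.
move=> /cvgrPdist_le vw e e0.
have [N _ hN] := vw (e / 2) (divr_gt0 e0 (ltr0Sn _ 1)).
exists N => m n Nm Nn; rewrite (le_trans (nrm_triangle _ w _))//.
have := hN m Nm; have := hN n Nn; rewrite /= !sub0r !normrN !(ger0_norm (nrm_ge0 _)).
by rewrite (nrmBC w); lra.
Qed.

Lemma cvgL2_ip (v v' : nat -> L2) w w' : cvgL2 v w -> cvgL2 v' w' ->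
  (fun n => ip (v n) (v' n)) @ \oo --> ip w w'.
Proof.
move=> hv hv'.
have hn : (fun n => nrm (v' n)) @ \oo --> nrm w' by exact: cvgL2_nrm.
have h : (fun n => nrm (v n - w) * nrm (v' n) + nrm w * nrm (v' n - w')) @ \oo --> (0 : R).
  have h1 : (fun n => nrm (v n - w) * nrm (v' n)) @ \oo --> (0 : R).
    by rewrite -(mul0r (nrm w')); apply: cvgM.
  have h2 : (fun n => nrm w * nrm (v' n - w')) @ \oo --> (0 : R).
    by rewrite -(mulr0 (nrm w)); apply: cvgM => //; exact: cvg_cst.
  by rewrite -[X in _ --> X](addr0 0); apply: cvgD.
apply/cvgrPdist_le => e e0.
have [N _ hN] := (@cvgrPdist_le _ _ _ _ _ _ _).1 h e e0.
exists N => // n Nn /=; apply: (le_trans _ (hN n Nn)).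
rewrite sub0r normrN [leRHS]ger0_norm ?addr_ge0 ?mulr_ge0 ?nrm_ge0//.
have -> : ip w w' - ip (v n) (v' n) = - (ip (v n - w) (v' n) + ip w (v' n - w')).
  by rewrite ipBl ipBr; ring.
by rewrite normrN (le_trans (ler_normD _ _))// lerD ?ip_CS.
Qed.

Lemma L2_sumE (I : Type) (r : seq I) (F : I -> L2) x :
  (\sum_(i <- r) F i) x = \sum_(i <- r) F i x.
Proof.
elim: r => [|i r IH]; first by rewrite !big_nil.
by rewrite !big_cons -IH.
Qed.

(** Convergence to 0 of the extended integrals makes one difference v N - X square integrable, hence
    X itself. *)
Lemma cvgL2_approx (v : nat -> L2) (f : nat -> T -> R) (X : T -> R) :
  (forall n, f n = v n) -> measurable_fun setT X ->
  (fun n => \int[mu]_w ((f n w - X w) ^+ 2)%:E)%E @ \oo --> 0%E ->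
  exists2 x : L2, (x : T -> R) = X & cvgL2 v x.
Proof.
move=> fv mX /fine_cvgP[/= hfin hX].
have [N _ hN] := hfin.
have mvX n : measurable_fun setT (fun w => v n w - X w) by apply: measurable_funB.
have [z zE] : exists z : L2, (z : T -> R) = (fun x => v N x - X x).
  apply: mkL2 => //; have := hN N (leqnn N); rewrite ge0_fin_numE.
    by rewrite fv.
  by apply: integral_ge0 => w _; rewrite lee_fin sqr_ge0.
have wE : ((v N - z : L2) : T -> R) = X.
  by apply/funext => x; rewrite -[LHS]/(v N x - z x) zE opprB addrC subrK.
exists (v N - z) => //.
have hn n : nrm (v n - (v N - z)) ^+ 2 = fine (\int[mu]_w ((f n w - X w) ^+ 2)%:E)%E.
  apply: EFin_inj; rewrite -integral_sq fineK; last first.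
    rewrite fv; rewrite (_ : (fun w => _) = (fun w => ((v n - (v N - z)) w ^+ 2)%:E)).
      by rewrite integral_sq.
    by apply/funext => w; rewrite -wE.
  by apply: eq_integral => w _; rewrite fv -wE.
have h : (fun n => nrm (v n - (v N - z)) ^+ 2) @ \oo --> (0 : R).
  by apply: cvg_trans hX; apply: near_eq_cvg; apply: nearW => n /=; rewrite hn.
rewrite /cvgL2 (_ : (fun n => _) = (fun n => Num.sqrt (nrm (v n - (v N - z)) ^+ 2))); last first.
  by apply/funext => n; rewrite sqrtr_sqr ger0_norm ?nrm_ge0.
rewrite -[X in _ --> X]sqrtr0.
by apply: (continuous_cvg _ (@sqrt_continuous R 0) h).
Qed.

Lemma mkL2_bounded (f : T -> R) M : (mu setT < +oo)%E -> measurable_fun setT f ->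
  (forall x, `|f x| <= M) -> exists v : L2, (v : T -> R) = f.
Proof.
move=> muT mf fM; apply: mkL2 => //.
apply: (@le_lt_trans _ _ (\int[mu]_x (cst (M ^+ 2)%:E x))%E); last first.
  by rewrite integral_cst// lte_mul_pinfty// lee_fin sqr_ge0.
apply: ge0_le_integral => //.
- by move=> x _; rewrite lee_fin sqr_ge0.
- by apply/measurable_EFinP; exact: measurable_funX.
- move=> x _; rewrite lee_fin -(real_normK (num_real (f x))).
  by rewrite ler_pXn2r ?nnegrE// (le_trans _ (fM x)).
Qed.

End L2_more.

(** * The normalised kernel and its primitive *)

Section kernel.
Context {R : realType}.
Notation mu := (@lebesgue_measure R).
Implicit Types (x t xi a b : R).

(** Dividing by the root of [hconst] makes the Gram kernel of the primitives equal to [fbm_cov],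
    with no constant. *)
Definition nker H xi x : R := (Num.sqrt (hconst H))^-1 * hker H xi x.
Definition nprim H b xi : R := (Num.sqrt (hconst H))^-1 * hprim H b xi.

Lemma nprim_gram H a b : 0 < H <= 1 / 2 -> 0 <= a -> 0 <= b ->
  mu.-integrable setT (EFin \o (fun x => nprim H a x * nprim H b x)) /\
  \int[mu]_x (nprim H a x * nprim H b x) = fbm_cov H a b.
Proof.
move=> H01 a0 b0; have [ih eh] := integral_hprim_mul H01 a0 b0.
set c := (Num.sqrt (hconst H))^-1.
have cE : (fun x => nprim H a x * nprim H b x) = (fun x => c ^+ 2 * (hprim H a x * hprim H b x)).
  by apply/funext => x; rewrite /nprim -/c; ring.
rewrite cE; split; first exact: RintegrableZ.
rewrite RintegralZl// eh mulrA /c exprVn sqr_sqrtr ?(ltW (hconst_gt0 H01))//.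
by rewrite mulVf ?mul1r// gt_eqF// hconst_gt0.
Qed.

Lemma measurable_nprim H b : measurable_fun setT (nprim H b).
Proof. by apply: measurable_funM => //; exact: measurable_hprim. Qed.

Lemma continuous_nker H xi : continuous (nker H xi).
Proof.
move=> x; apply: cvgMl_tmp; apply: cvgMl_tmp.
by apply: cvgD; [exact: continuous_cosM|exact: continuous_sinM].
Qed.

Lemma integral_nker H xi a b : a <= b ->
  \int[mu]_(x in `]a, b[) nker H xi x = nprim H b xi - nprim H a xi.
Proof.
move=> ab.
have dF x : is_derive x 1 (fun b => nprim H b xi) (nker H xi x).
  rewrite (_ : (fun b => _) = (fun b => (Num.sqrt (hconst H))^-1 * (`|xi| `^ (- (1 / 2 + H))
      * (1 + sin (xi * b) - cos (xi * b))))); last first.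
    by apply/funext => c; rewrite /nprim /hprim !(mulrC xi).
  have h1 := is_derive_sinM xi x; have h2 := is_derive_cosM xi x.
  apply: is_derive_eq; rewrite /nker /hker /GRing.scale/=; ring.
exact: (Rintegral_FTC ab (@continuous_nker H xi) dF).
Qed.

Lemma nker_bounded H xi x : `|nker H xi x| <=
  2 * `|(Num.sqrt (hconst H))^-1 * (xi * `|xi| `^ (- (1 / 2 + H)))|.
Proof.
rewrite /nker /hker mulrA normrM mulrC ler_wpM2r// (le_trans (ler_normD _ _))//.
by have := sin_max (xi * x); have := cos_max (xi * x); lra.
Qed.

Lemma measurable_nker2 H :
  measurable_fun setT (fun z : measurableTypeR R * measurableTypeR R => nker H z.1 z.2).
Proof.
apply: measurable_funM => //; apply: measurable_funM.
  apply: measurable_funM => //.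
  by apply: (measurableT_comp (measurable_normr_powR _)).
have m12 : measurable_fun setT (fun z : measurableTypeR R * measurableTypeR R => z.1 * z.2 : R).
  by apply: measurable_funM.
apply: measurable_funD.
  by apply: (measurableT_comp (continuous_measurable_fun (@continuous_cos R)) m12).
by apply: (measurableT_comp (continuous_measurable_fun (@continuous_sin R)) m12).
Qed.

Lemma integral_indic_itv2 (g : R -> R) p q a b : measurable_fun setT g ->
  p <= a -> a <= b -> b <= q ->
  \int[mu]_x ((\1_(`]p, q[) x : R) * (\1_(`]a, b]) x * g x)) = \int[mu]_(x in `]a, b[) g x.
Proof.
move=> mg pa ab bq.
have mgi (i : set R) : measurable_fun i (EFin \o g).
  by apply/measurable_EFinP; apply: measurable_funTS.
(* The two indicators intersect in a half-open interval when b < q and in an open one when b = q;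
   [BSide (q <= b) b] names both, and the endpoint is negligible. *)
have -> : \int[mu]_(x in `]a, b[) g x =
    \int[mu]_(x in [set` Interval (BRight a) (BSide (q <= b) b)]) g x.
  by rewrite /Rintegral [X in _ = fine X](@integral_itv_bndoo _ _ _ _ false).
rewrite [RHS]Rintegral_indic_mul; apply: eq_Rintegral => x _.
rewrite mulrA; congr (_ * _); rewrite !indicE !mem_setE -natrM mulnb; congr (_%:R).
congr nat_of_bool; rewrite !itv_boundlr/= !bnd_simp.
have [ax|_] := ltP a x; last by rewrite andbF.
rewrite (le_lt_trans pa ax)/=.
have [qb|qb] := leP q b; rewrite ?bnd_simp.
  have -> : q = b by apply/eqP; rewrite eq_le qb bq.
  by have [/ltW ->|] := ltP x b.
by have [xb|] := leP x b; rewrite ?andbF// (le_lt_trans xb).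
Qed.

End kernel.

Definition lebLL (R : realType) :
    {sigma_finite_measure set (measurableTypeR R * measurableTypeR R)%type -> \bar R} :=
  pmeasure (@lebesgue_measure R) (@lebesgue_measure R).

(** * The space-time transform of integrands *)

Section space_time.
Context {R : realType}.
Notation mu := (@lebesgue_measure R).
Notation R2 := (measurableTypeR R * measurableTypeR R)%type.
Notation LL := (lebLL R).
Notation L2M := (LfunType LL (lee1n 2)).
Variables (H1 H2 : R).
Hypotheses (H1P : 0 < H1 <= 1 / 2) (H2P : 0 < H2 <= 1 / 2).
Implicit Types (m z : R2) (x t : R).

Definition sprim x t m : R := nprim H1 x m.1 * nprim H2 t m.2.

(** The tensor product packaged as an element of L^2; by [sprimLE] the default 0 does not occur for
    x, t >= 0. [ker2L] and [sheetL] are built in the same way. *)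
Definition sprimL x t : L2M := xget 0 [set v : L2M | (v : R2 -> R) = sprim x t].

Lemma sprimLE x t : 0 <= x -> 0 <= t -> sprimL x t = sprim x t :> (R2 -> R).
Proof.
move=> x0 t0; rewrite /sprimL; case: xgetP => [v _ //|/=].
have [i1 _] := nprim_gram H1P x0 x0; have [i2 _] := nprim_gram H2P t0 t0.
have [v vE] : exists v : L2M, (v : R2 -> R) = sprim x t.
  apply: mkL2; first by apply: measurable_tensor; exact: measurable_nprim.
  have /integrableP[_] := integrable_tensor i1 i2; apply: le_lt_trans.
  apply: ge0_le_integral => //.
  - by move=> z _; rewrite lee_fin sqr_ge0.
  - apply/measurable_EFinP; apply: measurable_funX.
    by apply: measurable_tensor; exact: measurable_nprim.
  - apply: measurableT_comp => //; apply/measurable_EFinP.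
    apply: (@measurable_tensor _ _ _ _ _ (fun x0 => nprim H1 x x0 * nprim H1 x x0)
      (fun x0 => nprim H2 t x0 * nprim H2 t x0)); apply: measurable_funM; exact: measurable_nprim.
  - move=> z _ /=; rewrite lee_fin (le_trans _ (ler_norm _))// /sprim.
    by rewrite le_eqVlt; apply/orP; left; apply/eqP; ring.
by move/(_ v).
Qed.

Lemma sprimL_ip x t y r : 0 <= x -> 0 <= t -> 0 <= y -> 0 <= r ->
  ip (sprimL x t) (sprimL y r) = fbm_cov H1 x y * fbm_cov H2 t r.
Proof.
move=> x0 t0 y0 r0; rewrite /ip !sprimLE//.
have [i1 e1] := nprim_gram H1P x0 y0; have [i2 e2] := nprim_gram H2P t0 r0.
rewrite -e1 -e2 -(Rintegral_tensor i1 i2); apply: eq_Rintegral => z _.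
by rewrite /sprim; ring.
Qed.

Lemma measurable_Dt t : measurable (D `*` `]0%R, t[ : set R2).
Proof. by apply: measurableX => //; exact: measurable_D. Qed.

Definition lebDt t : {measure set R2 -> \bar R} := mrestr LL (measurable_Dt t).

Notation L2Dt t := (LfunType (lebDt t) (lee1n 2)).

Lemma lebDt_lty t : (lebDt t setT < +oo)%E.
Proof.
rewrite /lebDt /= /mrestr setTI /pmeasure product_measure1E//; last exact: measurable_D.
have hD : (@lebesgue_measure R D < +oo)%E.
  by rewrite /D lebesgue_measure_itv/= lte_fin ltr01 oppr0 adde0 ltry.
have ht : (@lebesgue_measure R `]0%R, t[ < +oo)%E.
  by rewrite lebesgue_measure_itv/=; case: ifPn; rewrite ?ltry// -EFinB ltry.
apply: lte_mul_pinfty; rewrite ?measure_ge0//.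
by rewrite ge0_fin_numE//; exact: hD.
Qed.

Lemma integral_lebDt t (f : R2 -> R) : measurable_fun setT f ->
  \int[lebDt t]_z f z = Rintegral LL setT (fun z => (\1_D z.1 * (\1_(`]0%R, t[) z.2)) * f z).
Proof.
move=> mf; rewrite {1}/Rintegral integral_mrestr; last exact/measurable_EFinP.
rewrite -/(Rintegral LL _ f) Rintegral_indic_mul; apply: eq_Rintegral => z _.
congr (_ * _); rewrite !indicE -natrM mulnb; congr (_%:R); congr nat_of_bool.
by rewrite in_setX.
Qed.

Definition ker2 m z : R := nker H1 m.1 z.1 * nker H2 m.2 z.2.

Definition ker2L t m : L2Dt t := xget 0 [set v : L2Dt t | (v : R2 -> R) = ker2 m].

Lemma measurable_ker2 m : measurable_fun setT (ker2 m).
Proof.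
by apply: measurable_tensor; apply: continuous_measurable_fun; exact: continuous_nker.
Qed.

Lemma ker2LE t m : ker2L t m = ker2 m :> (R2 -> R).
Proof.
rewrite /ker2L; case: xgetP => [v _ //|/=].
have [v vE] := mkL2_bounded (lebDt_lty t) (measurable_ker2 m)
  (fun z => ltac:(rewrite normrM; exact: ler_pM (normr_ge0 _) (normr_ge0 _)
     (nker_bounded _ _ _) (nker_bounded _ _ _))).
by move/(_ v).
Qed.

(* It sends the indicator of a rectangle to the increment of [sprim], and so turns
   the covariance of Wiener integrals into the inner product of L^2(R x R). *)
Definition Ktr t (v : R2 -> R) m : R := \int[lebDt t]_z (v z * ker2 m z).

(** For fixed m the kernel is bounded on a set of finite measure, so the transform at m is a
    continuous functional: L^2 convergence of integrands gives pointwise convergence of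
    transforms. *)
Lemma KtrE t (v : L2Dt t) m : Ktr t v m = ip v (ker2L t m).
Proof. by rewrite /ip ker2LE. Qed.

Lemma measurable_Ktr t (v : R2 -> R) : measurable_fun setT v -> measurable_fun setT (Ktr t v).
Proof.
move=> mv.
rewrite (_ : Ktr t v = (fun m => Rintegral LL setT (fun z => (\1_D z.1 * (\1_(`]0%R, t[) z.2)) *
    (v z * ker2 m z)))); last first.
  apply/funext => m; apply: integral_lebDt.
  by apply: measurable_funM => //; exact: measurable_ker2.
apply: (@measurable_parametrized_Rintegral _ _ R2 R2 R LL
  (fun w => (\1_D w.2.1 * (\1_(`]0%R, t[) w.2.2)) * (v w.2 * (ker2 w.1 w.2)))).
have mm : measurable_fun setT (fun w : R2 * R2 => ((w.1.1, w.2.1), (w.1.2, w.2.2)) : R2 * R2).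
  apply: measurable_fun_pair; apply: measurable_fun_pair.
  - by apply: (measurableT_comp (@measurable_fst _ _ _ _)) => //; exact: measurable_fst.
  - by apply: (measurableT_comp (@measurable_fst _ _ _ _)) => //; exact: measurable_snd.
  - by apply: (measurableT_comp (@measurable_snd _ _ _ _)) => //; exact: measurable_fst.
  - by apply: (measurableT_comp (@measurable_snd _ _ _ _)) => //; exact: measurable_snd.
have m1 : measurable_fun setT (fun w : R2 * R2 => w.2.1).
  by apply: (measurableT_comp (@measurable_fst _ _ _ _)) => //; exact: measurable_snd.
have m2 : measurable_fun setT (fun w : R2 * R2 => w.2.2).
  by apply: (measurableT_comp (@measurable_snd _ _ _ _)) => //; exact: measurable_snd.
apply: measurable_funM; first apply: measurable_funM.
- apply: (measurableT_comp _ m1); exact: (measurable_indic measurable_D).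
- apply: (measurableT_comp _ m2); exact: (measurable_indic (measurable_itv _)).
- apply: measurable_funM; first by apply: (measurableT_comp mv).
  have mn H (p : R2 * R2 -> R2) : measurable_fun setT p -> measurable_fun setT (fun w => nker H (p w).1 (p w).2).
    by move=> mp; apply: (measurableT_comp (measurable_nker2 H) mp).
  apply: measurable_funM.
    by apply: (mn H1 (fun w => (w.1.1, w.2.1))); have := measurableT_comp (@measurable_fst _ _ R2 R2) mm.
  by apply: (mn H2 (fun w => (w.1.2, w.2.2))); have := measurableT_comp (@measurable_snd _ _ R2 R2) mm.
Qed.

Lemma Ktr_tensor t (a b : R -> R) m : measurable_fun setT a -> measurable_fun setT b ->
  mu.-integrable setT (EFin \o (fun x => (\1_D x : R) * (a x * nker H1 m.1 x))) ->
  mu.-integrable setT (EFin \o (fun x => (\1_(`]0%R, t[) x : R) * (b x * nker H2 m.2 x))) ->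
  Ktr t (fun z => a z.1 * b z.2) m =
    (\int[mu]_x ((\1_D x : R) * (a x * nker H1 m.1 x))) *
    \int[mu]_x ((\1_(`]0%R, t[) x : R) * (b x * nker H2 m.2 x)).
Proof.
move=> ma mb ia ib; rewrite -(Rintegral_tensor ia ib) /Ktr integral_lebDt; last first.
  by apply: measurable_funM; [exact: measurable_tensor|exact: measurable_ker2].
by apply: eq_Rintegral => z _; rewrite /ker2; ring.
Qed.

Lemma integrable_indic_cont (g h : R -> R) (a b : R) (M : R) : measurable_fun setT h ->
  (forall x, `|h x| <= M) -> continuous g ->
  mu.-integrable setT (EFin \o (fun x => (\1_(`]a, b[) x : R) * (h x * g x))).
Proof.
move=> mh hM cg.
have mg : measurable_fun setT g by exact: continuous_measurable_fun.
have M0 : 0 <= M by rewrite (le_trans _ (hM 0)).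
have ig : mu.-integrable setT (EFin \o (fun x => (\1_(`]a, b[) x : R) * `|g x|)).
  apply: integrable_indic_mul => //; apply: continuous_integrable_itv => x.
  by apply: continuous_comp; [exact: cg|exact: norm_continuous].
apply: (@Rintegrable_le _ _ _ mu _ measurableT _ (fun x => M * ((\1_(`]a, b[) x : R) * `|g x|))).
- by apply: measurable_funM => //; apply: measurable_funM.
- exact: RintegrableZ.
- move=> x _; rewrite normrM mulrCA ger0_norm ?ler_wpM2l// normrM ler_wpM2r//.
Qed.

Definition rectf (q : wrect R) z : R :=
  \1_(`]xlo q, xhi q] `*` `]tlo q, thi q]) z.

Lemma rectfE q z : rectf q z = (\1_(`]xlo q, xhi q]) z.1 : R) * \1_(`]tlo q, thi q]) z.2.
Proof.
by rewrite /rectf !indicE in_setX -natrM mulnb.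
Qed.

Lemma Ktr_rect t q m : wrect_in t q -> Ktr t (rectf q) m =
  (nprim H1 (xhi q) m.1 - nprim H1 (xlo q) m.1) * (nprim H2 (thi q) m.2 - nprim H2 (tlo q) m.2).
Proof.
move=> [[x0 x1 x2] [t0 t1 t2]].
rewrite (_ : rectf q = fun z => (\1_(`]xlo q, xhi q]) z.1 : R) * \1_(`]tlo q, thi q]) z.2); last first.
  by apply/funext => z; exact: rectfE.
have b1 (A : set R) x : `|\1_A x : R| <= 1.
  by rewrite indicE; case: (_ \in _); rewrite ?normr0 ?normr1.
rewrite (@Ktr_tensor _ (\1_(`]xlo q, xhi q]) : R -> R) (\1_(`]tlo q, thi q]) : R -> R))//; last 2 first.
- by apply: (@integrable_indic_cont _ _ _ _ 1) => //; exact: continuous_nker.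
- by apply: (@integrable_indic_cont _ _ _ _ 1) => //; exact: continuous_nker.
have mn H xi : measurable_fun setT (nker H xi).
  by apply: continuous_measurable_fun; exact: continuous_nker.
rewrite /D !integral_indic_itv2 ?(ltW x0) ?(ltW x2)//.
by rewrite !integral_nker.
Qed.

Lemma rectf_L2 t q : exists v : L2Dt t, (v : R2 -> R) = rectf q.
Proof.
apply: (mkL2_bounded (M := 1) (lebDt_lty t)).
  by apply: measurable_indic; apply: measurableX.
by move=> z; rewrite /rectf indicE; case: (_ \in _); rewrite ?normr0 ?normr1.
Qed.

End space_time.

(** * Isometry between Wiener integrals and transforms *)

Section wiener.
Context {R : realType} d (Omega : measurableType d) (P : probability Omega R).
Variables (H1 H2 T : R) (W : R -> R -> {RV P >-> R}).
Hypotheses (H1P : 0 < H1 <= 1 / 2) (H2P : 0 < H2 <= 1 / 2).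
Hypothesis hW : fractional_brownian_sheet P H1 H2 T W.
Variable t : R.
Hypothesis tT : 0 <= t <= T.

Notation R2 := (measurableTypeR R * measurableTypeR R)%type.
Notation LL := (lebLL R).
Notation L2M := (LfunType LL (lee1n 2)).
Notation L2P := (LfunType P (lee1n 2)).
Notation L2Dt := (LfunType (lebDt t) (lee1n 2)).

Definition sheetL (x r : R) : L2P := xget 0 [set v : L2P | (v : Omega -> R) = W x r].

Lemma sheetLE x r : 0 < x < 1 -> 0 <= r <= T -> sheetL x r = W x r :> (Omega -> R).
Proof.
move=> x01 rT; rewrite /sheetL; case: xgetP => [v _ //|/=].
have [v vE] : exists v : L2P, (v : Omega -> R) = W x r.
  apply: mkL2; first exact: measurable_funP.
  have := fbs_cov hW x01 x01 rT rT; rewrite unlock => h.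
  rewrite (_ : (\int[P]_w _)%E = (fbm_cov H1 x x * fbm_cov H2 r r)%:E) ?ltry//.
by move/(_ v).
Qed.

Lemma sheetL_ip x r y q : 0 < x < 1 -> 0 <= r <= T -> 0 < y < 1 -> 0 <= q <= T ->
  ip (sheetL x r) (sheetL y q) = ip (sprimL H1 H2 x r) (sprimL H1 H2 y q).
Proof.
move=> x01 rT y01 qT; have [x0 _] := andP x01; have [y0 _] := andP y01.
have [r0 _] := andP rT; have [q0 _] := andP qT.
rewrite (sprimL_ip H1P H2P (ltW x0) r0 (ltW y0) q0).
apply: EFin_inj; rewrite -integral_ip !sheetLE//.
by have := fbs_cov hW x01 y01 rT qT; rewrite unlock.
Qed.

Definition stepP (g : step_fun t) : L2P :=
  \sum_i let q := step_rect g i in coef q *: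
    (sheetL (xhi q) (thi q) - sheetL (xlo q) (thi q)
     - sheetL (xhi q) (tlo q) + sheetL (xlo q) (tlo q)).

Definition stepM (g : step_fun t) : L2M :=
  \sum_i let q := step_rect g i in coef q *:
    (sprimL H1 H2 (xhi q) (thi q) - sprimL H1 H2 (xlo q) (thi q)
     - sprimL H1 H2 (xhi q) (tlo q) + sprimL H1 H2 (xlo q) (tlo q)).

Let rect_adm q : wrect_in t q -> [/\ 0 < xlo q < 1, 0 < xhi q < 1,
  0 <= tlo q <= T & 0 <= thi q <= T].
Proof.
move=> [[x0 x1 x2] [t0 t1 t2]]; have [_ tT'] := andP tT.
split; apply/andP; split => //.
- exact: le_lt_trans x2.
- exact: lt_le_trans x1.
- by rewrite (le_trans t1)// (le_trans t2).
- exact: le_trans t1.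
- exact: le_trans tT'.
Qed.

Lemma stepPE g : stepP g = step_int W g :> (Omega -> R).
Proof.
apply/funext => w; rewrite /stepP L2_sumE; apply: eq_bigr => i _.
have [h1 h2 h3 h4] := rect_adm (step_in i).
rewrite -[LHS]/(coef (step_rect g i) * (sheetL (xhi (step_rect g i)) (thi (step_rect g i)) w
  - sheetL (xlo (step_rect g i)) (thi (step_rect g i)) w
  - sheetL (xhi (step_rect g i)) (tlo (step_rect g i)) w
  + sheetL (xlo (step_rect g i)) (tlo (step_rect g i)) w)).
by rewrite !sheetLE.
Qed.

Lemma stepL_ex g : exists2 v : L2Dt, (v : R2 -> R) = step_val g &
  forall m, ip v (ker2L H1 H2 t m) = stepM g m.
Proof.
have [v vE] := choice (fun q => rectf_L2 t q).
exists (\sum_i coef (step_rect g i) *: v (step_rect g i)).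
  apply/funext => z; rewrite L2_sumE; apply: eq_bigr => i _.
  by rewrite -[LHS]/(coef (step_rect g i) * v (step_rect g i) z) vE.
move=> m; rewrite ip_suml /stepM L2_sumE; apply: eq_bigr => i _.
rewrite ipZl -KtrE vE Ktr_rect//; last exact: step_in.
have [h1 h2 h3 h4] := rect_adm (step_in i).
have S x r : 0 < x < 1 -> 0 <= r <= T ->
    sprimL H1 H2 x r m = nprim H1 x m.1 * nprim H2 r m.2.
  by move=> /andP[/ltW x0 _] /andP[r0 _]; rewrite sprimLE.
rewrite -[RHS]/(coef (step_rect g i) * (sprimL H1 H2 (xhi (step_rect g i)) (thi (step_rect g i)) m
  - sprimL H1 H2 (xlo (step_rect g i)) (thi (step_rect g i)) m
  - sprimL H1 H2 (xhi (step_rect g i)) (tlo (step_rect g i)) m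
  + sprimL H1 H2 (xlo (step_rect g i)) (tlo (step_rect g i)) m)).
rewrite (S _ _ h2 h4) (S _ _ h1 h4) (S _ _ h2 h3) (S _ _ h1 h3); ring.
Qed.

(** Both sides expand into the same combination of inner products of corners, which agree by
    [sheetL_ip]. *)
Lemma step_isometry g g' : ip (stepP g) (stepP g') = ip (stepM g) (stepM g').
Proof.
rewrite /stepP /stepM !ip_suml; apply: eq_bigr => i _.
rewrite !ip_sumr; apply: eq_bigr => j _; rewrite !ipZl !ipZr.
have [h1 h2 h3 h4] := rect_adm (step_in i).
have [k1 k2 k3 k4] := rect_adm (step_in j).
rewrite !(ipBl, ipBr, ipDl, ipDr).
by rewrite !sheetL_ip.
Qed.

Lemma nrm_stepB g g' : nrm (stepP g - stepP g') = nrm (stepM g - stepM g').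
Proof.
apply/eqP; rewrite -(@eqrXn2 _ 2) ?nrm_ge0//; apply/eqP.
by rewrite -!ip_sq !(ipBl, ipBr) !step_isometry.
Qed.

(** A Green function is only known to be measurable on D x (0, t); the cutoff makes it measurable on
    the whole plane. *)
Definition restrictDt (h : R2 -> R) (z : R2) : R := \1_(D `*` `]0%R, t[) z * h z.

Lemma measurable_restrictDt (h : R2 -> R) :
  measurable_fun (D `*` `]0%R, t[ : set R2) h -> measurable_fun setT (restrictDt h).
Proof.
move=> mh; have mD := measurable_Dt t.
have -> : restrictDt h = h \_ (D `*` `]0%R, t[).
  apply/funext => z; rewrite patchE /restrictDt indicE.
  by case: (_ \in _); rewrite ?mul1r ?mul0r.
exact: ((measurable_restrictT h mD).1 mh).
Qed.

Lemma L2cvg_Dt_cvgL2 (f : nat -> R2 -> R) (v : nat -> L2Dt) (h : R2 -> R) :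
  (forall n, f n = v n) -> measurable_fun (D `*` `]0%R, t[ : set R2) h ->
  L2cvg_Dt t f h ->
  exists2 hL : L2Dt, (hL : R2 -> R) = restrictDt h & cvgL2 v hL.
Proof.
move=> fv mh fh; have mr := measurable_restrictDt mh.
apply: (cvgL2_approx fv mr).
apply: cvg_trans fh; apply: near_eq_cvg; apply: nearW => n /=.
rewrite (ge0_integral_mrestr LL (measurable_Dt t)); last 2 first.
- apply/measurable_EFinP; apply: measurable_funX; apply: measurable_funB => //.
  by rewrite fv.
- by move=> z; rewrite lee_fin sqr_ge0.
apply: eq_integral => z zD; congr (_%:E); congr (_ ^+ 2); congr (_ - _).
by rewrite /restrictDt indicE zD mul1r.
Qed.

Lemma cvgL2_Ktr (v : nat -> L2Dt) (h : L2Dt) m : cvgL2 v h ->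
  (fun n => Ktr H1 H2 t (v n) m) @ \oo --> Ktr H1 H2 t h m.
Proof.
move=> vh; rewrite KtrE.
have := cvgL2_ipl (w' := ker2L H1 H2 t m) vh.
by apply: cvg_trans; apply: near_eq_cvg; apply: nearW => n; rewrite KtrE.
Qed.

(** Two modes of convergence meet: the transforms of the approximating step functions converge
    pointwise to that of h, and they are Cauchy in L^2 because by [nrm_stepB] their distances are
    those of the step integrals, which converge to X. *)
Lemma wiener_transform (h : R2 -> R) (X : Omega -> R) :
  measurable_fun (D `*` `]0%R, t[ : set R2) h -> is_wiener_integral W t h X ->
  exists (g : nat -> step_fun t) (x : L2P) (k : L2M),
   [/\ (x : Omega -> R) = X, (k : R2 -> R) = Ktr H1 H2 t (restrictDt h),
     cvgL2 (fun n => stepP (g n)) x & cvgL2 (fun n => stepM (g n)) k].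
Proof.
move=> mh [mX [g [gh gX]]].
have [v vE] := choice (fun n => (let: ex_intro2 v a b := stepL_ex (g n) in ex_intro _ v (conj a b)
  : exists v : L2Dt, (v : R2 -> R) = step_val (g n) /\
     forall m, ip v (ker2L H1 H2 t m) = stepM (g n) m)).
have [hL hLE vh] := L2cvg_Dt_cvgL2 (fun n => esym (vE n).1) mh gh.
have [x xE gx] := cvgL2_approx (fun n => esym (stepPE (g n))) mX gX.
have mK : measurable_fun setT (Ktr H1 H2 t (restrictDt h)).
  by apply: measurable_Ktr; exact: measurable_restrictDt.
have [||k kE gk] := @L2_pointwise_limit _ _ _ LL (fun n => stepM (g n)) _ mK.
- apply: aeW => m; rewrite -hLE; have := @cvgL2_Ktr v hL m vh.
  by apply: cvg_trans; apply: near_eq_cvg; apply: nearW => n; rewrite KtrE (vE n).2.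
- move=> e e0; have [N hN] := cvgL2_cauchy gx e0.
  by exists N => i j Ni Nj; rewrite -nrm_stepB; exact: hN.
by exists g, x, k.
Qed.

Lemma wiener_gram (h h' : R2 -> R) (X X' : Omega -> R) :
  measurable_fun (D `*` `]0%R, t[ : set R2) h -> is_wiener_integral W t h X ->
  measurable_fun (D `*` `]0%R, t[ : set R2) h' -> is_wiener_integral W t h' X' ->
  Rintegral P setT (fun w => X w * X' w) =
  Rintegral LL setT (fun m => Ktr H1 H2 t (restrictDt h) m * Ktr H1 H2 t (restrictDt h') m).
Proof.
move=> mh hX mh' hX'.
have [g [x [k [xE kE gx gk]]]] := wiener_transform mh hX.
have [g' [x' [k' [xE' kE' gx' gk']]]] := wiener_transform mh' hX'.
rewrite -xE -xE' -kE -kE' -/(ip x x') -/(ip k k').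
have c1 := cvgL2_ip gx gx'; have c2 := cvgL2_ip gk gk'.
have c3 : (fun n => ip (stepP (g n)) (stepP (g' n))) @ \oo --> ip k k'.
  by apply: cvg_trans c2; apply: near_eq_cvg; apply: nearW => n; rewrite step_isometry.
by apply: (cvg_unique _ c1 c3).
Qed.

End wiener.

(** * The stochastic convolution *)

Section twofold.
Context d1 d2 (Y : measurableType d1) (X : measurableType d2) (R : realType).
Context (nu : {sigma_finite_measure set Y -> \bar R}).
Context (m : {sigma_finite_measure set X -> \bar R}).
Variables (phi : LfunType m (lee1n 2)) (Z : Y * X -> R).
Hypothesis mZ : measurable_fun setT Z.
Hypothesis hZ : (\int[nu]_w \int[m]_x (Z (w, x) ^+ 2)%:E < +oo)%E.

Let mZ1 w : measurable_fun setT (fun x => Z (w, x)).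
Proof. exact: (measurableT_comp mZ (measurable_pair1 w)). Qed.

Let mZ2 : measurable_fun setT (fun z => (Z z ^+ 2)%:E).
Proof. by apply/measurable_EFinP; exact: measurable_funX. Qed.

Lemma ae_section_L2 : {ae nu, forall w, exists v : LfunType m (lee1n 2),
  (v : X -> R) = (fun x => Z (w, x))}.
Proof.
have mF : measurable_fun setT (fun w => \int[m]_x (Z (w, x) ^+ 2)%:E)%E.
  apply: (@measurable_fun_fubini_tonelli_F _ _ _ _ _ m (fun z => (Z z ^+ 2)%:E)) => //.
  by move=> z; rewrite lee_fin sqr_ge0.
have iF : nu.-integrable setT (fun w => \int[m]_x (Z (w, x) ^+ 2)%:E)%E.
  apply/integrableP; split => //; apply: le_lt_trans hZ.
  rewrite le_eqVlt; apply/orP; left; apply/eqP; apply: eq_integral => w _.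
  by rewrite gee0_abs// integral_ge0// => x _; rewrite lee_fin sqr_ge0.
have := integrable_ae measurableT iF; apply: filterS => w /(_ I) /fin_numPlt/andP[_ h].
exact: (mkL2 (mZ1 w) h).
Qed.

Let g (z : Y * X) : R := phi z.2 * Z z.

Let mphi2 : measurable_fun setT (fun z : Y * X => phi z.2).
Proof. by apply: (measurableT_comp (L2_measurable phi)). Qed.

Let mg : measurable_fun setT g.
Proof. exact: measurable_funM. Qed.

Let H (p : Y * (X * X)) : R := g (p.1, p.2.1) * g (p.1, p.2.2).

Let mp1 : measurable_fun setT (fun p : Y * (X * X) => (p.1, p.2.1)).
Proof.
apply: measurable_fun_pair => //.
by apply: (measurableT_comp (@measurable_fst _ _ X X)).
Qed.

Let mp2 : measurable_fun setT (fun p : Y * (X * X) => (p.1, p.2.2)).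
Proof.
apply: measurable_fun_pair => //.
by apply: (measurableT_comp (@measurable_snd _ _ X X)).
Qed.

Let mH : measurable_fun setT H.
Proof. by apply: measurable_funM; [exact: (measurableT_comp mg mp1)|exact: (measurableT_comp mg mp2)]. Qed.

Let phi2 : (\int[m]_x (phi x ^+ 2)%:E = (nrm phi ^+ 2)%:E)%E.
Proof. exact: integral_sq. Qed.

Let HI : (pmeasure nu (pmeasure m m)).-integrable setT (EFin \o H).
Proof.
have mE : measurable_fun setT (EFin \o H) by exact/measurable_EFinP.
apply: (integrable12ltyP nu (pmeasure m m) mE).2.
have mphix : measurable_fun setT (fun x => phi x ^+ 2) by apply: measurable_funX; exact: L2_measurable.
have mZx w : measurable_fun setT (fun x => Z (w, x) ^+ 2) by apply: measurable_funX.
have p0 x : 0 <= phi x ^+ 2 by exact: sqr_ge0.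
have q0 w x : 0 <= Z (w, x) ^+ 2 by exact: sqr_ge0.
have t1 w : measurable_fun setT (fun z : X * X => (Z (w, z.1) ^+ 2 * phi z.2 ^+ 2)%:E).
  by apply/measurable_EFinP; exact: (measurable_tensor (mZx w) mphix).
have t2 w : measurable_fun setT (fun z : X * X => (phi z.1 ^+ 2 * Z (w, z.2) ^+ 2)%:E).
  by apply/measurable_EFinP; exact: (measurable_tensor mphix (mZx w)).
apply: (@le_lt_trans _ _ (\int[nu]_w ((2 * nrm phi ^+ 2)%:E * \int[m]_x (Z (w, x) ^+ 2)%:E))%E); last first.
  rewrite ge0_integralZl//; last 3 first.
  - apply: (@measurable_fun_fubini_tonelli_F _ _ _ _ _ m (fun z => (Z z ^+ 2)%:E)) => //.
    by move=> z; rewrite lee_fin sqr_ge0.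
  - by move=> w _; apply: integral_ge0 => x _; rewrite lee_fin.
  - by rewrite lee_fin mulr_ge0 ?sqr_ge0.
  by apply: lte_mul_pinfty => //; rewrite lee_fin mulr_ge0 ?sqr_ge0.
apply: ge0_le_integral => //.
- by move=> w _; apply: integral_ge0.
- apply: (@measurable_fun_fubini_tonelli_F _ _ _ _ _ (pmeasure m m) (fun p => `|(EFin \o H) p|)%E) => //.
  exact: measurableT_comp.
- apply: measurable_funeM.
  apply: (@measurable_fun_fubini_tonelli_F _ _ _ _ _ m (fun z => (Z z ^+ 2)%:E)) => //.
  by move=> z; rewrite lee_fin sqr_ge0.
move=> w _.
(* The product is regrouped as (Z(w, x) phi(y)) (phi(x) Z(w, y)) before applying a b <= a^2 + b^2,
   so that each square is a tensor product. *)
apply: (@le_trans _ _ (\int[pmeasure m m]_z ((Z (w, z.1) ^+ 2 * phi z.2 ^+ 2)%:E +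
    (phi z.1 ^+ 2 * Z (w, z.2) ^+ 2)%:E))%E).
  apply: ge0_le_integral => //.
  - by apply: measurableT_comp => //; exact: (measurableT_comp mE (measurable_pair1 w)).
  - exact: emeasurable_funD.
  - move=> z _ /=; rewrite lee_fin /H /g /= !normrM.
    rewrite -(real_normK (num_real (Z (w, z.1)))) -(real_normK (num_real (Z (w, z.2)))).
    rewrite -(real_normK (num_real (phi z.1))) -(real_normK (num_real (phi z.2))).
    have h1 : 0 <= `|Z (w, z.1)| * `|phi z.2| by rewrite mulr_ge0.
    have h2 : 0 <= `|phi z.1| * `|Z (w, z.2)| by rewrite mulr_ge0.
    rewrite -!exprMn.
    rewrite (_ : _ * _ * _ = (`|Z (w, z.1)| * `|phi z.2|) * (`|phi z.1| * `|Z (w, z.2)|)); last by ring.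
    move: h1 h2; move: (`|Z (w, z.1)| * _) (_ * `|Z (w, z.2)|) => a b a0 b0.
    by have := sqr_ge0 (a - b); have := mulr_ge0 a0 b0; nra.
rewrite ge0_integralD//; last 2 first.
- by move=> z _; rewrite lee_fin mulr_ge0.
- by move=> z _; rewrite lee_fin mulr_ge0.
rewrite (ge0_integral_tensor m m (mZx w) mphix)// (ge0_integral_tensor m m mphix (mZx w))//.
rewrite phi2 muleC -ge0_muleDl ?lee_fin ?sqr_ge0// -EFinD.
by rewrite mulr2n mulrDl mul1r.
Qed.

(** The inner integral on the right involves Z only through its Gram kernel. Two fields with the
    same kernel, even over different spaces, thus have coefficients with the same second moments. *)
Lemma twofold : (\int[nu]_w ((\int[m]_x (phi x * Z (w, x))) ^+ 2)%:E =
  \int[pmeasure m m]_z \int[nu]_w (phi z.1 * Z (w, z.1) * (phi z.2 * Z (w, z.2)))%:E)%E.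
Proof.
rewrite -(Fubini HI).
apply: ae_eq_integral => //.
- apply/measurable_EFinP; apply: measurable_funX.
  exact: (@measurable_parametrized_Rintegral _ _ _ _ _ m _ mg).
- exact: measurable_fubini_F HI.
- apply: filterS ae_section_L2 => w [v vE] _.
  have ig : m.-integrable setT (EFin \o (fun x => phi x * Z (w, x))).
    by have := ip_integrable phi v; rewrite vE.
  rewrite (RintegralE measurableT (integrable_tensor ig ig)).
  by rewrite (Rintegral_tensor ig ig) expr2.
Qed.

End twofold.

Definition nweight {R : realType} (H xi : R) : R :=
  (Num.sqrt (hconst H))^-1 * (xi * `|xi| `^ (- (1 / 2 + H))).

(** Equality can fail only at xi = 0 with H = 1/2, where the right-hand power is 0^0 = 1. *)
Lemma nweight_sqr {R : realType} (H xi : R) : nweight H xi ^+ 2 <=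
  (Num.sqrt (hconst H))^-1 ^+ 2 * `|xi| `^ (1 - 2 * H).
Proof.
rewrite /nweight exprMn ler_wpM2l ?sqr_ge0//.
have [->|x0] := eqVneq xi 0; first by rewrite mul0r expr0n powR_ge0.
rewrite exprMn -(real_normK (num_real xi)) -(powR_mulrn 2 (normr_ge0 xi)).
rewrite expr2 -!normr_powRD// le_eqVlt; apply/orP; left; apply/eqP; congr (_ `^ _).
by field.
Qed.

(** * Variance of the modes of the stochastic convolution *)

Section modes.
Context {R : realType}.
Variables (alpha s H1 H2 T : R).
Hypothesis alpha01 : 0 < alpha < 1.
Hypotheses (H1P : 0 < H1 <= 1 / 2) (H2P : 0 < H2 <= 1 / 2).
Hypothesis T0 : 0 <= T.
Variables (lam : nat -> R) (phi : nat -> L2D R).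
Hypothesis hA : dirichlet_eigensystem lam phi.

Notation mu := (@lebesgue_measure R).
Notation R2 := (measurableTypeR R * measurableTypeR R)%type.
Notation LL := (lebLL R).
Notation L2M := (LfunType LL (lee1n 2)).
Notation L2Dt t := (LfunType (lebDt t) (lee1n 2)).

Definition relax k (r : R) : R := mittag_leffler alpha 1 (- (lam k `^ s * r `^ alpha)).

Lemma lam_sqr k : exists2 w, 1 <= w & lam k = w ^+ 2 /\
  exists c, c ^+ 2 = 2 /\ forall x, 0 < x < 1 -> phi k x = c * sin (w * x).
Proof.
have [m [c h]] := dirichlet_eigensystemP hA; have [km lE c2 pE] := h k.
exists ((m k)%:R * pi); last by split=> //; exists (c k).
rewrite (le_trans _ (ler_peMl (pi_ge0 R) _)) ?ler1n//; last exact: leq_trans km.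
by rewrite (le_trans _ (pi_ge2 R))// ler1n.
Qed.

Lemma lam_ge k : k.+1%:R ^+ 2 <= lam k.
Proof.
have [m [c h]] := dirichlet_eigensystemP hA; have [km -> _ _] := h k.
rewrite ler_pXn2r ?nnegrE ?mulr_ge0 ?pi_ge0//.
have h1 : k.+1%:R <= (m k)%:R :> R by rewrite ler_nat.
have h2 : 1 <= pi :> R by rewrite (le_trans _ (pi_ge2 R))// ler1n.
by rewrite (le_trans h1)// ler_peMr.
Qed.

Lemma lam_gt0 k : 0 < lam k.
Proof. by apply: (lt_le_trans _ (lam_ge k)); rewrite exprn_gt0. Qed.

Let arg0 k r : 0 <= lam k `^ s * r `^ alpha.
Proof. by rewrite mulr_ge0 ?powR_ge0. Qed.

Lemma relax_ge0 k r : 0 <= relax k r.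
Proof. exact: (mlneg_ge0 alpha01 (arg0 k r)). Qed.

Lemma relax_le1 k r : relax k r <= 1.
Proof. exact: (mlneg_le1 alpha01 (arg0 k r)). Qed.

Lemma relax_noninc k x y : 0 < x -> x <= y -> relax k y <= relax k x.
Proof.
move=> x0 xy; apply: (mlneg_noninc alpha01 (arg0 k x)).
rewrite ler_wpM2l ?powR_ge0// ge0_ler_powR ?nnegrE ?(ltW x0)//.
- by case/andP : alpha01 => /ltW.
- by rewrite (le_trans (ltW x0)).
Qed.

Lemma measurable_relax k : measurable_fun setT (relax k).
Proof.
(* Monotonicity of [mlneg] is known on nonnegative arguments only; composing with the positive part
   makes it monotone on the line, hence measurable. *)
have mM : measurable_fun setT (fun x : R => mlneg alpha (Num.max x 0)).
  apply: nonincreasing_measurable => // x y xy.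
  apply: (mlneg_noninc alpha01); first by rewrite le_max lexx orbT.
  by rewrite ge_max !le_max xy lexx orbT.
have mg : measurable_fun setT (fun r : R => lam k `^ s * r `^ alpha) by exact: measurable_funM.
have := measurableT_comp mM mg; rewrite /comp (_ : (fun x => _) = relax k)//.
by apply/funext => r; rewrite /relax /mlneg max_l.
Qed.

Lemma relax_bound g k x : 0 <= g <= 1 -> 0 < x ->
  relax k x <= (gJ alpha + 1) * lam k `^ (- (s * g)) * x `^ (- (alpha * g)).
Proof.
move=> g01 x0; have l0 := lam_gt0 k.
have a0 : 0 < lam k `^ s * x `^ alpha by rewrite mulr_gt0 ?powR_gt0.
have := mlneg_bound alpha01 g01 a0; rewrite powRM ?powR_ge0// -!powRrM !mulrN.
by rewrite mulrA.
Qed.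

Definition modef t k (z : R2) : R := phi k z.1 * relax k (t - z.2).

Lemma measurable_relaxB t k : measurable_fun setT (fun r : R => relax k (t - r)).
Proof. by apply: (measurableT_comp (measurable_relax k)); exact: measurable_funB. Qed.

Lemma measurable_modef t k : measurable_fun setT (modef t k).
Proof.
apply: (@measurable_tensor _ _ (measurableTypeR R) (measurableTypeR R) R (phi k) (fun r => relax k (t - r))) => //.
exact: measurable_relaxB.
Qed.

Lemma modef_L2 t k : exists v : L2Dt t, (v : R2 -> R) = modef t k.
Proof.
apply: mkL2; first exact: measurable_modef.
have mf2 : measurable_fun setT (fun z => (modef t k z ^+ 2)%:E).
  by apply/measurable_EFinP; apply: measurable_funX; exact: measurable_modef.
have [w _ [_ [c [c2 pE]]]] := lam_sqr k.
have mD := measurable_Dt t.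
have LD : (LL (D `*` `]0%R, t[) < +oo)%E.
  by have := lebDt_lty t; rewrite /lebDt /= /mrestr setTI.
have f0 z : (0 <= (modef t k z ^+ 2)%:E)%E by rewrite lee_fin sqr_ge0.
have -> := @ge0_integral_mrestr _ _ _ LL _ mD _ mf2 f0.
apply: (@le_lt_trans _ _ (\int[LL]_(z in D `*` `]0%R, t[) (cst 2%:E z))%E); last first.
  by rewrite integral_cst// lte_mul_pinfty.
apply: (@ge0_le_integral _ _ _ LL _ mD _ _ (fun z _ => f0 z)) => //.
  exact: measurable_funTS.
move=> [x r] [] /=; rewrite /D/= in_itv/= => x01 _.
have q1 : sin (w * x) ^+ 2 <= 1.
  by rewrite -(real_normK (num_real (sin _))) expr_le1// sin_max.
have q2 : relax k (t - r) ^+ 2 <= 1 by rewrite expr_le1 ?relax_ge0 ?relax_le1.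
rewrite lee_fin /modef/= pE// !exprMn c2 -mulrA ler_piMr//.
by rewrite mulr_ile1 ?sqr_ge0.
Qed.

Definition modeK t k (m : R2) : R := Ktr H1 H2 t (modef t k) m.

Lemma measurable_modeK t k : measurable_fun setT (modeK t k).
Proof. by apply: measurable_Ktr; exact: measurable_modef. Qed.

Lemma modeKE t k w c : (forall x, 0 < x < 1 -> phi k x = c * sin (w * x)) ->
  modeK t k = (fun m => (nweight H1 m.1 * c * sine_hartley w m.1) *
                 (nweight H2 m.2 * time_hartley (relax k) t m.2)).
Proof.
move=> pE; apply/funext => m; rewrite /modeK.
have e1 : (fun x : R => (\1_D x : R) * (phi k x * nker H1 m.1 x)) =
    (fun x : R => (\1_D x : R) * (c * sin (w * x) * nker H1 m.1 x)).
  apply/funext => x; rewrite indicE; have [|_] := boolP (x \in D); last by rewrite !mul0r.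
  by rewrite inE /D/= in_itv/= => x01; rewrite pE.
have cn H xi := @continuous_nker _ H xi.
have cb x : `|c * sin (w * x)| <= `|c| by rewrite normrM ler_piMr ?sin_max.
have mcs : measurable_fun setT (fun x => c * sin (w * x)).
  by apply: measurable_funM => //; exact: measurable_sinM.
have rb x : `|relax k (t - x)| <= 1 by rewrite ger0_norm ?relax_ge0 ?relax_le1.
have cas (xi : R) : continuous (fun x => cos (xi * x) + sin (xi * x)).
  by move=> x; apply: cvgD; [exact: continuous_cosM|exact: continuous_sinM].
rewrite /modef (@Ktr_tensor _ H1 H2 t (phi k) (fun r => relax k (t - r)) m)//; last 4 first.
- exact: (L2_measurable (phi k)).
- exact: measurable_relaxB.
- by rewrite e1; apply: (integrable_indic_cont _ _ mcs cb); exact: cn.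
- by apply: (integrable_indic_cont _ _ (measurable_relaxB t k) rb); exact: cn.
rewrite e1; congr (_ * _).
- rewrite /D -Rintegral_indic_mul /sine_hartley -RintegralZl//; last first.
    apply: continuous_integrable_itv => x.
    by apply: cvgM; [exact: continuous_sinM|exact: cas].
  by apply: eq_Rintegral => x _; rewrite /nker /hker /nweight; ring.
- rewrite -Rintegral_indic_mul /time_hartley -RintegralZl//; last first.
    apply: (@Rintegrable_le _ _ _ mu _ (measurable_itv _) _ (fun x => `|cos (m.2 * x) + sin (m.2 * x)|)).
    - apply: measurable_funTS; apply: measurable_funM; first exact: measurable_relaxB.
      exact: continuous_measurable_fun.
    - apply: (@continuous_integrable_itv _ (fun x => `|cos (m.2 * x) + sin (m.2 * x)|)) => x.
      apply: (continuous_comp (cas m.2 x)); exact: norm_continuous.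
    - by move=> x _; rewrite normrM ler_piMl.
  by apply: eq_Rintegral => x _; rewrite /nker /hker /nweight; ring.
Qed.

(** By [modeKE] the integral is a product. The space factor is of order w^(1 - 2 H1) = lam^(1/2 -
    H1), with c^2 = 2 from the normalised sine. The time factor is [time_hartley_weighted] with K =
    (Gamma(alpha + 1) + 1) lam^(-s g) and b = alpha g < H2, which contributes lam^(-2 s g). *)
Lemma modeK_bound g : 0 <= g <= 1 -> alpha * g < H2 -> exists2 C, 0 <= C &
  forall k t, 0 <= t <= T ->
  (\int[LL]_m (modeK t k m ^+ 2)%:E <= (C * lam k `^ (1 / 2 - H1 - 2 * s * g))%:E)%E.
Proof.
move=> g01 ag.
have [C1 C10 h1] := sine_hartley_weighted H1P.
have [C2 C20 h2] := time_hartley_weighted H2P ag T0.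
have [n1 n10 hwt1] : exists2 n, 0 <= n & forall x, nweight H1 x ^+ 2 <= n * `|x| `^ (1 - 2 * H1).
  by exists ((Num.sqrt (hconst H1))^-1 ^+ 2); [exact: sqr_ge0|exact: nweight_sqr].
have [n2 n20 hwt2] : exists2 n, 0 <= n & forall x, nweight H2 x ^+ 2 <= n * `|x| `^ (1 - 2 * H2).
  by exists ((Num.sqrt (hconst H2))^-1 ^+ 2); [exact: sqr_ge0|exact: nweight_sqr].
have [a0 _] := andP alpha01.
have J0 : 0 <= gJ alpha + 1 by rewrite addr_ge0// ltW// gJ_gt0// ltW.
exists (n1 * 2 * C1 * (n2 * (C2 * (gJ alpha + 1) ^+ 2))).
  by rewrite !mulr_ge0 ?sqr_ge0.
move=> k t tT; have [w w1 [lE [c [c2 pE]]]] := lam_sqr k.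
have w0 : 0 < w by exact: lt_le_trans w1.
rewrite (modeKE _ pE).
pose A xi := (nweight H1 xi * c * sine_hartley w xi) ^+ 2.
pose B xi := (nweight H2 xi * time_hartley (relax k) t xi) ^+ 2.
have mwt (H : R) : measurable_fun setT (nweight H).
  apply: measurable_funM => //; apply: measurable_funM => //.
  exact: measurable_normr_powR.
have mth : measurable_fun setT (time_hartley (relax k) t).
  by apply: measurable_time_hartley; exact: measurable_relax.
have mA : measurable_fun setT A.
  apply: measurable_funX; apply: measurable_funM; last exact: measurable_sine_hartley.
  exact: measurable_funM.
have mB : measurable_fun setT B.
  by apply: measurable_funX; apply: measurable_funM.
have A0 x : 0 <= A x by exact: sqr_ge0.
have B0 x : 0 <= B x by exact: sqr_ge0.
have -> : (\int[LL]_m (((nweight H1 m.1 * c * sine_hartley w m.1) *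
     (nweight H2 m.2 * time_hartley (relax k) t m.2)) ^+ 2)%:E =
    \int[mu]_x (A x)%:E * \int[mu]_x (B x)%:E)%E.
  transitivity (\int[LL]_m (A m.1 * B m.2)%:E)%E.
    by apply: eq_integral => m _; rewrite /A /B; congr (_%:E); ring.
  exact: (ge0_integral_tensor mu mu mA mB A0 B0).
have lA : (\int[mu]_x (A x)%:E <= (n1 * 2 * C1 * lam k `^ (1 / 2 - H1))%:E)%E.
  apply: (@le_trans _ _ (\int[mu]_x ((n1 * 2)%:E * (`|x| `^ (1 - 2 * H1) * sine_hartley w x ^+ 2)%:E))%E).
    apply: ge0_le_integral => //.
    - by move=> x _; rewrite lee_fin.
    - exact/measurable_EFinP.
    - apply: measurable_funeM; apply/measurable_EFinP; apply: measurable_funM.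
        exact: measurable_normr_powR.
      by apply: measurable_funX; exact: measurable_sine_hartley.
    - move=> x _; rewrite -EFinM lee_fin /A.
      rewrite (_ : _ ^+ 2 = nweight H1 x ^+ 2 * (c ^+ 2 * sine_hartley w x ^+ 2)); last by ring.
      rewrite c2 (_ : n1 * 2 * _ = n1 * `|x| `^ (1 - 2 * H1) * (2 * sine_hartley w x ^+ 2)); last by ring.
      by rewrite ler_wpM2r// mulr_ge0// sqr_ge0.
  rewrite ge0_integralZl//; last 3 first.
  - apply/measurable_EFinP; apply: measurable_funM; first exact: measurable_normr_powR.
    by apply: measurable_funX; exact: measurable_sine_hartley.
  - by move=> x _; rewrite lee_fin mulr_ge0 ?powR_ge0 ?sqr_ge0.
  - by rewrite lee_fin; exact: mulr_ge0 n10 (ler0n _ 2).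
  rewrite -(mulrA (n1 * 2)) [leRHS]EFinM.
  apply: lee_wpmul2l; first by rewrite lee_fin; exact: mulr_ge0 n10 (ler0n _ 2).
  rewrite lE -(powR_mulrn 2 (ltW w0)) -powRrM.
  by rewrite (_ : 2 * (1 / 2 - H1) = 1 - 2 * H1) ?h1//; field.
have lB : (\int[mu]_x (B x)%:E <= (n2 * (C2 * (gJ alpha + 1) ^+ 2) * lam k `^ (- 2 * s * g))%:E)%E.
  apply: (@le_trans _ _ (\int[mu]_x (n2%:E * (`|x| `^ (1 - 2 * H2) * time_hartley (relax k) t x ^+ 2)%:E))%E).
    apply: ge0_le_integral => //.
    - by move=> x _; rewrite lee_fin.
    - exact/measurable_EFinP.
    - apply: measurable_funeM; apply/measurable_EFinP; apply: measurable_funM.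
        exact: measurable_normr_powR.
      exact: measurable_funX.
    - move=> x _; rewrite -EFinM lee_fin /B.
      rewrite (_ : _ ^+ 2 = nweight H2 x ^+ 2 * time_hartley (relax k) t x ^+ 2); last by ring.
      by rewrite (mulrA n2) ler_wpM2r ?sqr_ge0.
  rewrite ge0_integralZl//; last 2 first.
  - apply/measurable_EFinP; apply: measurable_funM; first exact: measurable_normr_powR.
    exact: measurable_funX.
  - by move=> x _; rewrite lee_fin mulr_ge0 ?powR_ge0 ?sqr_ge0.
  rewrite -mulrA EFinM lee_wpmul2l ?lee_fin//.
  have K0 : 0 <= (gJ alpha + 1) * lam k `^ (- (s * g)) by rewrite mulr_ge0 ?powR_ge0.
  have := h2 (relax k) t _ (measurable_relax k) _ (fun x y => @relax_noninc k x y) K0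
    (fun x x0 => relax_bound k g01 x0) tT.
  have -> : C2 * ((gJ alpha + 1) * lam k `^ (- (s * g))) ^+ 2 =
      C2 * (gJ alpha + 1) ^+ 2 * lam k `^ (- 2 * s * g).
    rewrite exprMn mulrA; congr (_ * _).
    rewrite -(powR_mulrn 2 (powR_ge0 _ _)) -powRrM; congr (_ `^ _); ring.
  by apply => x _; rewrite relax_ge0 relax_le1.
apply: (le_trans (lee_pmul _ _ lA lB)).
- by apply: integral_ge0 => x _; rewrite lee_fin.
- by apply: integral_ge0 => x _; rewrite lee_fin.
rewrite -EFinM lee_fin le_eqVlt; apply/orP; left; apply/eqP.
rewrite (_ : 1 / 2 - H1 - 2 * s * g = 1 / 2 - H1 + - 2 * s * g); last by ring.
by rewrite (powRDp (1 / 2 - H1) _ (lam_gt0 k)); ring.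
Qed.

End modes.

(** * Second moments of the stochastic convolution and of its coefficients *)

Section stochastic_convolution.
Context {R : realType} d (Omega : measurableType d) (P : probability Omega R).
Variables (alpha s H1 H2 T : R) (W : R -> R -> {RV P >-> R}).
Hypothesis alpha01 : 0 < alpha < 1.
Hypotheses (H1P : 0 < H1 <= 1 / 2) (H2P : 0 < H2 <= 1 / 2).
Variables (lam : nat -> R) (phi : nat -> L2D R).
Hypothesis hA : dirichlet_eigensystem lam phi.
Hypothesis hW : fractional_brownian_sheet P H1 H2 T W.
Variable t : R.
Hypothesis tT : 0 <= t <= T.

Notation mu := (@lebesgue_measure R).
Notation R2 := (measurableTypeR R * measurableTypeR R)%type.
Notation LL := (lebLL R).
Notation L2M := (LfunType LL (lee1n 2)).
Notation L2P := (LfunType P (lee1n 2)).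
Notation L2Dt := (LfunType (lebDt t) (lee1n 2)).
Notation mK := (modeK alpha s H1 H2 lam phi t).

Let hphi : forall j k, ip (phi j) (phi k) = (j == k)%:R := eigensystem_orthonormal hA.

Variable V : nat -> R.
Hypothesis hV : forall k, (\int[LL]_m (mK k m ^+ 2)%:E <= (V k)%:E)%E.
Variable B : R.
Hypothesis hB : forall n, \sum_(0 <= k < n) V k <= B.

Let V0 k : 0 <= V k.
Proof.
by rewrite -lee_fin (le_trans _ (hV k))// integral_ge0// => m _; rewrite lee_fin sqr_ge0.
Qed.

Let mmK k : measurable_fun setT (mK k).
Proof. exact: measurable_modeK. Qed.

Let mKL k : exists v : L2M, (v : R2 -> R) = mK k.
Proof. by apply: mkL2 => //; apply: (le_lt_trans (hV k)); rewrite ltry. Qed.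

Definition kpsum n (z : R2 * measurableTypeR R) : R :=
  \sum_(0 <= k < n) mK k z.1 * phi k z.2.

Lemma measurable_kpsum n : measurable_fun setT (kpsum n).
Proof.
apply: measurable_sum => k; apply: (measurable_tensor (mmK k) (L2_measurable (phi k))).
Qed.

(** [kpsum] is the transform of the partial sums of the Green function, which converge to h in L^2;
    the transform at a given m is continuous there. *)
Lemma green_kpsum_cvg x h m : is_green lam phi alpha s t x h ->
  (fun n => kpsum n (m, x)) @ \oo --> Ktr H1 H2 t (restrictDt t h) m.
Proof.
move=> [mh hh].
have [g gE] := choice (fun k => modef_L2 s alpha01 hA t k).
pose v n : L2Dt := \sum_(0 <= k < n) phi k x *: g k.
have vE n : green_psum lam phi alpha s t x n = v n.
  apply/funext => z; rewrite /v L2_sumE; apply: eq_bigr => k _.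
  rewrite -[RHS]/(phi k x * g k z) gE /modef /relax; ring.
have [hL hLE vh] := L2cvg_Dt_cvgL2 vE mh hh.
have := @cvgL2_Ktr _ H1 H2 t v hL m vh; rewrite hLE; apply: cvg_trans.
apply: near_eq_cvg; apply: nearW => n; rewrite KtrE /v ip_suml /kpsum.
by apply: eq_bigr => k _; rewrite ipZl -KtrE gE mulrC.
Qed.

Variable O : Omega -> L2D R.
Hypothesis hO : is_stoch_conv W lam phi alpha s t O.

Let good x := exists h, is_green lam phi alpha s t x h /\
  is_wiener_integral W t h (fun w => O w x).

(** The set of good points need not be measurable, so a measurable subset of full measure replaces
    it. *)
Lemma good_set : exists G : set (measurableTypeR R), [/\ measurable G, lebD R (~` G) = 0%E,
  G `<=` D & forall x, G x -> good x].
Proof.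
have [N [mN N0 gN]] := hO.2.
exists (D `\` N); split.
- by apply: measurableD => //; exact: measurable_D.
- apply/eqP; rewrite -measure_le0 -N0 /lebD /= /mrestr le_measure ?inE//.
  + by apply: measurableI; [apply: measurableC; apply: measurableD => //|]; exact: measurable_D.
  + by apply: measurableI => //; exact: measurable_D.
  + by move=> x [/= /not_andP[//|/contrapT]].
- by move=> x [].
- by move=> x [Dx Nx]; apply: contrapT => gx; apply: Nx; apply: gN.
Qed.

Section with_good_set.
Variable G : set (measurableTypeR R).
Hypotheses (mG : measurable G) (G0 : lebD R (~` G) = 0%E) (GD : G `<=` D).
Hypothesis Ggood : forall x, G x -> good x.

Definition fieldO (z : Omega * measurableTypeR R) : R := \1_G z.2 * O z.1 z.2.

(** The function h attached to x comes from an existence statement and says nothing about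
    measurability in x. A limit of explicit partial sums is a jointly measurable choice of its
    transform, and by [field_gram] it has the same Gram kernel as [fieldO]. *)
Definition fieldK (z : R2 * measurableTypeR R) : R := limn (fun n => \1_G z.2 * kpsum n z).

Lemma measurable_fieldO : measurable_fun setT fieldO.
Proof.
have mSD : measurable (setT `*` D : set (Omega * measurableTypeR R)).
  by apply: measurableX => //; exact: measurable_D.
have mO := (measurable_restrictT _ mSD).1 hO.1.
rewrite (_ : fieldO = (fun z => \1_G z.2 *
  ((fun z : Omega * measurableTypeR R => O z.1 z.2) \_ (setT `*` D)) z)).
  by apply: measurable_funM => //; apply: (measurableT_comp (measurable_indic mG)).
apply/funext => z; rewrite /fieldO patchE indicE.
have [|_] := boolP (z.2 \in G); last by rewrite !mul0r.
by rewrite inE => /GD zD; rewrite mem_set.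
Qed.

Lemma fieldK_cvg z : (fun n => \1_G z.2 * kpsum n z) @ \oo --> fieldK z.
Proof.
rewrite /fieldK; have [zG|zG] := pselect (G z.2); last first.
  rewrite indicE memNset// (_ : (fun n => _) = cst 0); last by apply/funext => n; rewrite mul0r.
  by rewrite lim_cst//; exact: cvg_cst.
have [h [hg _]] := Ggood zG.
have := @green_kpsum_cvg z.2 h z.1 hg; rewrite indicE mem_set//.
case: z zG hg => m x /= zG hg hc.
rewrite (_ : (fun n => _) = (fun n => kpsum n (m, x))); last by apply/funext => n; rewrite mul1r.
by rewrite (cvg_lim _ hc).
Qed.

Lemma fieldKE m x h : G x -> is_green lam phi alpha s t x h ->
  fieldK (m, x) = Ktr H1 H2 t (restrictDt t h) m.
Proof.
move=> Gx hg; have h1 := @fieldK_cvg (m, x).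
have h2 : (fun n => \1_G x * kpsum n (m, x)) @ \oo --> Ktr H1 H2 t (restrictDt t h) m.
  rewrite indicE mem_set//.
  rewrite (_ : (fun n => _) = (fun n => kpsum n (m, x))); last by apply/funext => n; rewrite mul1r.
  exact: green_kpsum_cvg.
by apply: (cvg_unique _ h1 h2).
Qed.

Lemma fieldK_notin m x : ~ G x -> fieldK (m, x) = 0.
Proof.
move=> Gx; have h1 := @fieldK_cvg (m, x).
have h2 : (fun n => \1_G x * kpsum n (m, x)) @ \oo --> (0 : R).
  rewrite indicE memNset// (_ : (fun n => _) = cst 0); first exact: cvg_cst.
  by apply/funext => n; rewrite mul0r.
by apply: (cvg_unique _ h1 h2).
Qed.

Lemma measurable_fieldK : measurable_fun setT fieldK.
Proof.
apply: (@measurable_fun_cvg _ _ _ _ (fun n z => \1_G z.2 * kpsum n z)); last first.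
  by move=> z _; exact: fieldK_cvg.
move=> n; apply: measurable_funM; last exact: measurable_kpsum.
by apply: (measurableT_comp (measurable_indic mG)).
Qed.

Lemma field_L2 x : exists (z : L2P) (a : L2M),
  (z : Omega -> R) = (fun w => fieldO (w, x)) /\ (a : R2 -> R) = (fun m => fieldK (m, x)).
Proof.
have [Gx|Gx] := pselect (G x).
  have [h [hg hw]] := Ggood Gx.
  have [_ [z [a [zE aE _ _]]]] := wiener_transform H1P H2P hW tT hg.1 hw.
  exists z, a; split.
    by rewrite zE; apply/funext => w; rewrite /fieldO/= indicE mem_set// mul1r.
  by rewrite aE; apply/funext => m; rewrite (fieldKE m Gx hg).
exists 0, 0; split; apply/funext => w.
  by rewrite /fieldO/= indicE memNset// mul0r.
by rewrite fieldK_notin.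
Qed.

Lemma field_gram x y :
  Rintegral P setT (fun w => fieldO (w, x) * fieldO (w, y)) =
  Rintegral LL setT (fun m => fieldK (m, x) * fieldK (m, y)).
Proof.
have [Gx|Gx] := pselect (G x); last first.
  transitivity (0 : R).
    rewrite (_ : (fun w => _) = cst 0) ?Rintegral_cst ?mul0r//.
    by apply/funext => w; rewrite /fieldO/= indicE memNset// !mul0r.
  rewrite (_ : (fun m => _) = cst 0); last by apply/funext => m; rewrite fieldK_notin// mul0r.
  by rewrite /Rintegral integral0.
have [Gy|Gy] := pselect (G y); last first.
  transitivity (0 : R).
    rewrite (_ : (fun w => _) = cst 0) ?Rintegral_cst ?mul0r//.
    by apply/funext => w; rewrite /fieldO/= [\1_G y]indicE memNset// mul0r mulr0.
  rewrite (_ : (fun m => _) = cst 0); last first.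
    by apply/funext => m; rewrite (fieldK_notin _ Gy) mulr0.
  by rewrite /Rintegral integral0.
have [h [hg hw]] := Ggood Gx; have [h' [hg' hw']] := Ggood Gy.
transitivity (Rintegral P setT (fun w => O w x * O w y)).
  by apply: eq_Rintegral => w _; rewrite /fieldO/= !indicE !mem_set// !mul1r.
rewrite (wiener_gram H1P H2P hW tT hg.1 hw hg'.1 hw').
by apply: eq_Rintegral => m _; rewrite (fieldKE m Gx hg) (fieldKE m Gy hg').
Qed.

Lemma field_sqr x : (\int[P]_w (fieldO (w, x) ^+ 2)%:E = \int[LL]_m (fieldK (m, x) ^+ 2)%:E)%E.
Proof.
have [z [a [zE aE]]] := field_L2 x.
transitivity ((nrm z ^+ 2)%:E); first by rewrite -integral_sq zE.
transitivity ((nrm a ^+ 2)%:E); last by rewrite -integral_sq aE.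
by rewrite -!ip_sq /ip zE aE field_gram.
Qed.

(* Fatou's lemma along the partial sums, whose increments have the squared
   norm of a block of the orthogonal series. *)
Lemma fieldK_tail n b : (forall n', (n <= n')%N -> \sum_(n <= k < n') V k <= b) ->
  (\int[LL]_m \int[lebDm]_x ((fieldK (m, x) - \1_G x * kpsum n (m, x)) ^+ 2)%:E <= b%:E)%E.
Proof.
move=> hb.
pose f n' z : R := (\1_G z.2 * kpsum n' z - \1_G z.2 * kpsum n z) ^+ 2.
have mGk n' : measurable_fun setT (fun z : R2 * measurableTypeR R => \1_G z.2 * kpsum n' z).
  apply: measurable_funM; last exact: measurable_kpsum.
  by apply: (measurableT_comp (measurable_indic mG)).
have mf n' : measurable_fun setT (f n').
  by apply: measurable_funX; apply: measurable_funB.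
have mg : measurable_fun setT (fun z => (fieldK z - \1_G z.2 * kpsum n z) ^+ 2).
  by apply: measurable_funX; apply: measurable_funB => //; exact: measurable_fieldK.
rewrite -[leLHS](@fubini_tonelli1 _ _ _ _ _ LL lebDm
  (fun z => ((fieldK z - \1_G z.2 * kpsum n z) ^+ 2)%:E)); last 2 first.
- exact/measurable_EFinP.
- by move=> z; rewrite lee_fin sqr_ge0.
apply: (@fatou_ae _ _ _ _ f) => //.
- by move=> n' z; exact: sqr_ge0.
- by move=> z; exact: sqr_ge0.
- apply: aeW => z; have hz := @fieldK_cvg z.
  have hd : (fun n' => \1_G z.2 * kpsum n' z - \1_G z.2 * kpsum n z) @ \oo -->
      fieldK z - \1_G z.2 * kpsum n z.
    by apply: cvgB => //; exact: cvg_cst.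
  exact: (cvgM hd hd).
- exists n => // n' /= nn'.
  rewrite fubini_tonelli1//; last 2 first.
  + exact/measurable_EFinP.
  + by move=> z; rewrite lee_fin sqr_ge0.
  apply: (@le_trans _ _ (\int[LL]_m (\sum_(n <= k < n') (mK k m ^+ 2)%:E))%E).
    apply: ge0_le_integral => //.
    * by move=> m _; apply: integral_ge0 => x _; rewrite lee_fin sqr_ge0.
    * apply: (@measurable_fun_fubini_tonelli_F _ _ _ _ _ lebDm (fun z => (f n' z)%:E)).
        exact/measurable_EFinP.
      by move=> z; rewrite lee_fin sqr_ge0.
    * by apply: emeasurable_sum => k; apply/measurable_EFinP; exact: measurable_funX.
    * move=> m _; rewrite /fubini_F/= sumEFin.
      rewrite -(opsumB_nrm hphi (fun k => mK k m) nn') -integral_sq.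
      apply: ge0_le_integral => //.
      - by move=> x _; rewrite lee_fin sqr_ge0.
      - by apply/measurable_EFinP; exact: (measurableT_comp (mf n') (measurable_pair1 m)).
      - by apply/measurable_EFinP; apply: measurable_funX; exact: L2_measurable.
      - move=> x _; rewrite lee_fin /f/= -mulrBr exprMn.
        rewrite [X in _ <= X ^+ 2](_ : _ = kpsum n' (m, x) - kpsum n (m, x)); last first.
          have E j : (opsum phi (fun k => mK k m) j : R -> R) x = kpsum j (m, x).
            by rewrite /opsum L2_sumE.
          by rewrite -!E.
        rewrite ler_piMl ?sqr_ge0// indicE; case: (_ \in _); rewrite ?expr1n// expr0n//=.
  rewrite ge0_integral_sum//; last 2 first.
  + by move=> k; apply/measurable_EFinP; exact: measurable_funX.
  + by move=> k m _; rewrite lee_fin sqr_ge0.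
  apply: (@le_trans _ _ (\sum_(n <= k < n') (V k)%:E)%E); first exact: lee_sum.
  by rewrite sumEFin lee_fin hb.
Qed.

Lemma fieldK_bound : (\int[LL]_m \int[lebDm]_x (fieldK (m, x) ^+ 2)%:E <= B%:E)%E.
Proof.
have := @fieldK_tail 0%N B (fun n _ => hB n); apply: le_trans.
rewrite le_eqVlt; apply/orP; left; apply/eqP.
apply: eq_integral => m _; apply: eq_integral => x _.
by rewrite /kpsum big_geq// mulr0 subr0.
Qed.

(** Exchanging the integrals reduces this to fixed x, where [field_sqr] passes to the transform
    side; a second exchange leads to [fieldK_bound]. *)
Lemma fieldO_bound : (\int[P]_w \int[lebDm]_x (fieldO (w, x) ^+ 2)%:E <= B%:E)%E.
Proof.
rewrite (@fubini_tonelli _ _ _ _ _ P lebDm (fun z => (fieldO z ^+ 2)%:E)); last 2 first.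
- by apply/measurable_EFinP; apply: measurable_funX; exact: measurable_fieldO.
- by move=> z; rewrite lee_fin sqr_ge0.
under eq_integral => x _ do rewrite field_sqr.
rewrite -(@fubini_tonelli _ _ _ _ _ LL lebDm (fun z => (fieldK z ^+ 2)%:E)); last 2 first.
- by apply/measurable_EFinP; apply: measurable_funX; exact: measurable_fieldK.
- by move=> z; rewrite lee_fin sqr_ge0.
exact: fieldK_bound.
Qed.

Let coefK k m : R := \int[lebDm]_x (phi k x * fieldK (m, x)).

Let mcoefK k : measurable_fun setT (coefK k).
Proof.
apply: (@measurable_parametrized_Rintegral _ _ R2 (measurableTypeR R) R lebDm
  (fun z => phi k z.2 * fieldK z)).
apply: measurable_funM; last exact: measurable_fieldK.
by apply: (measurableT_comp (L2_measurable (phi k))).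
Qed.

Let phi_nrm k : nrm (phi k) = 1.
Proof.
apply/eqP; rewrite -(@eqrXn2 _ 2) ?nrm_ge0//; apply/eqP.
by rewrite -ip_sq hphi eqxx expr1n.
Qed.

Let aeG : {ae lebD R, forall x, G x}.
Proof. by exists (~` G); split => //; exact: measurableC. Qed.

Let coefK_close k n m : (k < n)%N -> (((coefK k m - mK k m) ^+ 2)%:E <=
  \int[lebDm]_x ((fieldK (m, x) - \1_G x * kpsum n (m, x)) ^+ 2)%:E)%E.
Proof.
move=> kn; set I := (\int[lebDm]_x _)%E.
have mq : measurable_fun setT (fun x => fieldK (m, x) - \1_G x * kpsum n (m, x)).
  apply: measurable_funB.
    exact: (measurableT_comp measurable_fieldK (measurable_pair1 m)).
  apply: measurable_funM; first exact: (measurable_indic mG).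
  exact: (measurableT_comp (measurable_kpsum n) (measurable_pair1 m)).
have [->|Ioo] := eqVneq I +oo%E; first by rewrite leey.
have {}Ioo : (I < +oo)%E by rewrite ltey.
have [q qE] := @mkL2 _ _ _ lebDm _ mq Ioo.
pose S : LfunType lebDm (lee1n 2) := opsum phi (fun j => mK j m) n.
have SE x : S x = kpsum n (m, x) by rewrite /S /opsum L2_sumE.
have -> : coefK k m - mK k m = ip (phi k) q.
  have -> : mK k m = ip (phi k) S.
    by rewrite ipC [RHS](ip_opsum hphi) kn mul1r.
  have -> : coefK k m = ip (phi k) (q + S).
    rewrite /coefK /ip /Rintegral; congr fine; apply: ae_eq_integral => //.
    + apply/measurable_EFinP; apply: measurable_funM; first exact: L2_measurable.
      exact: (measurableT_comp measurable_fieldK (measurable_pair1 m)).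
    + by apply/measurable_EFinP; apply: measurable_funM; exact: L2_measurable.
    + apply: filterS aeG => x Gx _; congr (_ * _)%:E.
      rewrite -[RHS]/(q x + S x) qE SE indicE mem_set// mul1r subrK//.
  by rewrite ipDr addrK.
have IE : I = (nrm q ^+ 2)%:E by rewrite -integral_sq qE.
rewrite IE lee_fin -(real_normK (num_real (ip _ _))) ler_pXn2r ?nnegrE ?nrm_ge0//.
by rewrite (le_trans (ip_CS _ _))// phi_nrm mul1r.
Qed.

Let tail_small e : 0 < e -> exists n, forall n', (n <= n')%N -> forall n'', (n' <= n'')%N ->
  \sum_(n' <= k < n'') V k <= e.
Proof.
move=> e0.
have cV : cvgn (series V).
  apply: nondecreasing_is_cvgn; first by apply: nondecreasing_series.
  by exists B => _ [n _ <-]; exact: hB.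
have [n _ hn] := (@cvgrPdist_le _ _ _ _ _ _ _).1 cV e e0.
exists n => n' nn' n'' nn''.
have h := hn n' nn'; apply: le_trans h.
rewrite -(sub_series_geq _ nn'').
have : series V n'' <= limn (series V).
  by apply: nondecreasing_cvgn_le => //; apply: nondecreasing_series.
by move=> h; rewrite (le_trans _ (ler_norm _))// lerD2r.
Qed.

(** The coefficient [coefK k] equals [mK k] almost everywhere: for n > k the partial sum has
    coefficient [mK k], so their squared distance is bounded by every late tail of the series of
    V. *)
Lemma coefK_sqr k : (\int[LL]_m (coefK k m ^+ 2)%:E <= (V k)%:E)%E.
Proof.
have [v vE] := mKL k.
have mD : measurable_fun setT (fun m => coefK k m - mK k m) by apply: measurable_funB.
have I0 : (\int[LL]_m ((coefK k m - mK k m) ^+ 2)%:E <= 0)%E.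
  apply/lee_addgt0Pr => e e0; rewrite add0e.
  have [n hn] := tail_small e0.
  have := @fieldK_tail (maxn n k.+1) e (hn _ (leq_maxl _ _)); apply: le_trans.
  apply: ge0_le_integral => //.
  - by move=> m _; rewrite lee_fin sqr_ge0.
  - by apply/measurable_EFinP; exact: measurable_funX.
  - apply: (@measurable_fun_fubini_tonelli_F _ _ _ _ _ lebDm
      (fun z => ((fieldK z - \1_G z.2 * kpsum (maxn n k.+1) z) ^+ 2)%:E)).
      apply/measurable_EFinP; apply: measurable_funX; apply: measurable_funB.
        exact: measurable_fieldK.
      apply: measurable_funM; last exact: measurable_kpsum.
      by apply: (measurableT_comp (measurable_indic mG)).
    by move=> z; rewrite lee_fin sqr_ge0.
  - by move=> m _; apply: coefK_close; exact: leq_maxr.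
have [q qE] := @mkL2 _ _ _ LL _ mD (le_lt_trans I0 (ltry 0)).
have q0 : nrm q = 0.
  apply/eqP; rewrite -sqrf_eq0 eq_le sqr_ge0 andbT -lee_fin -integral_sq qE//.
have -> : (\int[LL]_m (coefK k m ^+ 2)%:E = (nrm (q + v) ^+ 2)%:E)%E.
  rewrite -integral_sq; apply: eq_integral => m _.
  by rewrite -[(q + v) m]/(q m + v m) qE vE subrK.
apply: le_trans (hV k); rewrite (_ : (\int[LL]_m (mK k m ^+ 2)%:E)%E = (nrm v ^+ 2)%:E); last first.
  by rewrite -integral_sq vE.
rewrite lee_fin ler_pXn2r ?nnegrE ?nrm_ge0//.
by rewrite (le_trans (nrmD _ _))// q0 add0r.
Qed.

Lemma inner_fieldO w k : inner (O w) (phi k) = \int[lebDm]_x (phi k x * fieldO (w, x)).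
Proof.
rewrite /inner /Rintegral; congr fine; apply: ae_eq_integral => //.
+ by apply/measurable_EFinP; apply: measurable_funM; exact: L2_measurable.
+ apply/measurable_EFinP; apply: measurable_funM; first exact: L2_measurable.
  exact: (measurableT_comp measurable_fieldO (measurable_pair1 w)).
+ apply: filterS aeG => x Gx _; rewrite /fieldO/= indicE mem_set// mul1r mulrC//.
Qed.

Lemma nrm_fieldO w : ((L2norm (O w) ^+ 2)%:E = \int[lebDm]_x (fieldO (w, x) ^+ 2)%:E)%E.
Proof.
rewrite -[L2norm _]/(nrm (O w)) -integral_sq; apply: ae_eq_integral => //.
+ by apply/measurable_EFinP; apply: measurable_funX; exact: L2_measurable.
+ apply/measurable_EFinP; apply: measurable_funX.
  exact: (measurableT_comp measurable_fieldO (measurable_pair1 w)).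
+ by apply: filterS aeG => x Gx _; rewrite /fieldO/= indicE mem_set// mul1r.
Qed.

(** The coefficient of O is not identified with a Wiener integral. By [twofold] and [field_gram] its
    second moment equals that of [coefK k], which is enough. *)
Lemma inner_O_sqr k : (\int[P]_w (inner (O w) (phi k) ^+ 2)%:E <= (V k)%:E)%E.
Proof.
apply: le_trans (coefK_sqr k).
under eq_integral do rewrite inner_fieldO.
have hZ := le_lt_trans fieldO_bound (ltry B).
have hZ' := le_lt_trans fieldK_bound (ltry B).
have -> := @twofold _ _ Omega (measurableTypeR R) R P lebDm (phi k) fieldO measurable_fieldO hZ.
have -> := @twofold _ _ R2 (measurableTypeR R) R LL lebDm (phi k) fieldK measurable_fieldK hZ'.
rewrite le_eqVlt; apply/orP; left; apply/eqP; apply: eq_integral => z _.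
have [z1 [a1 [z1E a1E]]] := field_L2 z.1; have [z2 [a2 [z2E a2E]]] := field_L2 z.2.
transitivity ((phi k z.1 * phi k z.2 * ip z1 z2)%:E).
  rewrite EFinM -integral_ip -integralZl//; last exact: ip_integrable.
  by apply: eq_integral => w _; rewrite z1E z2E -EFinM; congr EFin; ring.
transitivity ((phi k z.1 * phi k z.2 * ip a1 a2)%:E).
  by congr (_ * _)%:E; rewrite /ip z1E z2E a1E a2E field_gram.
rewrite EFinM -integral_ip -integralZl//; last exact: ip_integrable.
by apply: eq_integral => w _; rewrite a1E a2E -EFinM; congr EFin; ring.
Qed.

Lemma measurable_inner_O k : measurable_fun setT (fun w => inner (O w) (phi k)).
Proof.
under eq_fun do rewrite inner_fieldO.
apply: (@measurable_parametrized_Rintegral _ _ Omega (measurableTypeR R) R lebDm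
  (fun z => phi k z.2 * fieldO z)).
apply: measurable_funM; last exact: measurable_fieldO.
by apply: (measurableT_comp (L2_measurable (phi k))).
Qed.

Lemma measurable_nrm_O : measurable_fun setT (fun w => (L2norm (O w) ^+ 2)%:E).
Proof.
under eq_fun do rewrite nrm_fieldO.
apply: (@measurable_fun_fubini_tonelli_F _ _ _ _ _ lebDm (fun z => (fieldO z ^+ 2)%:E)).
  by apply/measurable_EFinP; apply: measurable_funX; exact: measurable_fieldO.
by move=> z; rewrite lee_fin sqr_ge0.
Qed.

End with_good_set.

Lemma stoch_conv_bounds :
  [/\ measurable_fun setT (fun w => (L2norm (O w) ^+ 2)%:E),
      forall k, measurable_fun setT (fun w => inner (O w) (phi k)),
      (\int[P]_w (L2norm (O w) ^+ 2)%:E <= B%:E)%E &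
      forall k, (\int[P]_w (inner (O w) (phi k) ^+ 2)%:E <= (V k)%:E)%E].
Proof.
have [G [mG G0 GD Ggood]] := good_set.
split.
- exact: (measurable_nrm_O mG G0 GD).
- exact: (measurable_inner_O mG G0 GD).
- under eq_integral do rewrite (nrm_fieldO mG G0 GD).
  by apply: fieldO_bound.
- by move=> k; apply: (inner_O_sqr mG G0 GD).
Qed.

End stochastic_convolution.

(** * The drift *)

Section lower_integral.
Context d (T : measurableType d) (R : realType) (mu : {measure set T -> \bar R}).

(* No measurability: the integral of a nonnegative function is defined as a
   supremum over simple functions below it. *)
Lemma ge0_le_integralT (f g : T -> \bar R) : (forall x, 0 <= f x)%E ->
  (forall x, f x <= g x)%E -> (\int[mu]_x f x <= \int[mu]_x g x)%E.
Proof.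
move=> f0 fg; have g0 x : (0 <= g x)%E by exact: le_trans (f0 x) (fg x).
rewrite !ge0_integralTE//; apply: le_ereal_sup => _ [h hf <-].
by exists h => // x; exact: le_trans (hf x) (fg x).
Qed.

Lemma ge0_le_integral_sub (A B : set T) (f g : T -> \bar R) : A `<=` B ->
  (forall x, A x -> 0 <= f x)%E -> (forall x, B x -> 0 <= g x)%E ->
  (forall x, A x -> f x <= g x)%E ->
  (\int[mu]_(x in A) f x <= \int[mu]_(x in B) g x)%E.
Proof.
move=> AB f0 g0 fg; rewrite integral_mkcond [leRHS]integral_mkcond.
apply: ge0_le_integralT => x; rewrite !patchE.
  by case: ifPn => // /set_mem; exact: f0.
case: ifPn => [/set_mem Ax|_]; first by rewrite mem_set ?fg//; exact: AB.
by case: ifPn => // /set_mem; exact: g0.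
Qed.

End lower_integral.

(** * Bounds on Bochner integrals by duality *)

Section bochner.
Context {R : realType}.
Notation mu := (@lebesgue_measure R).
Variables (E : set R) (F : R -> L2D R) (b : L2D R).
Hypothesis mE : measurable (E : set (measurableTypeR R)).
Hypothesis finE : (mu E < +oo)%E.
Hypothesis hb : is_bochner E F b.

Section test_vector.
Variable psi : L2D R.

Let sim_ip (g : L2simple R) r : R :=
  \sum_i (\1_(sim_set g i) r : R) * ip (sim_vec g i) psi.

Let sim_ipE (g : L2simple R) r : ip (sim_val g r) psi = sim_ip g r.
Proof. by rewrite ip_suml; apply: eq_bigr => i _; rewrite ipZl. Qed.

Let measurable_sim_ip (g : L2simple R) : measurable_fun setT (sim_ip g).
Proof.
apply: measurable_sum => i; apply: measurable_funM => //.
exact: (measurable_indic (sim_meas (l := g) i)).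
Qed.

Let mEi (g : L2simple R) i : (mu (sim_set g i `&` E) < +oo)%E.
Proof.
apply: le_lt_trans finE; apply: le_measure; rewrite ?inE//.
by apply: measurableI => //; exact: sim_meas.
Qed.

Let integrable_sim_i (g : L2simple R) i :
  mu.-integrable E (EFin \o (fun r => \1_(sim_set g i) r)).
Proof.
apply/integrableP; split.
  apply/measurable_EFinP; apply: measurable_funTS.
  exact: (measurable_indic (sim_meas (l := g) i)).
under eq_integral do rewrite gee0_abs ?lee_fin//.
by rewrite integral_indic//; [exact: mEi|exact: sim_meas].
Qed.

Let integrable_sim_iZ (g : L2simple R) i (c : R) :
  mu.-integrable E (fun r => (c * \1_(sim_set g i) r)%:E).
Proof.
have := integrableZl (mu := mu) mE c (@integrable_sim_i g i).
by apply: eq_integrable.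
Qed.

Let sim_ip_sum (g : L2simple R) r : (sim_ip g r)%:E =
  (\sum_i (ip (sim_vec g i) psi * \1_(sim_set g i) r)%:E)%E.
Proof. by rewrite sumEFin; congr EFin; apply: eq_bigr => i _; rewrite mulrC. Qed.

Let integrable_sim_ip (g : L2simple R) : mu.-integrable E (EFin \o sim_ip g).
Proof.
rewrite (_ : EFin \o sim_ip g = (fun r =>
  \sum_i (ip (sim_vec g i) psi * \1_(sim_set g i) r)%:E)%E); last first.
  by apply/funext => r; exact: sim_ip_sum.
by apply: integrable_sum => // i _; exact: integrable_sim_iZ.
Qed.

Let integral_sim_ip (g : L2simple R) :
  (ip (sim_int E g) psi)%:E = (\int[mu]_(r in E) (sim_ip g r)%:E)%E.
Proof.
under eq_integral do rewrite sim_ip_sum.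
rewrite integral_sum//.
rewrite ip_suml -sumEFin; apply: eq_bigr => i _.
rewrite ipZl; under eq_integral do rewrite EFinM.
rewrite (integralZl mE (@integrable_sim_i g i)) integral_indic//; last exact: sim_meas.
by rewrite EFinM fineK ?ge0_fin_numE// muleC.
Qed.

Lemma bochner_ip (q : R -> R) : measurable_fun setT q ->
  (forall r, E r -> `|ip (F r) psi| <= q r) ->
  (`|ip b psi|%:E <= \int[mu]_(r in E) (q r)%:E)%E.
Proof.
move=> mq Fq; have [g [_ gint gb]] := hb.
have q0 r : E r -> 0 <= q r by move=> Er; rewrite (le_trans _ (Fq r Er)).
pose x n r := Num.max (`|sim_ip (g n) r| - q r) 0.
have mx n : measurable_fun setT (x n).
  apply: measurable_maxr => //; apply: measurable_funB => //.
  exact: measurableT_comp.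
have x0 n r : 0 <= x n r by rewrite /x le_max lexx orbT.
pose y n := (\int[mu]_(r in E) (L2norm (sim_val (g n) r - F r))%:E)%E.
have bn n : (`|ip (sim_int E (g n)) psi|%:E <=
    \int[mu]_(r in E) (q r)%:E + (nrm psi)%:E * y n)%E.
  have -> : (`|ip (sim_int E (g n)) psi|%:E = `|\int[mu]_(r in E) (sim_ip (g n) r)%:E|)%E.
    by rewrite -integral_sim_ip.
  apply: le_trans (le_abse_integral _ mE _) _.
    by apply/measurable_EFinP; exact: measurable_funTS.
  apply: (@le_trans _ _ (\int[mu]_(r in E) ((q r)%:E + (x n r)%:E))%E).
    apply: ge0_le_integral => //.
    - by apply/measurable_EFinP; apply: measurableT_comp => //; exact: measurable_funTS.
    - apply/measurable_EFinP; apply: measurable_funD; exact: measurable_funTS.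
    - move=> r Er; rewrite -EFinD lee_fin -lerBlDl /x le_max.
      by rewrite lexx.
  rewrite ge0_integralD//; last 3 first.
  - by apply/measurable_EFinP; exact: measurable_funTS.
  - by move=> r Er; rewrite lee_fin.
  - by apply/measurable_EFinP; exact: measurable_funTS.
  rewrite leeD2l//.
  have [psi0|psi0] := eqVneq (nrm psi) 0.
    rewrite psi0 mul0e integral0_eq// => r Er; congr EFin.
    apply/eqP; rewrite eq_le x0 andbT /x ge_max lexx andbT subr_le0.
    by rewrite -sim_ipE ipC nrm0_ip// normr0 q0.
  have psi_gt0 : 0 < nrm psi by rewrite lt_neqAle eq_sym psi0 nrm_ge0.
  (* The error inside y n may fail to be measurable, so the factor [nrm psi] is taken out of the
     integral of x n instead; this is why [nrm psi] = 0 was treated apart. *)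
  have -> : (\int[mu]_(r in E) (x n r)%:E =
      (nrm psi)%:E * \int[mu]_(r in E) ((nrm psi)^-1 * x n r)%:E)%E.
    rewrite -ge0_integralZl//; last 3 first.
    - by apply/measurable_EFinP; apply: measurable_funM => //; exact: measurable_funTS.
    - by move=> r _; rewrite lee_fin mulr_ge0// invr_ge0 nrm_ge0.
    - by rewrite lee_fin nrm_ge0.
    by apply: eq_integral => r _; rewrite -EFinM mulrA divff// mul1r.
  rewrite lee_wpmul2l ?lee_fin ?nrm_ge0//.
  apply: ge0_le_integral_sub => //.
  - by move=> r _; rewrite lee_fin mulr_ge0// invr_ge0 nrm_ge0.
  - by move=> r _; rewrite lee_fin; exact: nrm_ge0.
  - move=> r Er; rewrite lee_fin mulrC ler_pdivrMr// /x ge_max mulr_ge0 ?nrm_ge0// andbT.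
    have h1 := ip_CS (sim_val (g n) r - F r) psi.
    have h2 := Fq r Er; rewrite -sim_ipE.
    have h3 := ler_normD (ip (sim_val (g n) r - F r) psi) (ip (F r) psi).
    rewrite ipBl subrK in h3; rewrite ipBl in h1.
    by move: h1 h2 h3; rewrite -/(nrm _) /L2norm /nrm; lra.
have cy : (fun n => \int[mu]_(r in E) (q r)%:E + (nrm psi)%:E * y n)%E @ \oo -->
    (\int[mu]_(r in E) (q r)%:E)%E.
  rewrite -[X in _ --> X]adde0; apply: cvgeD => //.
  - by rewrite fin_num_adde_defl.
  - exact: cvg_cst.
  - rewrite -(mule0 (nrm psi)%:E); apply: cvgeMl => //.
have cb : (fun n => `|ip (sim_int E (g n)) psi|%:E)%E @ \oo --> `|ip b psi|%:E.
  apply: cvg_EFin; first exact: nearW.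
  apply: cvg_norm; exact: (cvgL2_ipl gb).
rewrite -(cvg_lim _ cb)// -(cvg_lim _ cy)//.
by apply: lee_lim; [apply/cvg_ex; eexists; exact: cb|apply/cvg_ex; eexists; exact: cy|exact: nearW].
Qed.

End test_vector.

Lemma bochner_nrm (q : R -> R) : measurable_fun setT q ->
  (forall r, E r -> nrm (F r) <= q r) ->
  ((nrm b)%:E <= \int[mu]_(r in E) (q r)%:E)%E.
Proof.
move=> mq Fq.
have q0 r : E r -> 0 <= q r by move=> Er; rewrite (le_trans _ (Fq r Er))// nrm_ge0.
have [b0|b0] := eqVneq (nrm b) 0.
  by rewrite b0; apply: integral_ge0 => r Er; rewrite lee_fin q0.
have b_gt0 : 0 < nrm b by rewrite lt_neqAle eq_sym b0 nrm_ge0.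
have := @bochner_ip ((nrm b)^-1 *: b) q mq.
rewrite ipZr ip_sq normrM ger0_norm ?invr_ge0 ?nrm_ge0// ger0_norm ?sqr_ge0//.
rewrite expr2 mulrA mulVf// mul1r; apply=> r Er.
apply: le_trans (Fq r Er); apply: le_trans (ip_CS _ _) _.
by rewrite nrmZ ger0_norm ?invr_ge0 ?nrm_ge0// mulVf// mulr1.
Qed.

End bochner.

Section cauchy_schwarz.
Context d (T : measurableType d) (R : realType) (mu : {measure set T -> \bar R}).

Lemma integral_CS (E : set T) (a b : T -> R) (A B : R) : measurable E ->
  measurable_fun setT a -> measurable_fun setT b ->
  (\int[mu]_(x in E) (a x ^+ 2)%:E <= A%:E)%E ->
  (\int[mu]_(x in E) (b x ^+ 2)%:E <= B%:E)%E ->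
  (\int[mu]_(x in E) (a x * b x)%:E <= (Num.sqrt A * Num.sqrt B)%:E)%E.
Proof.
move=> mE ma mb.
have toE (h : T -> R) : measurable_fun setT h ->
    (\int[mu]_(x in E) (h x)%:E = \int[mrestr mu mE]_x (h x)%:E)%E.
  by move=> mh; rewrite integral_mrestr//; exact/measurable_EFinP.
have ma2 : measurable_fun setT (fun x => a x ^+ 2) by exact: measurable_funX.
have mb2 : measurable_fun setT (fun x => b x ^+ 2) by exact: measurable_funX.
have mab : measurable_fun setT (fun x => a x * b x) by exact: measurable_funM.
rewrite !toE// => hA hB.
have [va vaE] := mkL2 ma (le_lt_trans hA (ltry _)).
have [vb vbE] := mkL2 mb (le_lt_trans hB (ltry _)).
rewrite -vaE -vbE in hA hB *; rewrite integral_ip lee_fin.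
rewrite !integral_sq !lee_fin in hA hB.
apply: le_trans (ler_norm _) _; apply: le_trans (ip_CS _ _) _.
apply: ler_pM; rewrite ?nrm_ge0//.
  by rewrite -[leLHS]ger0_norm ?nrm_ge0// -sqrtr_sqr ler_wsqrtr.
by rewrite -[leLHS]ger0_norm ?nrm_ge0// -sqrtr_sqr ler_wsqrtr.
Qed.

End cauchy_schwarz.

Section orthonormal_CS.
Context d (T : measurableType d) (R : realType) (mu : {measure set T -> \bar R}).
Variable phi : nat -> LfunType mu (lee1n 2).
Hypothesis hphi : forall j k, ip (phi j) (phi k) = (j == k)%:R.

(** Cauchy-Schwarz for finite sequences, read off from [ip_CS] in the span of the orthonormal
    sequence. *)
Lemma sum_CS (x y : nat -> R) n : `|\sum_(0 <= k < n) x k * y k| <=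
  Num.sqrt (\sum_(0 <= k < n) x k ^+ 2) * Num.sqrt (\sum_(0 <= k < n) y k ^+ 2).
Proof.
rewrite -!(opsum_nrm hphi) !sqrtr_sqr !(ger0_norm (nrm_ge0 _)).
apply: le_trans (ip_CS _ _); rewrite {2}/opsum ip_sumr.
rewrite [X in _ <= `|X|](_ : _ = \sum_(0 <= k < n) x k * y k)//.
apply: eq_big_nat => k /andP[_ kn].
by rewrite ipZr ip_opsum// kn mul1r mulrC.
Qed.

End orthonormal_CS.

Section bochner_weighted.
Context {R : realType}.
Notation mu := (@lebesgue_measure R).
Variables (E : set R) (F : R -> L2D R) (b : L2D R) (phi : nat -> L2D R).
Hypothesis mE : measurable (E : set (measurableTypeR R)).
Hypothesis finE : (mu E < +oo)%E.
Hypothesis hb : is_bochner E F b.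
Hypothesis hphi : forall j k, inner (phi j) (phi k) = (j == k)%:R.

(* Tested against psi = sum_(k < n) c_k^2 (b, phi_k) phi_k. *)
Lemma bochner_weighted (c : nat -> R) (q : R -> R) (Q : R) n :
  measurable_fun setT q -> (forall r, E r -> 0 <= q r) ->
  (forall r, E r -> \sum_(0 <= k < n) (c k * inner (F r) (phi k)) ^+ 2 <= q r ^+ 2) ->
  (\int[mu]_(r in E) (q r)%:E <= Q%:E)%E ->
  \sum_(0 <= k < n) (c k * inner b (phi k)) ^+ 2 <= Q ^+ 2.
Proof.
move=> mq q0 Fq hQ.
have hphi' : forall j k, ip (phi j) (phi k) = (j == k)%:R := hphi.
have Q0 : 0 <= Q.
  by rewrite -lee_fin; apply: le_trans hQ; apply: integral_ge0 => r Er; rewrite lee_fin q0.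
set S := \sum_(0 <= k < n) _.
have S0 : 0 <= S by apply: sumr_ge0 => k _; exact: sqr_ge0.
pose a k := c k * (c k * inner b (phi k)).
have ipa v : ip v (opsum phi a n) =
    \sum_(0 <= k < n) (c k * inner v (phi k)) * (c k * inner b (phi k)).
  by rewrite /opsum ip_sumr; apply: eq_bigr => k _; rewrite ipZr /a /inner /ip; ring.
have ipb : ip b (opsum phi a n) = S.
  by rewrite ipa; apply: eq_bigr => k _; rewrite expr2.
have h r : E r -> `|ip (F r) (opsum phi a n)| <= q r * Num.sqrt S.
  move=> Er; rewrite ipa; apply: le_trans (sum_CS hphi' _ _ _) _.
  rewrite ler_wpM2r ?sqrtr_ge0//.
  by rewrite -[leRHS]ger0_norm ?q0// -sqrtr_sqr ler_wsqrtr// Fq.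
have := bochner_ip mE finE hb (psi := opsum phi a n) (q := fun r => q r * Num.sqrt S).
rewrite ipb ger0_norm//.
move=> /(_ (measurable_funM mq (measurable_cst _))) /(_ h).
under eq_integral do rewrite mulrC EFinM.
rewrite ge0_integralZl//; last first.
  by apply/measurable_EFinP; exact: measurable_funTS.
move=> hS.
have {}hS : S <= Num.sqrt S * Q.
  by rewrite -lee_fin; apply: le_trans hS _; rewrite EFinM lee_wpmul2l// lee_fin sqrtr_ge0.
have sS := sqr_sqrtr S0; have sS0 := sqrtr_ge0 S.
move: hS sS sS0; move: (Num.sqrt S) => z hS sS z0; rewrite -sS in hS *.
rewrite ler_sqr ?nnegrE//.
have [->//|zn] := eqVneq z 0.
by move: hS; rewrite expr2 ler_pM2l// lt_neqAle eq_sym zn.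
Qed.

End bochner_weighted.

(** * Pathwise estimates of the drift *)

Section drift.
Context {R : realType}.
Notation mu := (@lebesgue_measure R).
Variables (alpha s T Cf : R).
Hypotheses (alpha01 : 0 < alpha < 1) (T0 : 0 <= T) (Cf0 : 0 <= Cf).
Variables (lam : nat -> R) (phi : nat -> L2D R).
Hypothesis hA : dirichlet_eigensystem lam phi.
Variable f : L2D R -> L2D R.
Hypothesis hf : forall v, L2norm (f v) <= Cf * (1 + L2norm v).
Variables (t : R) (v : R -> L2D R) (nv : R -> R) (Phi : R).
Hypotheses (t0 : 0 <= t <= T) (mnv : measurable_fun setT nv).
Hypothesis vE : forall r, 0 <= r <= T -> L2norm (v r) = nv r.
Hypothesis hPhi : (\int[mu]_(r in `]0%R, t[) ((1 + nv r) ^+ 2)%:E <= Phi%:E)%E.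
Variable b : L2D R.
Hypothesis hb :
  is_bochner `]0, t[ (fun r => sol_op lam phi alpha s (t - r) (f (v r))) b.

Let hphi := eigensystem_orthonormal hA.

Let Et (r : R) : `]0, t[%classic r -> [/\ 0 < r, 0 < t - r & 0 <= r <= T].
Proof.
rewrite /= in_itv/= => /andP[r0 rt]; rewrite subr_gt0; split=> //.
by rewrite (ltW r0)/= (le_trans (ltW rt))//; case/andP : t0.
Qed.

Let mE : measurable (`]0, t[%classic : set (measurableTypeR R)).
Proof. exact: measurable_itv. Qed.

Let muE : mu `]0%R, t[%classic = t%:E.
Proof.
rewrite lebesgue_measure_itv/= lte_fin; case/andP : t0 => h _.
by case: (ltgtP 0 t) h => // [_|<-] _; rewrite ?oppr0 ?adde0.
Qed.

Let finE : (mu `]0%R, t[%classic < +oo)%E.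
Proof. by rewrite muE ltry. Qed.

Let relax1 r k : `|relax alpha s lam k r| <= 1.
Proof. by rewrite ger0_norm ?relax_ge0// relax_le1. Qed.

Let fnv r : `]0, t[%classic r -> 0 <= 1 + nv r /\ L2norm (f (v r)) <= Cf * (1 + nv r).
Proof.
move=> /Et[_ _ rT]; rewrite -vE//; split; last exact: hf.
by rewrite addr_ge0//; exact: nrm_ge0.
Qed.

Let Phi0 : 0 <= Phi.
Proof.
rewrite -lee_fin; apply: le_trans hPhi; apply: integral_ge0 => r _.
by rewrite lee_fin sqr_ge0.
Qed.

(** The solution operator is a contraction because the relaxation lies in [0, 1]; Cauchy-Schwarz in
    time then brings in Phi, the quantity that is finite along almost every path. *)
Lemma drift_nrm : L2norm b ^+ 2 <= Cf ^+ 2 * T * Phi.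
Proof.
have mn : measurable_fun setT (fun r => 1 + nv r) by exact: measurable_funD.
have /= h1 := bochner_nrm mE finE hb (q := fun r => Cf * (1 + nv r))
  (measurable_funM (measurable_cst _) mn).
have /h1 h2 : forall r, `]0, t[%classic r ->
    nrm (sol_op lam phi alpha s (t - r) (f (v r))) <= Cf * (1 + nv r).
  move=> r Er; apply: le_trans (fnv Er).2.
  exact: (spectral_bounded hphi _ (relax1 (t - r))).1.
have h3 : (\int[mu]_(r in `]0%R, t[) ((cst Cf r) ^+ 2)%:E <= (Cf ^+ 2 * T)%:E)%E.
  have -> : (\int[mu]_(r in `]0%R, t[) ((cst Cf r) ^+ 2)%:E = (Cf ^+ 2 * t)%:E)%E.
    by rewrite EFinM -muE; exact: (integral_cst mu mE (Cf ^+ 2)%:E).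
  by rewrite lee_fin ler_wpM2l ?sqr_ge0//; case/andP : t0.
have := integral_CS mE (measurable_cst Cf) mn h3 hPhi.
move=> /(le_trans h2); rewrite lee_fin => h.
rewrite -[leRHS](sqr_sqrtr (mulr_ge0 (mulr_ge0 (sqr_ge0 Cf) T0) Phi0)).
rewrite ler_sqr ?nnegrE ?nrm_ge0 ?sqrtr_ge0// sqrtrM// mulr_ge0 ?sqr_ge0//.
Qed.

(** Cauchy-Schwarz in time, now with the singular kernel (t - r)^(-p) against 1 + nv: 2 p < 1 is the
    square integrability of that kernel, and its squared norm is the factor T^(1 - 2 p) / (1 - 2
    p). *)
Lemma drift_weighted (c : nat -> R) K p n : 0 <= K -> 2 * p < 1 ->
  (forall k x, 0 < x -> `|c k * relax alpha s lam k x| <= K * x `^ (- p)) ->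
  \sum_(0 <= k < n) (c k * inner b (phi k)) ^+ 2 <=
    (K * Cf) ^+ 2 * (T `^ (1 - 2 * p) / (1 - 2 * p)) * Phi.
Proof.
move=> K0 p1 hc; have pp : 0 < 1 - 2 * p by rewrite subr_gt0.
pose w r : R := K * Cf * (t - r) `^ (- p).
have mn : measurable_fun setT (fun r => 1 + nv r) by exact: measurable_funD.
have mw : measurable_fun setT w.
  apply: measurable_funM => //; apply: (measurableT_comp (measurable_powR (- p))).
  exact: measurable_funB.
have w0 r : 0 <= w r by rewrite !mulr_ge0// powR_ge0.
set A := _ * (_ / _).
have A0 : 0 <= A by rewrite mulr_ge0 ?sqr_ge0// divr_ge0 ?powR_ge0// ltW.
have hw : (\int[mu]_(r in `]0%R, t[) (w r ^+ 2)%:E <= A%:E)%E.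
  pose h x : R := (K * Cf * x `^ (- p)) ^+ 2.
  have mh : measurable_fun setT h.
    by apply: measurable_funX; apply: measurable_funM => //; exact: measurable_powR.
  rewrite (ge0_integral_reflect_itv t mh); last by move=> x; exact: sqr_ge0.
  apply: (@le_trans _ _ (\int[mu]_(x in `]0%R, t[) (((K * Cf) ^+ 2)%:E * (x `^ (- (2 * p)))%:E))%E).
    apply: ge0_le_integral => //.
    - by move=> x _; rewrite lee_fin sqr_ge0.
    - by apply/measurable_EFinP; exact: measurable_funTS.
    - apply/measurable_EFinP; apply: measurable_funM => //.
      by apply: measurable_funTS; exact: measurable_powR.
    - move=> x; rewrite /= in_itv/= => /andP[x0 _]; rewrite lee_fin /h exprMn.
      by rewrite -(powR_mulrn 2 (powR_ge0 _ _)) -powRrM (_ : - p * 2 = - (2 * p))//; ring.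
  rewrite ge0_integralZl//; last 3 first.
  - by apply/measurable_EFinP; apply: measurable_funTS; exact: measurable_powR.
  - by move=> x _; rewrite lee_fin powR_ge0.
  - by rewrite lee_fin sqr_ge0.
  rewrite /A [leRHS]EFinM; apply: lee_wpmul2l; first by rewrite lee_fin sqr_ge0.
  have p1' : -1 < - (2 * p) by lra.
  case/andP : t0 => t00 tT.
  apply: le_trans (integral_powR_0 p1' t00) _; rewrite (addrC (- _)) lee_fin.
  by rewrite ler_pM2r ?invr_gt0// ge0_ler_powR ?nnegrE// ltW.
rewrite -(sqr_sqrtr (mulr_ge0 A0 Phi0)) sqrtrM//.
apply: (@bochner_weighted _ _ _ _ phi mE finE hb hphi c (fun r => w r * (1 + nv r))).
- exact: measurable_funM.
- by move=> r Er; rewrite mulr_ge0//; exact: (fnv Er).1.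
- move=> r Er; have [r0 tr _] := Et Er; have [n0 hn] := fnv Er.
  have hk k : inner (sol_op lam phi alpha s (t - r) (f (v r))) (phi k) =
      relax alpha s lam k (t - r) * inner (f (v r)) (phi k).
    exact: (spectral_bounded hphi _ (relax1 (t - r))).2.
  apply: (@le_trans _ _ ((K * (t - r) `^ (- p)) ^+ 2 * L2norm (f (v r)) ^+ 2)).
    apply: le_trans (ler_wpM2l (sqr_ge0 _) (bessel hphi (f (v r)) n)).
    rewrite mulr_sumr; apply: ler_sum => k _; rewrite hk mulrA exprMn.
    rewrite ler_wpM2r ?sqr_ge0// -[leLHS]real_normK ?num_real//.
    by rewrite ler_sqr ?nnegrE ?mulr_ge0 ?powR_ge0// hc.
  rewrite (_ : w r * (1 + nv r) = (K * (t - r) `^ (- p)) * (Cf * (1 + nv r))); last by rewrite /w; ring.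
  rewrite [leRHS]exprMn ler_wpM2l ?sqr_ge0// ler_sqr ?nnegrE ?nrm_ge0// mulr_ge0//.
- exact: integral_CS.
Qed.

End drift.

(** * Moments and regularity of the mild solution *)

Section gronwall.
Context {R : realType}.
Notation mu := (@lebesgue_measure R).

Lemma integral_expR_le (c t S : R) : 0 < c -> 0 <= t -> 0 <= S ->
  (\int[mu]_(r in `]0%R, t[) (S * expR (c * r))%:E <= (S / c * expR (c * t))%:E)%E.
Proof.
move=> c0 t0 S0.
have ce : continuous (fun r : R => S * expR (c * r)).
  move=> x; apply: cvgMr; apply: (@continuous_comp _ _ _ (fun r => c * r) expR).
    by apply: cvgMr; exact: cvg_id.
  exact: continuous_expR.
have dF (x : R) : is_derive x 1 (fun r => S / c * expR (c * r)) (S * expR (c * x)).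
  have h1 : is_derive x 1 (fun r => c * r) c.
    by have := is_deriveZ c (is_derive_id x (1 : R)); rewrite /GRing.scale/= mulr1.
  have h2 := is_derive1_comp (is_derive_expR (c * x)) h1.
  have h3 := is_deriveZ (S / c) h2.
  apply: is_derive_eq; rewrite /GRing.scale/=; field; exact: lt0r_neq0.
rewrite (RintegralE (measurable_itv _ : measurable (`]0, t[%classic : set (measurableTypeR R))) (continuous_integrable_itv 0 t ce)).
rewrite (Rintegral_FTC t0 ce dF) lee_fin gerBl.
by rewrite mulr_ge0 ?expR_ge0// divr_ge0// ltW.
Qed.

(** Weighted supremum: with S the supremum of g r e^(-2 K r), the integral term contributes at most
    S / 2, so S <= 2 a. The a priori bound B makes S finite, and no continuity of g is involved. *)
Lemma gronwall (g : R -> R) (a B K T : R) : 0 < K -> 0 <= a ->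
  measurable_fun setT g -> (forall t, 0 <= t <= T -> 0 <= g t <= B) ->
  (forall t, 0 <= t <= T ->
    ((g t)%:E <= a%:E + K%:E * \int[mu]_(r in `]0%R, t[) (g r)%:E)%E) ->
  forall t, 0 <= t <= T -> g t <= 2 * a * expR (2 * K * T).
Proof.
move=> K0 a0 mg gB hg t tT.
have K2 : 0 < 2 * K by rewrite mulr_gt0.
pose X := [set g r * expR (- (2 * K * r)) | r in [set r | 0 <= r <= T]].
have ubX : ubound X B.
  move=> _ [r /= rT <-]; have /andP[g0 gb] := gB r rT.
  apply: le_trans gb; rewrite ler_piMr// -[leRHS]expR0 ler_expR oppr_le0.
  by rewrite mulr_ge0 ?(ltW K2)//; case/andP : rT.
have X0 : X !=set0 by exists (g t * expR (- (2 * K * t))); exists t.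
have supX : has_sup X by split=> //; exists B.
pose S := sup X.
have SX r : 0 <= r <= T -> g r * expR (- (2 * K * r)) <= S.
  by move=> rT; apply: ub_le_sup; [exists B|exists r].
have gS r : 0 <= r <= T -> g r <= S * expR (2 * K * r).
  move=> /SX; rewrite expRN ler_pdivrMr// expR_gt0//.
have S0 : 0 <= S.
  by apply: le_trans (SX t tT); rewrite mulr_ge0 ?expR_ge0//; case/andP : (gB t tT).
have Sa : S <= a + S / 2.
  apply: ge_sup => // _ [r /= rT <-]; have /andP[r0 rT'] := rT.
  have h : g r <= a + S / 2 * expR (2 * K * r).
    rewrite -lee_fin; apply: le_trans (hg r rT) _; rewrite EFinD; apply: leeD2l.
    apply: (@le_trans _ _ (K%:E * (S / (2 * K) * expR (2 * K * r))%:E)%E).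
      apply: lee_wpmul2l; first by rewrite lee_fin ltW.
      apply: le_trans (integral_expR_le K2 r0 S0).
      apply: ge0_le_integral => //.
      - move=> x; rewrite /= in_itv/= => /andP[x0 xr]; rewrite lee_fin.
        have : 0 <= x <= T by rewrite (ltW x0) (le_trans (ltW xr)).
        by move=> /gB/andP[].
      - by apply/measurable_EFinP; exact: measurable_funTS.
      - apply/measurable_EFinP; apply: measurable_funTS; apply: measurable_funM => //.
        by apply: (measurableT_comp (@measurable_expR R)); exact: measurable_funM.
      - move=> x; rewrite /= in_itv/= => /andP[x0 xr]; rewrite lee_fin.
        by apply: gS; rewrite (ltW x0) (le_trans (ltW xr)).
    rewrite -EFinM lee_fin (_ : K * _ = S / 2 * expR (2 * K * r))//.
    by field; exact: lt0r_neq0.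
  rewrite expRN ler_pdivrMr ?expR_gt0// mulrDl; apply: (le_trans h).
  rewrite lerD2r ler_peMr// -[leLHS]expR0 ler_expR mulr_ge0// ltW//.
apply: le_trans (gS t tT) _; apply: ler_pM; rewrite ?expR_ge0//; first by lra.
by rewrite ler_expR ler_wpM2l ?(ltW K2)//; case/andP : tT.
Qed.

End gronwall.

Section stochastic_gronwall.
Context {R : realType} d (Omega : measurableType d) (P : probability Omega R).
Notation mu := (@lebesgue_measure R).
Variables (Y : measurableTypeR R * Omega -> R) (T K z : R).
Hypotheses (K0 : 0 < K) (z0 : 0 <= z).
Hypothesis mY : measurable_fun setT Y.
Hypothesis Y0 : forall p, 0 <= Y p.
Hypothesis finY : {ae P, forall w, (\int[mu]_(r in `]0%R, T[) (Y (r, w))%:E < +oo)%E}.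
Hypothesis stepY : forall t, 0 <= t <= T -> exists2 Z : Omega -> \bar R,
  [/\ measurable_fun setT Z, forall w, (0 <= Z w)%E & (\int[P]_w Z w <= z%:E)%E] &
  {ae P, forall w, forall F : R, (\int[mu]_(r in `]0%R, t[) (Y (r, w))%:E <= F%:E)%E ->
    ((Y (t, w))%:E <= K%:E * F%:E + Z w)%E}.

Let mI (t : R) : measurable_fun setT (fun p : measurableTypeR R * Omega => \1_(`]0, t[%classic) p.1 * Y p).
Proof.
apply: measurable_funM => //.
exact: (measurableT_comp (measurable_indic
  (measurable_itv _ : measurable (`]0, t[%classic : set (measurableTypeR R)))) measurable_fst).
Qed.

Let Phi (t : R) w : \bar R := (\int[mu]_(r in `]0%R, t[) (Y (r, w))%:E)%E.

Let PhiE t w : Phi t w = (\int[mu]_r (\1_(`]0, t[%classic) r * Y (r, w))%:E)%E.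
Proof. by rewrite /Phi (integral_indic_mul mu `]0%R, t[%classic). Qed.

Let mPhi t : measurable_fun setT (Phi t).
Proof.
rewrite (_ : Phi t = fun w => (\int[mu]_r (\1_(`]0, t[%classic) r * Y (r, w))%:E)%E).
  apply: (@measurable_fun_fubini_tonelli_G _ _ _ _ _ mu
    (fun p : measurableTypeR R * Omega => (\1_(`]0, t[%classic) p.1 * Y p)%:E)).
    by apply/measurable_EFinP; exact: mI.
  by move=> p; rewrite lee_fin mulr_ge0.
by apply/funext => w; exact: PhiE.
Qed.

Let A (n : nat) := [set w | (Phi T w <= n%:R%:E)%E].

Let mA n : measurable (A n).
Proof. by rewrite -[A n]setTI; exact: emeasurable_fun_infty_c. Qed.

Let mYt t : measurable_fun setT (fun w => Y (t, w)).
Proof. exact: (measurableT_comp mY (measurable_pair1 t)). Qed.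

Let G n t : \bar R := (\int[P]_w (\1_(A n) w * Y (t, w))%:E)%E.

Let mAY n : measurable_fun setT (fun p : measurableTypeR R * Omega => \1_(A n) p.2 * Y p).
Proof.
apply: measurable_funM => //.
exact: (measurableT_comp (measurable_indic (mA n)) measurable_snd).
Qed.

Let mG n : measurable_fun setT (G n).
Proof.
apply: (@measurable_fun_fubini_tonelli_F _ _ _ _ _ P
  (fun p : measurableTypeR R * Omega => (\1_(A n) p.2 * Y p)%:E)).
  by apply/measurable_EFinP; exact: mAY.
by move=> p; rewrite lee_fin mulr_ge0.
Qed.

Let G0 n t : (0 <= G n t)%E.
Proof. by apply: integral_ge0 => w _; rewrite lee_fin mulr_ge0. Qed.

Let Phi_mono t w : t <= T -> (Phi t w <= Phi T w)%E.
Proof.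
move=> tT; apply: ge0_subset_integral => //.
- apply/measurable_EFinP; apply: measurable_funTS.
  exact: (measurableT_comp mY (measurable_pair2 w)).
- by move=> r _; rewrite lee_fin.
- by move=> r; rewrite /= !in_itv/= => /andP[-> rt]; exact: lt_le_trans tT.
Qed.

Let Gstep n t : 0 <= t <= T ->
  (G n t <= z%:E + K%:E * \int[mu]_(r in `]0%R, t[) G n r)%E.
Proof.
move=> tT; have [Z [mZ Z0 hZ] hY] := stepY tT.
have -> : (\int[mu]_(r in `]0%R, t[) G n r = \int[P]_w ((\1_(A n) w)%:E * Phi t w))%E.
  rewrite (_ : (\int[mu]_(r in `]0%R, t[) G n r)%E =
    (\int[mu]_r \int[P]_w (\1_(`]0, t[%classic) r * (\1_(A n) w * Y (r, w)))%:E)%E); last first.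
    rewrite integral_mkcond; apply: eq_integral => r _.
    rewrite patchE indicE; case: ifP => rt.
      by apply: eq_integral => w _; rewrite mul1r.
    by rewrite integral0_eq// => w _; rewrite mul0r.
  rewrite (@fubini_tonelli _ _ _ _ _ mu P (fun p : measurableTypeR R * Omega =>
     (\1_(`]0, t[%classic) p.1 * (\1_(A n) p.2 * Y p))%:E)); last 2 first.
  - apply/measurable_EFinP.
    rewrite (_ : (fun p => _) = (fun p => \1_(A n) p.2 * (\1_(`]0, t[%classic) p.1 * Y p))).
      apply: measurable_funM; last exact: mI.
      exact: (measurableT_comp (measurable_indic (mA n)) measurable_snd).
    by apply/funext => p; ring.
  - by move=> p; rewrite lee_fin !mulr_ge0.
  apply: eq_integral => w _; rewrite PhiE -ge0_integralZl//.
  - by apply: eq_integral => r _; rewrite -EFinM; congr EFin; ring.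
  - apply/measurable_EFinP.
    exact: (measurableT_comp (mI t) (measurable_pair2 w)).
  - by move=> r _; rewrite lee_fin mulr_ge0.
apply: (@le_trans _ _ (\int[P]_w (Z w + K%:E * ((\1_(A n) w)%:E * Phi t w)))%E); last first.
  rewrite ge0_integralD//; last 2 first.
  - move=> w _; rewrite mule_ge0 ?lee_fin ?(ltW K0)// mule_ge0 ?lee_fin//.
    by apply: integral_ge0 => r _; rewrite lee_fin.
  - apply: measurable_funeM; apply: emeasurable_funM => //.
    by apply/measurable_EFinP; exact: measurable_indic.
  rewrite ge0_integralZl//; last 3 first.
  - apply: emeasurable_funM => //.
    by apply/measurable_EFinP; exact: measurable_indic.
  - by move=> w _; rewrite mule_ge0 ?lee_fin//; apply: integral_ge0 => r _; rewrite lee_fin.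
  - by rewrite lee_fin ltW.
  exact: leeD2r.
apply: ae_ge0_le_integral => //.
- by move=> w _; rewrite lee_fin mulr_ge0.
- by apply/measurable_EFinP; apply: measurable_funM => //; exact: measurable_indic.
- move=> w _; rewrite adde_ge0// mule_ge0 ?lee_fin ?(ltW K0)// mule_ge0 ?lee_fin//.
  by apply: integral_ge0 => r _; rewrite lee_fin.
- apply: emeasurable_funD => //; apply: measurable_funeM; apply: emeasurable_funM => //.
  by apply/measurable_EFinP; exact: measurable_indic.
- apply: filterS hY => w hw _; rewrite indicE; have [Aw|Aw] := boolP (w \in A n).
    rewrite mul1r mul1e.
    have Pf : Phi t w \is a fin_num.
      rewrite ge0_fin_numE; last by apply: integral_ge0 => r _; rewrite lee_fin.
      apply: le_lt_trans (ltry n%:R); move/set_mem : Aw; apply: le_trans.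
      by apply: Phi_mono; case/andP : tT.
    by have := hw (fine (Phi t w)); rewrite fineK// addeC; apply.
  by rewrite mul0r mul0e mule0 adde0.
Qed.

(** On A n the hypothesis with F = n gives G n <= z + K n, the a priori bound that [gronwall] asks
    for. The bound it returns is free of n, and since almost every w belongs to all A n from some n
    on, Fatou's lemma removes the cutoff. *)
Lemma stochastic_gronwall : forall t, 0 <= t <= T ->
  (\int[P]_w (Y (t, w))%:E <= (2 * z * expR (2 * K * T))%:E)%E.
Proof.
move=> t tT.
have GB n r : 0 <= r <= T -> (G n r <= (z + K * n%:R)%:E)%E.
  move=> rT; have [Z [mZ Z0 hZ] hY] := stepY rT.
  apply: (@le_trans _ _ (\int[P]_w (Z w + (K * n%:R)%:E))%E).
    apply: ae_ge0_le_integral => //.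
    - by move=> w _; rewrite lee_fin mulr_ge0.
    - by apply/measurable_EFinP; apply: measurable_funM => //; exact: measurable_indic.
    - by move=> w _; rewrite adde_ge0// lee_fin mulr_ge0// ltW.
    - exact: emeasurable_funD.
    - apply: filterS hY => w hw _; rewrite indicE; have [Aw|Aw] := boolP (w \in A n).
        rewrite mul1r addeC EFinM; apply: hw; move/set_mem : Aw; apply: le_trans.
        by apply: Phi_mono; case/andP : rT.
      by rewrite mul0r adde_ge0// lee_fin mulr_ge0// ltW.
  rewrite ge0_integralD//; last by move=> w _; rewrite lee_fin mulr_ge0// ltW.
  rewrite (integral_cst P measurableT (K * n%:R)%:E).
  rewrite (_ : ((K * n%:R)%:E * _)%E = (K * n%:R)%:E).
    by rewrite EFinD leeD2r.
  by rewrite -[RHS]mule1; congr (_ * _)%E; exact: probability_setT.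
have Gfin n r : 0 <= r <= T -> G n r \is a fin_num.
  by move=> rT; rewrite ge0_fin_numE// (le_lt_trans (GB n r rT))// ltry.
have key n : (G n t <= (2 * z * expR (2 * K * T))%:E)%E.
  rewrite -(fineK (Gfin n t tT)) lee_fin.
  apply: (@gronwall _ (fun r => fine (G n r)) z (z + K * n%:R) K T) => //.
  - by apply: (measurableT_comp (f := fine)) => //; exact: mG.
  - move=> r rT; rewrite -!lee_fin fineK ?Gfin// G0/=; exact: GB.
  - move=> r rT; rewrite fineK ?Gfin//; apply: le_trans (Gstep n rT) _.
    apply: leeD2l; apply: lee_wpmul2l; first by rewrite lee_fin ltW.
    rewrite le_eqVlt; apply/orP; left; apply/eqP; apply: eq_integral => x.
    rewrite inE /= in_itv/= => /andP[x0 xr]; rewrite fineK// Gfin//.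
    by rewrite (ltW x0)/= (le_trans (ltW xr))//; case/andP : rT.
apply: (@fatou_ae _ _ _ P (fun n w => \1_(A n) w * Y (t, w))) => //.
- by move=> n; apply: measurable_funM => //; exact: measurable_indic.
- by move=> n w; rewrite mulr_ge0.
- apply: filterS finY => w hw.
  have Pf : Phi T w \is a fin_num.
    by rewrite ge0_fin_numE//; apply: integral_ge0 => r _; rewrite lee_fin.
  apply: cvg_near_cst; have [N hN] : exists N : nat, fine (Phi T w) <= N%:R.
    by exists (Num.truncn (fine (Phi T w))).+1; rewrite ltW// truncnS_gt.
  exists N => // n /= Nn; rewrite indicE mem_set ?mul1r//= /A/=.
  by rewrite -(fineK Pf) lee_fin (le_trans hN)// ler_nat.
- exact: nearW.
Qed.

End stochastic_gronwall.

Section norm_measurable.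
Context {R : realType} d (Omega : measurableType d).
Variables (T : R) (u : R -> Omega -> L2D R).
Hypothesis mu_u : measurable_fun
    (`[0, T] `*` setT `*` D :
      set (measurableTypeR R * Omega * measurableTypeR R)%type)
    (fun z : measurableTypeR R * Omega * measurableTypeR R => u z.1.1 z.1.2 z.2).

(** The field is jointly measurable only over [0, T] and D. Extending it by 0 gives a norm
    measurable on the whole product, which agrees with the true one for times in [0, T]. *)
Lemma measurable_L2norm : exists2 n : measurableTypeR R * Omega -> R,
  measurable_fun setT n & forall r w, 0 <= r <= T -> L2norm (u r w) = n (r, w).
Proof.
pose B : set (measurableTypeR R * Omega * measurableTypeR R) := `[0, T] `*` setT `*` D.
have mB : measurable B.
  apply: measurableX; last exact: measurable_D.
  by apply: measurableX => //; exact: measurable_itv.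
pose F := (fun z : measurableTypeR R * Omega * measurableTypeR R =>
  u z.1.1 z.1.2 z.2) \_ B.
have mF : measurable_fun setT F by apply/(measurable_restrictT _ mB).
pose h z := (\int[lebDm]_x (F (z, x) ^+ 2)%:E)%E.
have mh : measurable_fun setT h.
  apply: (@measurable_fun_fubini_tonelli_F _ _ _ _ _ (lebDm) (fun z => (F z ^+ 2)%:E)).
    by apply/measurable_EFinP; exact: measurable_funX.
  by move=> z; rewrite lee_fin sqr_ge0.
exists (fun z => Num.sqrt (fine (h z))).
  apply: (measurableT_comp (continuous_measurable_fun (@sqrt_continuous R))).
  by apply: (measurableT_comp (f := fine)).
move=> r w rT.
suff -> : h (r, w) = (L2norm (u r w) ^+ 2)%:E.
  by rewrite /= sqrtr_sqr ger0_norm//; exact: nrm_ge0.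
rewrite -[RHS](integral_sq (u r w)) /h.
rewrite -[LHS]/(\int[lebD R]_x (F ((r, w), x) ^+ 2)%:E)%E.
rewrite /lebD !ge0_integral_mrestr//.
- apply: eq_integral => x; rewrite inE => Dx.
  by rewrite /F patchE mem_set//; split => //=; split => //=; rewrite in_itv.
- by apply/measurable_EFinP; apply: measurable_funX; exact: L2_measurable.
- by move=> x; rewrite lee_fin sqr_ge0.
- apply/measurable_EFinP; apply: measurable_funX.
  exact: (measurableT_comp mF (measurable_pair1 (r, w))).
- by move=> x; rewrite lee_fin sqr_ge0.
Qed.

End norm_measurable.

Section ae_majorant.
Context d (T : measurableType d) (R : realType) (mu : {measure set T -> \bar R}).

(* [f] need not be measurable: the majorant is raised to +oo on a null set. *)
Lemma ae_ge0_le_integralT (f g : T -> \bar R) : measurable_fun setT g ->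
  (forall x, 0 <= f x)%E -> (forall x, 0 <= g x)%E ->
  {ae mu, forall x, (f x <= g x)%E} -> (\int[mu]_x f x <= \int[mu]_x g x)%E.
Proof.
move=> mg f0 g0 [N [mN N0 hN]].
pose h x := (g x + +oo * (\1_N x)%:E)%E.
have mh : measurable_fun setT h.
  apply: emeasurable_funD => //; apply: measurable_funeM; apply/measurable_EFinP.
  exact: measurable_indic.
apply: (@le_trans _ _ (\int[mu]_x h x)%E).
  apply: ge0_le_integralT => // x; rewrite /h indicE.
  have [xN|xN] := boolP (x \in N).
    by rewrite mule1 addey ?leey//; apply: contraTneq (g0 x) => ->.
  rewrite mule0 adde0; apply: contrapT => fg; move/negP : xN; apply.
  by rewrite inE; exact: hN.
rewrite le_eqVlt; apply/orP; left; apply/eqP; apply: ae_eq_integral => //.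
exists N; split => // x /= h1; apply: contrapT => xN; apply: h1 => _.
by rewrite /h indicE memNset// mule0 adde0.
Qed.

End ae_majorant.

(** * Summability over the spectrum and choice of the decay exponent *)

Section pseries.
Context {R : realType}.

Lemma pseries_bound (p : R) : p < -1 -> forall n : nat,
  \sum_(0 <= k < n) k.+1%:R `^ p <= 1 - (p + 1)^-1.
Proof.
move=> p1; have pp : p + 1 < 0 by rewrite -ltrBrDr sub0r.
have step (k : nat) : k.+2%:R `^ p <= (k.+2%:R `^ (p + 1) - k.+1%:R `^ (p + 1)) / (p + 1) :> R.
  have k1 : k.+1%:R < k.+2%:R :> R by rewrite ltr_nat.
  rewrite -lee_fin -integral_powR_itv ?lt_eqF//.
  have mE : measurable (`[k.+1%:R, k.+2%:R]%classic : set (measurableTypeR R)).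
    exact: measurable_itv.
  have -> : ((k.+2%:R `^ p)%:E =
      \int[@lebesgue_measure R]_(x in `[k.+1%:R, k.+2%:R]) (k.+2%:R `^ p)%:E)%E.
    rewrite (integral_cst _ mE) [X in (_ * X)%E](_ : _ = 1%E) ?mule1//.
    rewrite [LHS](@lebesgue_measure_itv R `[k.+1%:R, k.+2%:R])/= lte_fin k1 -EFinB.
    by rewrite -(natrB _ (leqnSn _)) subSnn.
  apply: ge0_le_integral => //.
  - by apply/measurable_EFinP; apply: measurable_funTS; exact: measurable_powR.
  - move=> x; rewrite /= in_itv/= => /andP[x1 x2].
    have x0 : 0 < x by rewrite (lt_le_trans _ x1).
    rewrite lee_fin -(opprK p) !(powRN _ (- p)) lef_pV2 ?posrE ?powR_gt0//.
    by rewrite ge0_ler_powR ?nnegrE// ?(ltW x0)//; lra.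
(* Keeping the last term, which is nonpositive since p + 1 < 0, makes the integral comparison
   telescope; it is dropped at the end. *)
have H n : \sum_(0 <= k < n.+1) k.+1%:R `^ p <= 1 - (p + 1)^-1 + n.+1%:R `^ (p + 1) / (p + 1).
  elim: n => [|n IH]; first by rewrite big_nat1 !powR1 div1r subrK.
  rewrite big_nat_recr//=; apply: le_trans (lerD IH (step n)) _.
  by rewrite mulrBl addrACA subrr addr0 ?addrA; lra.
move=> [|n].
  by rewrite big_geq// addr_ge0// -invrN invr_ge0 oppr_ge0 ltW.
apply: le_trans (H n) _; rewrite gerDl pmulr_rle0 ?powR_gt0// invr_le0 ltW//.
Qed.

Variables (lam : nat -> R) (phi : nat -> L2D R).
Hypothesis hA : dirichlet_eigensystem lam phi.

Lemma lam_series_bound (e : R) : e < - (1 / 2) -> exists2 B, 0 <= B &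
  forall n, \sum_(0 <= k < n) lam k `^ e <= B.
Proof.
move=> e1; have e2 : 2 * e < -1 by lra.
exists (1 - (2 * e + 1)^-1).
  by have := pseries_bound e2 0; rewrite big_geq.
move=> n; apply: le_trans (pseries_bound e2 n); apply: ler_sum => k _.
have -> : k.+1%:R `^ (2 * e) = (k.+1%:R ^+ 2) `^ e :> R by rewrite powRrM powR_mulrn.
have en : e = - (- e) by rewrite opprK.
rewrite en !(powRN _ (- e)) lef_pV2 ?posrE ?powR_gt0 ?exprn_gt0//; last exact: lam_gt0 hA _.
rewrite ge0_ler_powR ?nnegrE//; first by lra.
- by rewrite ltW// (lam_gt0 hA).
- exact: lam_ge hA k.
Qed.

(** The last inequality means g > L. The first entry of the minimum says L < H2 / alpha, the second
    L < 1. If H2 / alpha > 1, g = 1 works; otherwise the midpoint of L and H2 / alpha does, and it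
    is at most 1. *)
Lemma exists_decay_exponent (alpha s H1 H2 sigma : R) :
  0 < alpha -> 0 < s -> 0 < H1 <= 1 / 2 -> 0 < H2 ->
  0 <= 2 * sigma < Num.min (2 * s * H2 / alpha + H1 - 1) (H1 + 2 * s - 1) ->
  exists g, [/\ 0 <= g <= 1, alpha * g < H2 & 2 * sigma < H1 - 1 + 2 * s * g].
Proof.
move=> a0 s0 /andP[H10 H12] H20 /andP[sg0]; rewrite lt_min => /andP[h1 h2].
have [c|c] := ltP 1 (H2 / alpha).
  exists 1; rewrite ler01 lexx mulr1; split=> //; last by lra.
  by move: c; rewrite ltr_pdivlMr// mul1r.
pose L := (2 * sigma + 1 - H1) / (2 * s).
have s2 : 0 < 2 * s by lra.
have L0 : 0 < L by rewrite divr_gt0//; lra.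
have LH : L < H2 / alpha.
  rewrite ltr_pdivrMr//; have -> : H2 / alpha * (2 * s) = 2 * s * H2 / alpha by ring.
  by lra.
exists ((L + H2 / alpha) / 2); split.
- by apply/andP; split; lra.
- by rewrite mulrC -ltr_pdivlMr//; lra.
- have : L * (2 * s) < (L + H2 / alpha) / 2 * (2 * s) by rewrite ltr_pM2r//; lra.
  rewrite {1}/L mulfVK ?lt0r_neq0// => h.
  by rewrite (mulrC (2 * s)); lra.
Qed.

End pseries.

(** * Second moment and spatial regularity of the mild solution *)

Section mild.
Context {R : realType} d (Omega : measurableType d) (P : probability Omega R).
Notation mu := (@lebesgue_measure R).
Variables (alpha s H1 H2 T Cf : R).
Hypotheses (halpha : 0 < alpha < 1) (hs : 0 < s < 1).
Hypotheses (hH1 : 0 < H1 <= 1 / 2) (hH2 : 0 < H2 <= 1 / 2) (hT : 0 < T).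
Variables (lam : nat -> R) (phi : nat -> L2D R).
Hypothesis hA : dirichlet_eigensystem lam phi.
Variable W : R -> R -> {RV P >-> R}.
Hypothesis hW : fractional_brownian_sheet P H1 H2 T W.
Variables (f : L2D R -> L2D R) (u : R -> Omega -> L2D R).
Hypothesis Cf0 : 0 < Cf.
Hypothesis hf : forall v, L2norm (f v) <= Cf * (1 + L2norm v).
Hypothesis hu : mild_solution P W lam phi alpha s T f u.

Let T0 := ltW hT.
Let hphi := eigensystem_orthonormal hA.

Section majorants.
Variables (gam C : R).
Hypotheses (gam01 : 0 <= gam <= 1) (agam : alpha * gam < H2) (C0 : 0 <= C).
Let V k := C * lam k `^ (1 / 2 - H1 - 2 * s * gam).
Hypothesis hV : forall k t, 0 <= t <= T ->
  (\int[lebLL R]_m (modeK alpha s H1 H2 lam phi t k m ^+ 2)%:E <= (V k)%:E)%E.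
Variable B : R.
Hypothesis hB : forall n, \sum_(0 <= k < n) V k <= B.
Variable n : measurableTypeR R * Omega -> R.
Hypothesis mn : measurable_fun setT n.
Hypothesis nE : forall r w, 0 <= r <= T -> L2norm (u r w) = n (r, w).

Let Y p := (1 + n p) ^+ 2.

Let mY : measurable_fun setT Y.
Proof. by apply: measurable_funX; exact: measurable_funD. Qed.

Let Y0 p : 0 <= Y p. Proof. exact: sqr_ge0. Qed.

Let mnw w : measurable_fun setT (fun r => n (r, w)).
Proof. exact: (measurableT_comp mn (measurable_pair2 w)). Qed.

Let finY : {ae P, forall w, (\int[mu]_(r in `]0%R, T[) (Y (r, w))%:E < +oo)%E}.
Proof.
apply: filterS (mild_integrable hu) => w hw.
have mE : measurable (`]0, T[%classic : set (measurableTypeR R)) by exact: measurable_itv.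
apply: (@le_lt_trans _ _ (\int[mu]_(r in `]0%R, T[) (2%:E + 2%:E * (n (r, w) ^+ 2)%:E))%E).
  apply: ge0_le_integral => //.
  - by move=> r _; rewrite lee_fin.
  - apply/measurable_EFinP; apply: measurable_funTS.
    exact: (measurableT_comp mY (measurable_pair2 w)).
  - apply/measurable_EFinP; apply: measurable_funD => //; apply: measurable_funM => //.
    by apply: measurable_funTS; apply: measurable_funX.
  - move=> r _; rewrite -EFinM -EFinD lee_fin /Y.
    by have := sqr_ge0 (1 - n (r, w)); rewrite !expr2; lra.
rewrite ge0_integralD//; last 2 first.
- by move=> r _; rewrite -EFinM lee_fin mulr_ge0// sqr_ge0.
- apply/measurable_EFinP; apply: measurable_funM => //.
  by apply: measurable_funTS; apply: measurable_funX.
rewrite ge0_integralZl//; last 2 first.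
- by apply/measurable_EFinP; apply: measurable_funTS; apply: measurable_funX.
- by move=> r _; rewrite lee_fin sqr_ge0.
rewrite (integral_cst mu mE 2%:E) lte_add_pinfty//.
  rewrite lte_mul_pinfty// [X in (X < _)%E](@lebesgue_measure_itv R `]0, T[)/=.
  by case: ifP => // _; rewrite -EFinB ltry.
rewrite lte_mul_pinfty//; apply: le_lt_trans hw.
apply: ge0_le_integral_sub.
- by apply: subset_itv; rewrite bnd_simp.
- by move=> r _; rewrite lee_fin sqr_ge0.
- by move=> r _; rewrite lee_fin sqr_ge0.
- move=> r; rewrite /= in_itv/= => /andP[r0 rT]; rewrite nE// (ltW r0) ltW//.
Qed.

Let decomposition t w (b : L2D R) (X : Omega -> L2D R) :
  {ae lebD R, forall x, u t w x = b x + X w x} -> nrm (u t w - (b + X w)) = 0.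
Proof. by move=> h; apply: nrm_ae_eq. Qed.

Lemma mild_moment : exists2 M, 0 <= M & forall t, 0 <= t <= T ->
  (\int[P]_w (Y (t, w))%:E <= M%:E)%E.
Proof.
have B0 : 0 <= B by have := hB 0; rewrite big_geq.
(* From (1 + y + o)^2 <= 3 + 3 y^2 + 3 o^2, with y the norm of the drift, bounded by [drift_nrm],
   and o that of the stochastic convolution, whose second moment is at most B. *)
pose K := 3 * (Cf ^+ 2 * T); pose z := 3 + 3 * B.
have K0 : 0 < K by rewrite !mulr_gt0// exprn_gt0.
have z0 : 0 <= z by rewrite addr_ge0// mulr_ge0.
exists (2 * z * expR (2 * K * T)).
  by rewrite mulr_ge0 ?expR_ge0// mulr_ge0.
apply: (stochastic_gronwall K0 z0 mY Y0 finY) => t tT.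
have [X hX hb] := mild_eq hu tT.
have [mO _ OB _] := stoch_conv_bounds halpha hH1 hH2 hA hW tT (fun k => hV k tT) hB hX.
exists (fun w => 3%:E + 3%:E * (L2norm (X w) ^+ 2)%:E)%E.
  split.
  - by apply: emeasurable_funD => //; apply: measurable_funeM.
  - by move=> w; rewrite -EFinM lee_fin addr_ge0// mulr_ge0// sqr_ge0.
  - rewrite ge0_integralD//; last 2 first.
    + by move=> w _; rewrite -EFinM lee_fin mulr_ge0// sqr_ge0.
    + exact: measurable_funeM.
    rewrite ge0_integralZl//; last by move=> w _; rewrite lee_fin sqr_ge0.
    rewrite (integral_cst P measurableT 3%:E) [X in (X + _)%E](_ : _ = 3%:E); last first.
      by rewrite -[RHS]mule1; congr (_ * _)%E; exact: probability_setT.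
    by rewrite /z [leRHS]EFinD leeD2l// [leRHS]EFinM lee_wpmul2l.
apply: filterS hb => w [b hb hbO] F hF.
rewrite -EFinM -EFinM -!EFinD lee_fin /Y.
have := @drift_nrm _ alpha s T Cf halpha T0 lam phi hA f hf t (u ^~ w)
  (fun r => n (r, w)) F tT (mnw w) (fun r => @nE r w) hF b hb.
have hn : n (t, w) <= L2norm b + L2norm (X w).
  rewrite -nE//; have := nrm_triangle (u t w) (b + X w) 0.
  rewrite decomposition// !subr0 add0r => h; apply: le_trans h _; exact: nrmD.
have n0 : 0 <= n (t, w) by rewrite -nE//; exact: nrm_ge0.
have b0 : 0 <= L2norm b by exact: nrm_ge0.
have O0 : 0 <= L2norm (X w) by exact: nrm_ge0.
move: hn n0 b0 O0; move: (n _) (L2norm b) (L2norm (X w)) => x y o hx x0 y0 o0 hy.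
apply: (@le_trans _ _ ((1 + (y + o)) ^+ 2)).
  by rewrite ler_sqr ?nnegrE ?addr_ge0// lerD2l.
have h1 := sqr_ge0 (1 - y); have h2 := sqr_ge0 (1 - o); have h3 := sqr_ge0 (y - o).
rewrite /K; move: hy h1 h2 h3; rewrite !expr2; nra.
Qed.

Lemma mild_regularity (sigma : R) : 0 <= sigma -> 2 * sigma < H1 - 1 + 2 * s * gam ->
  exists C' : R, forall t : R, 0 <= t <= T ->
      {ae P, forall w, dom_Apow lam phi sigma (u t w)} /\
      ('E_P[fun w => (L2norm (Apow lam phi sigma (u t w)) ^+ 2)%R] <= C'%:E)%E.
Proof.
move=> sg0 hsg; have [M M0 hM] := mild_moment.
have /andP[a0 a1] := halpha; have /andP[s0 s1] := hs; have /andP[g0 g1] := gam01.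
have /andP[H10 H12] := hH1; have /andP[H20 H22] := hH2.
(* Because H1 <= 1/2, the hypothesis on sigma even leaves room: 2 sigma < 2 s gam - 1/2. So the
   decay of the relaxation beats lam^sigma in the drift. *)
have sgs : sigma <= s * gam by lra.
(* alpha gam < H2 <= 1/2: the drift kernel (t - r)^(-alpha gam) is square integrable, as
   [drift_weighted] requires. *)
have p1 : 2 * (alpha * gam) < 1.
  by have ag := agam; lra.
have [B' B'0 hB'] : exists2 B', 0 <= B' &
    forall m, \sum_(0 <= k < m) lam k `^ (2 * sigma) * V k <= B'.
  (* This is a restatement of 2 sigma < H1 - 1 + 2 s gam; -1/2 is the threshold of summability
     because lam k >= (k + 1)^2. *)
  have e : 2 * sigma + (1 / 2 - H1 - 2 * s * gam) < - (1 / 2) by lra.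
  have [B1 B10 hB1] := lam_series_bound hA e.
  exists (C * B1) => [|m]; first exact: mulr_ge0.
  apply: le_trans (ler_wpM2l C0 (hB1 m)); rewrite mulr_sumr; apply: ler_sum => k _.
  by rewrite (powRDp _ _ (lam_gt0 hA k)) mulrCA.
pose A := ((gJ alpha + 1) * Cf) ^+ 2 * (T `^ (1 - 2 * (alpha * gam)) / (1 - 2 * (alpha * gam))).
have A0 : 0 <= A by rewrite mulr_ge0 ?sqr_ge0// divr_ge0 ?powR_ge0//; lra.
have gJ0 : 0 <= gJ alpha + 1 by rewrite addr_ge0// ltW// gJ_gt0// ltW.
have lam1 k : 1 <= lam k by apply: le_trans (lam_ge hA k); rewrite expr_ge1// ler1n.
(* All eigenvalues are at least 1, so lam^(sigma - s gam) <= 1 and the bound is uniform in k. *)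
have hdecay k x : 0 < x -> `|lam k `^ sigma * relax alpha s lam k x| <=
    (gJ alpha + 1) * x `^ (- (alpha * gam)).
  move=> x0; rewrite ger0_norm; last by rewrite mulr_ge0 ?powR_ge0// relax_ge0.
  apply: le_trans (ler_wpM2l (powR_ge0 _ _) (relax_bound s halpha hA k gam01 x0)) _.
  rewrite -(mulrA (_ + 1)) mulrCA ler_wpM2l// mulrA ler_piMl ?powR_ge0//.
  rewrite -powRD ?lt0r_neq0 ?implybT ?(lam_gt0 hA)//.
  rewrite -[leRHS](powRr0 (lam k)) ler_powR//; lra.
exists (2 * (A * (T * M)) + 2 * B') => t tT.
have [X hX hb] := mild_eq hu tT.
have [_ mO _ OV] := stoch_conv_bounds halpha hH1 hH2 hA hW tT (fun k => hV k tT) hB hX.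
pose Phi w := (\int[mu]_(r in `]0%R, T[) (Y (r, w))%:E)%E.
pose zk k w := ((lam k `^ sigma * inner (X w) (phi k)) ^+ 2)%:E.
have zk0 k w : (0 <= zk k w)%E by rewrite lee_fin sqr_ge0.
have mzk k : measurable_fun setT (zk k).
  by apply/measurable_EFinP; apply: measurable_funX; exact: measurable_funM.
pose Z w := (\sum_(0 <= k <oo) zk k w)%E.
have Z0 w : (0 <= Z w)%E by exact: nneseries_ge0.
have mZ : measurable_fun setT Z by exact: ge0_emeasurable_sum.
have Phi0 w : (0 <= Phi w)%E by apply: integral_ge0 => r _; rewrite lee_fin.
have intZ : (\int[P]_w Z w <= B'%:E)%E.
  rewrite integral_nneseries//; apply: lime_le.
    by apply: is_cvg_nneseries => k _ _; exact: integral_ge0.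
  apply: nearW => m; apply: le_trans (_ : (\sum_(0 <= k < m) lam k `^ (2 * sigma) * V k)%:E <= _)%E; last first.
    by rewrite lee_fin.
  rewrite -sumEFin; apply: lee_sum => k _.
  rewrite /zk; under eq_integral do rewrite exprMn EFinM.
  rewrite ge0_integralZl//; last 3 first.
  - by apply/measurable_EFinP; exact: measurable_funX.
  - by move=> w _; rewrite lee_fin sqr_ge0.
  - by rewrite lee_fin sqr_ge0.
  rewrite -(powR_mulrn 2 (powR_ge0 _ _)) -powRrM (mulrC sigma) [leRHS]EFinM.
  by apply: lee_wpmul2l; [rewrite lee_fin powR_ge0|exact: OV].
pose f1 (p : measurableTypeR R * Omega) := (\1_(`]0, T[%classic) p.1 * Y p)%:E.
have mf1 : measurable_fun setT f1.
  apply/measurable_EFinP; apply: measurable_funM => //.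
  exact: (measurableT_comp (measurable_indic
    (measurable_itv _ : measurable (`]0, T[%classic : set (measurableTypeR R)))) measurable_fst).
have f10 p : (0 <= f1 p)%E by rewrite lee_fin mulr_ge0.
have PhiE : Phi = fun w => (\int[mu]_r f1 (r, w))%E.
  by apply/funext => w; rewrite /Phi (integral_indic_mul mu `]0%R, T[%classic).
have mPhi : measurable_fun setT Phi.
  by rewrite PhiE; exact: (@measurable_fun_fubini_tonelli_G _ _ _ _ _ mu f1).
have intPhi : (\int[P]_w Phi w <= (T * M)%:E)%E.
  rewrite PhiE -(@fubini_tonelli _ _ _ _ _ mu P f1)//.
  apply: (@le_trans _ _ (\int[mu]_(r in `]0%R, T[) M%:E)%E).
    rewrite [leRHS]integral_mkcond; apply: ge0_le_integralT.
      by move=> r; exact: integral_ge0.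
    move=> r; rewrite patchE /f1/= indicE; case: ifPn => rT.
      under eq_integral do rewrite mul1r; apply: hM.
      by move/set_mem : rT; rewrite /= in_itv/= => /andP[/ltW-> /ltW->].
    by rewrite integral0_eq// => w _; rewrite mul0r.
  have mE : measurable (`]0, T[%classic : set (measurableTypeR R)) by exact: measurable_itv.
  rewrite (integral_cst mu mE M%:E) [X in (_ * X)%E](_ : _ = T%:E).
    by rewrite -EFinM lee_fin mulrC.
  by rewrite [LHS](@lebesgue_measure_itv R `]0, T[)/= lte_fin hT oppr0 adde0.
have finPhi : {ae P, forall w, (Phi w < +oo)%E} := finY.
have finZ : {ae P, forall w, (Z w < +oo)%E}.
  have iZ : P.-integrable setT Z.
    apply/integrableP; split => //; under eq_integral do rewrite gee0_abs//.
    exact: le_lt_trans intZ (ltry _).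
  have := integrable_ae measurableT iZ; apply: filterS => w /(_ Logic.I).
  by rewrite ge0_fin_numE.
(* Where Phi and Z are finite, the weighted coefficients of u t w are square summable with an
   explicit bound. [spectral_series_summable] then gives the domain and the norm estimate at once;
   the factors 2 come from (x + y)^2 <= 2 x^2 + 2 y^2. *)
have key : {ae P, forall w, dom_Apow lam phi sigma (u t w) /\
    ((L2norm (Apow lam phi sigma (u t w)) ^+ 2)%:E <=
      2%:E * (A%:E * Phi w) + 2%:E * Z w)%E}.
  apply: filterS3 finPhi finZ hb => w Phif Zf [b hb hbO].
  have {}Phif : Phi w \is a fin_num by rewrite ge0_fin_numE.
  have {}Zf : Z w \is a fin_num by rewrite ge0_fin_numE.
  have hF : (\int[mu]_(r in `]0%R, t[) ((1 + n (r, w)) ^+ 2)%:E <= (fine (Phi w))%:E)%E.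
    rewrite fineK//; apply: ge0_le_integral_sub.
    - by apply: subset_itv; rewrite bnd_simp//; case/andP : tT.
    - by move=> r _; rewrite lee_fin sqr_ge0.
    - by move=> r _; rewrite lee_fin.
    - by move=> r _.
  have hdrift m := @drift_weighted _ alpha s T Cf halpha T0 (ltW Cf0) lam phi hA f hf t (u ^~ w)
    (fun r => n (r, w)) (fine (Phi w)) tT (mnw w) (fun r => @nE r w) hF b hb
    (fun k => lam k `^ sigma) (gJ alpha + 1) (alpha * gam) m gJ0 p1 hdecay.
  have hsum m : \sum_(0 <= k < m) (lam k `^ sigma * inner (u t w) (phi k)) ^+ 2 <=
      2 * (A * fine (Phi w)) + 2 * fine (Z w).
    have hOm : \sum_(0 <= k < m) (lam k `^ sigma * inner (X w) (phi k)) ^+ 2 <= fine (Z w).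
      rewrite -lee_fin fineK// -sumEFin.
      exact: (@nneseries_lim_ge _ (fun k => zk k w) xpredT 0 m (fun k _ _ => zk0 k w)).
    apply: le_trans (lerD (ler_wpM2l (ler0n _ 2) (hdrift m)) (ler_wpM2l (ler0n _ 2) hOm)).
    rewrite !mulr_sumr -big_split/=; apply: ler_sum => k _.
    have -> : inner (u t w) (phi k) = inner b (phi k) + inner (X w) (phi k).
      have := nrm0_ip (phi k) (decomposition hbO); rewrite ipBl ipDl => /eqP.
      by rewrite subr_eq0 => /eqP.
    rewrite mulrDr; move: (_ * _) (_ * _) => x y.
    by have := sqr_ge0 (x - y); rewrite !expr2; lra.
  have [hdom hle _] := spectral_series_summable hphi hsum.
  split=> //; rewrite -(fineK Phif) -(fineK Zf) -!EFinM -EFinD lee_fin.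
  exact: hle.
split; first by apply: filterS key => w [].
rewrite unlock.
apply: (@le_trans _ _ (\int[P]_w (2%:E * (A%:E * Phi w) + 2%:E * Z w))%E).
  (* The norm of [Apow] is built on a selected limit and its measurability in w is not established;
     only the majorant has to be measurable. *)
  apply: ae_ge0_le_integralT.
  - by apply: emeasurable_funD; apply: measurable_funeM => //; exact: measurable_funeM.
  - by move=> w; rewrite lee_fin sqr_ge0.
  - by move=> w; rewrite adde_ge0// !mule_ge0// lee_fin.
  - by apply: filterS key => w [].
rewrite ge0_integralD//; last 4 first.
- by move=> w _; rewrite !mule_ge0// lee_fin.
- by apply: measurable_funeM; exact: measurable_funeM.
- by move=> w _; rewrite mule_ge0.
- exact: measurable_funeM.
rewrite !ge0_integralZl//; last 2 first.
- exact: measurable_funeM.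
- by move=> w _; rewrite mule_ge0// lee_fin.
rewrite [leRHS]EFinD; apply: leeD; rewrite [leRHS]EFinM; apply: lee_wpmul2l => //.
by rewrite [leRHS]EFinM; apply: lee_wpmul2l; rewrite ?lee_fin.
Qed.

End majorants.
End mild.

Unset Implicit Arguments.
Set Strict Implicit.
Set Printing Implicit Defensive.

Theorem theorem2p4 (R : realType) (d : measure_display)
    (Omega : measurableType d) (P : probability Omega R)
    (alpha s H1 H2 T Cf : R)
    (halpha : 0 < alpha < 1) (hs : 0 < s < 1)
    (hH1 : 0 < H1 <= 1 / 2) (hH2 : 0 < H2 <= 1 / 2) (hT : 0 < T)
    (lam : nat -> R) (phi : nat -> L2D R)
    (hA : dirichlet_eigensystem lam phi)
    (W : R -> R -> {RV P >-> R})
    (hW : fractional_brownian_sheet P H1 H2 T W)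
    (f : L2D R -> L2D R) (hCf : 0 < Cf)
    (hf_growth : forall v, L2norm (f v) <= Cf * (1 + L2norm v))
    (hf_lip : forall v w, L2norm (f v - f w) <= Cf * L2norm (v - w))
    (u : R -> Omega -> L2D R)
    (hu : mild_solution P W lam phi alpha s T f u)
    (hcond1 : 0 < 2 * s * H2 / alpha + H1 - 1)
    (hcond2 : 0 < H1 + 2 * s - 1) :
  forall sigma : R,
    0 <= 2 * sigma < Num.min (2 * s * H2 / alpha + H1 - 1) (H1 + 2 * s - 1) ->
    exists C : R, forall t : R, 0 <= t <= T ->
      {ae P, forall w, dom_Apow lam phi sigma (u t w)} /\
      ('E_P[fun w => (L2norm (Apow lam phi sigma (u t w)) ^+ 2)%R] <= C%:E)%E.
Proof.
move=> sigma hsigma; have /andP[a0 _] := halpha; have /andP[s0 _] := hs.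
have /andP[H20 _] := hH2; have /andP[sg0 _] := hsigma.
have [gam [gam01 agam hsg]] := exists_decay_exponent a0 s0 hH1 H20 hsigma.
have [C C0 hV] := modeK_bound s halpha hH1 hH2 (ltW hT) hA gam01 agam.
(* Since sigma >= 0, the choice of gam also makes the unweighted variances summable; their sum is
   the bound B of the moment estimate. *)
have e : 1 / 2 - H1 - 2 * s * gam < - (1 / 2) by lra.
have [B1 B10 hB1] := lam_series_bound hA e.
have [n mn nE] := measurable_L2norm (mild_measurable hu).
apply: (@mild_regularity _ _ _ P alpha s H1 H2 T Cf halpha hs hH1 hH2 hT lam phi hA W hW f u
  hCf hf_growth hu gam C gam01 agam C0 hV (C * B1) _ n mn nE sigma) => //; last by lra.
by move=> m; rewrite -mulr_sumr ler_wpM2l.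
Qed.
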